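(* Let $q=(q_1,q_2,q_3)\in\mathbb{R}_+^3$, $c=(c_1,c_2,c_3)\in\mathbb{R}^3_+$, $\nu>0$, and let $\mathcal{Y}_1,\mathcal{Y}_2,\mathcal{Y}_3,\mathcal{Y}_{12},\mathcal{Y}_{23},\mathcal{Y}_0$ be the Gaussian random fields defined in the context as stochastic integrals with respect to Gaussian white noise on $\mathbb{R}^3$. (i) These random fields are well-defined in the following parameter regions: (i1) $\mathcal{Y}_1$ is well-defined for $\frac{1}{2q_1}+\sum_{i=2}^3\frac1{q_i}<1<\sum_{i=1}^3\frac1{q_i}$; (i2) $\mathcal{Y}_2$ is well-defined for $\sum_{i=1}^2\frac1{2q_i}+\frac1{q_3}<1<\frac1{2q_1}+\sum_{i=2}^3\frac1{q_i}$; (i3) $\mathcal{Y}_3$ is well-defined for $\sum_{i=1}^3\frac1{2q_i}<1<\sum_{i=1}^2\frac1{2q_i}+\frac1{q_3}$; (i4) $\mathcal{Y}_{12}$ is well-defined for $\sum_{i=1}^2\frac1{2q_i}+\frac1{q_3}<1<\sum_{i=1}^3\frac1{q_i}$; (i5) $\mathcal{Y}_{23}$ is well-defined for $\sum_{i=1}^3\frac1{2q_i}<1<\frac1{2q_1}+\sum_{i=2}^3\frac1{q_i}$; (i6) $\mathcal{Y}_0$ is well-defined for $\sum_{i=1}^3\frac1{2q_i}<1<\sum_{i=1}^3\frac1{q_i}$. (ii) In the respective parameter regions of (i), these random fields have stationary rectangular increments and satisfy the following self-similarity properties, where $\stackrel{\rm fdd}{=}$ denotes equality of finite-dimensional distributions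 of random fields indexed by $(x_1,x_2,x_3)$: $$\mathcal{Y}_1(\lambda_1x_1,\lambda_2x_2,\lambda_3x_3)\stackrel{\rm fdd}{=}\lambda_1^{\mathcal{H}_1}\lambda_2^{1/2}\lambda_3^{1/2}\,\mathcal{Y}_1(x_1,x_2,x_3)\quad\forall\lambda_i>0,\ i=1,2,3,$$ $$\mathcal{Y}_2(\lambda_1x_1,\lambda_2x_2,\lambda_3x_3)\stackrel{\rm fdd}{=}\lambda_1\lambda_2^{\mathcal{H}_2}\lambda_3^{1/2}\,\mathcal{Y}_2(x_1,x_2,x_3)\quad\forall\lambda_i>0,\ i=1,2,3,$$ $$\mathcal{Y}_3(\lambda_1x_1,\lambda_2x_2,\lambda_3x_3)\stackrel{\rm fdd}{=}\lambda_1\lambda_2\lambda_3^{\mathcal{H}_3}\,\mathcal{Y}_3(x_1,x_2,x_3)\quad\forall\lambda_i>0,\ i=1,2,3,$$ $$\mathcal{Y}_{12}(\lambda^{1/q_1}x_1,\lambda^{1/q_2}x_2,\mu x_3)\stackrel{\rm fdd}{=}\lambda^{\mathcal{H}_{12}}\mu^{1/2}\,\mathcal{Y}_{12}(x_1,x_2,x_3)\quad\forall\lambda>0,\ \mu>0,$$ $$\mathcal{Y}_{23}(\lambda x_1,\mu^{1/q_2}x_2,\mu^{1/q_3}x_3)\stackrel{\rm fdd}{=}\lambda\mu^{\mathcal{H}_{23}}\,\mathcal{Y}_{23}(x_1,x_2,x_3)\quad\forall\lambda>0,\ \mu>0,$$ $$\mathcal{Y}_0(\lambda^{1/q_1}x_1,\lambda^{1/q_2}x_2,\lambda^{1/q_3}x_3)\stackrel{\rm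 fdd}{=}\lambda^{\mathcal{H}_0}\,\mathcal{Y}_0(x_1,x_2,x_3)\quad\forall\lambda>0,$$ where $$\mathcal{H}_1:=\tfrac32-q_1\big(1-\tfrac1{q_2}-\tfrac1{q_3}\big),\quad \mathcal{H}_2:=\tfrac32-q_2\big(1-\tfrac1{2q_1}-\tfrac1{q_3}\big),\quad \mathcal{H}_3:=\tfrac32-q_3\big(1-\tfrac1{2q_1}-\tfrac1{2q_2}\big),$$ $$\mathcal{H}_{12}:=\tfrac3{2q_1}+\tfrac3{2q_2}+\tfrac1{q_3}-1,\quad \mathcal{H}_{23}:=\tfrac1{2q_1}+\tfrac3{2q_2}+\tfrac3{2q_3}-1,\quad \mathcal{H}_0:=\sum_{i=1}^3\tfrac3{2q_i}-1.$$ (iii) In the respective parameter regions (i1), (i2), (i3), the random fields $\mathcal{Y}_i$, $i=1,2,3$, agree, up to the multiplicative constants $\sigma_i:=\big(\mathrm{E}[\mathcal{Y}_i(1,1,1)^2]\big)^{1/2}$, with a fractional Brownian sheet having two of its parameters equal to either $1/2$ or $1$; namely, $$\mathcal{Y}_1\stackrel{\rm fdd}{=}\sigma_1B_{\mathcal{H}_1,1/2,1/2},\qquad \mathcal{Y}_2\stackrel{\rm fdd}{=}\sigma_2B_{1,\mathcal{H}_2,1/2},\qquad \mathcal{Y}_3\stackrel{\rm fdd}{=}\sigma_3B_{1,1,\mathcal{H}_3}.$$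
   Context: Notation: $\mathbb{R}^3_+=\{x\in\mathbb{R}^3:x_i>0,\ i=1,2,3\}$, $\bar{\mathbb{R}}^3_+=\{x\in\mathbb{R}^3:x_i\ge0,\ i=1,2,3\}$; $\mathbf{1}(\cdot)$ is the indicator; $du=du_1du_2du_3$, $dt=dt_1dt_2dt_3$ for $u,t\in\mathbb{R}^3$. $W(du)$ is real-valued Gaussian white noise on $\mathbb{R}^3$: a centered Gaussian process indexed by Borel sets of finite Lebesgue measure with $\mathrm{E}[W(A)W(B)]=\mathrm{leb}(A\cap B)$. The stochastic integral $\int_{\mathbb{R}^3}h(u)W(du)$ is well-defined for $h\in L^2(\mathbb{R}^3)$ and is $N(0,\|h\|^2)$-distributed, with $\|h\|^2=\int_{\mathbb{R}^3} h(u)^2du$. A random field given by such integrals is well-defined if for each $x$ its integrand (the inner integral, as a function of $u$) is in $L^2(\mathbb{R}^3)$. The random fields are, for $x=(x_1,x_2,x_3)\in\bar{\mathbb{R}}^3_+$: $$\mathcal{Y}_1(x):=\int_{\mathbb{R}^3}W(du)\int_{\mathbb{R}^3}\frac{\mathbf{1}(0<u_j<x_j,\ j=2,3,\ 0<t_1<x_1)\,dt}{\big(c_1|t_1-u_1|^{q_1/\nu}+\sum_{j=2}^3c_j|t_j|^{q_j/\nu}\big)^\nu},$$ $$\mathcal{Y}_2(x):=x_1\int_{\mathbb{R}^3}W(du)\int_{\mathbb{R}^2}\frac{\mathbf{1}(0<u_3<x_3,\ 0<t_2<x_2)\,dt_2dt_3}{\big(c_1|u_1|^{q_1/\nu}+c_2|t_2-u_2|^{q_2/\nu}+c_3|t_3|^{q_3/\nu}\big)^\nu},$$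 $$\mathcal{Y}_3(x):=x_1x_2\int_{\mathbb{R}^3}W(du)\int_{\mathbb{R}}\frac{\mathbf{1}(0<t<x_3)\,dt}{\big(\sum_{j=1}^2c_j|u_j|^{q_j/\nu}+c_3|t-u_3|^{q_3/\nu}\big)^\nu},$$ $$\mathcal{Y}_{12}(x):=\int_{\mathbb{R}^3}W(du)\int_{\mathbb{R}^3}\frac{\mathbf{1}(0<t_j<x_j,\ j=1,2,\ 0<u_3<x_3)\,dt}{\big(\sum_{j=1}^2c_j|t_j-u_j|^{q_j/\nu}+c_3|t_3|^{q_3/\nu}\big)^\nu},$$ $$\mathcal{Y}_{23}(x):=x_1\int_{\mathbb{R}^3}W(du)\int_{\mathbb{R}^2}\frac{\mathbf{1}(0<t_j<x_j,\ j=2,3)\,dt_2dt_3}{\big(c_1|u_1|^{q_1/\nu}+\sum_{j=2}^3c_j|t_j-u_j|^{q_j/\nu}\big)^\nu},$$ $$\mathcal{Y}_0(x):=\int_{\mathbb{R}^3}W(du)\int_{\mathbb{R}^3}\frac{\mathbf{1}(0<t_j<x_j,\ j=1,2,3)\,dt}{\big(\sum_{j=1}^3c_j|t_j-u_j|^{q_j/\nu}\big)^\nu}.$$ Stationary rectangular increments: write $y\prec x$ if $y_i<x_i$ for $i=1,2,3$, and $K(y,x)=\prod_{i=1}^3(y_i,x_i]$. The rectangular increment of $V=\{V(x);x\in\bar{\mathbb{R}}^3_+\}$ on $K(y,x)$ is $$V(K(y,x)):=V(x_1,x_2,x_3)-V(x_1,x_2,y_3)-V(x_1,y_2,x_3)-V(y_1,x_2,x_3)+V(x_1,y_2,y_3)+V(y_1,x_2,y_3)+V(y_1,y_2,x_3)-V(y_1,y_2,y_3).$$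 $V$ has stationary rectangular increments if for any $y\in\bar{\mathbb{R}}^3_+$, $\{V(K(y,x)),\,y\prec x\}\stackrel{\rm fdd}{=}\{V(K(0,x-y)),\,y\prec x\}$. Fractional Brownian sheet: for $0<H_i\le1$, $i=1,2,3$, $B_{H_1,H_2,H_3}$ is the Gaussian process on $\bar{\mathbb{R}}^3_+$ with zero mean and covariance $\mathrm{E}[B_{H_1,H_2,H_3}(x)B_{H_1,H_2,H_3}(y)]=\frac18\prod_{j=1}^3\big(x_j^{2H_j}+y_j^{2H_j}-|x_j-y_j|^{2H_j}\big)$. *)

(* Defs.v *)
From HB Require Import structures.
From mathcomp Require Import all_boot all_order all_algebra.
From mathcomp Require Import all_classical all_reals all_analysis.
From mathcomp Require Import measurable_realfun.

Set Implicit Arguments.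
Unset Strict Implicit.
Unset Printing Implicit Defensive.

Import Order.TTheory GRing.Theory Num.Theory.
Import numFieldNormedType.Exports.

Local Open Scope classical_set_scope.
Local Open Scope ring_scope.

(* Points of R^3 are nested pairs, so that R^3 carries the library's product
   sigma-algebra (the Borel sets) and product measure. *)
Notation R3 R := (R * R * R)%type.

Section coordinates.
Context {R : realType}.
Implicit Types x y : R3 R.

Definition co1 x : R := x.1.1.
Definition co2 x : R := x.1.2.
Definition co3 x : R := x.2.

Definition open_orthant : set (R3 R) :=
  [set x | [/\ 0 < co1 x, 0 < co2 x & 0 < co3 x]].

Definition closed_orthant : set (R3 R) :=
  [set x | [/\ 0 <= co1 x, 0 <= co2 x & 0 <= co3 x]].

Definition prec3 y x : Prop :=
  [/\ co1 y < co1 x, co2 y < co2 x & co3 y < co3 x].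

Definition sub3 x y : R3 R := (co1 x - co1 y, co2 x - co2 y, co3 x - co3 y).

Definition scale3 (a b c : R) x : R3 R := (a * co1 x, b * co2 x, c * co3 x).

End coordinates.

Definition leb2 (R : realType) := (@lebesgue_measure R \x @lebesgue_measure R)%E.
Arguments leb2 R : clear implicits.

Definition leb3 (R : realType) := (leb2 R \x @lebesgue_measure R)%E.
Arguments leb3 R : clear implicits.

Section finite_dimensional_distributions.
Context {R : realType}.

(* X1 and X2 may live on different probability spaces; B ranges over the Borel
   sets of R^n. *)
Definition fdd_eq (I : Type) (D : set I)
    d1 (T1 : measurableType d1) (P1 : probability T1 R)
    d2 (T2 : measurableType d2) (P2 : probability T2 R)
    (X1 : I -> T1 -> R) (X2 : I -> T2 -> R) : Prop :=
  forall (n : nat) (t : 'I_n -> I), (forall i, D (t i)) ->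
  forall B : set (n.-tuple R), measurable B ->
    P1 [set w | B [tuple X1 (t i) w | i < n]] =
    P2 [set w | B [tuple X2 (t i) w | i < n]].

Context d (T : measurableType d) (P : probability T R).

(* Normal law N(m, s^2), degenerate case included: the library's
   normal_prob m s is meant for s != 0 (it is uniform on [0, 1] for s = 0). *)
Definition gaussian_rv (X : T -> R) : Prop :=
  measurable_fun setT X /\
  exists m s : R, forall A : set R, measurable A ->
    P (X @^-1` A) = if s == 0 then \d_m A else normal_prob m s A.

Definition gaussian_process (I : Type) (D : set I) (X : I -> T -> R) : Prop :=
  forall (n : nat) (t : 'I_n -> I) (a : 'I_n -> R), (forall i, D (t i)) ->
    gaussian_rv (fun w => \sum_(i < n) a i * X (t i) w).

Definition centered (I : Type) (D : set I) (X : I -> T -> R) : Prop :=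
  forall t, D t -> 'E_P[X t]%E = 0%E.

End finite_dimensional_distributions.

Section white_noise.
Context {R : realType} d (T : measurableType d) (P : probability T R).

Definition finite_borel : set (set (R3 R)) :=
  [set A | measurable A /\ (leb3 R A < +oo)%E].

(* Only the values of W on finite_borel matter. *)
Definition white_noise (W : set (R3 R) -> T -> R) : Prop :=
  [/\ gaussian_process P finite_borel W,
      centered P finite_borel W &
      forall A B, finite_borel A -> finite_borel B ->
        'E_P[fun w => (W A w * W B w)%R]%E = leb3 R (A `&` B)].

Definition in_L2 (h : R3 R -> \bar R) : Prop :=
  measurable_fun setT h /\ (\int[leb3 R]_u (h u ^+ 2) < +oo)%E.

(* X is a version of \int h dW: the integral of a simple function
   \sum_i a_i 1_(A_i) is \sum_i a_i W(A_i), and X is the L^2(P) limit of such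
   integrals along simple functions tending to h in L^2(R^3).
   By the isometry E[(\int s dW)^2] = |s|^2, X is unique up to P-null sets. *)
Definition wiener_integral (W : set (R3 R) -> T -> R)
    (h : R3 R -> \bar R) (X : T -> R) : Prop :=
  measurable_fun setT X /\
  forall e : R, 0 < e ->
    exists (n : nat) (a : 'I_n -> R) (A : 'I_n -> set (R3 R)),
    [/\ forall i, finite_borel (A i),
        (\int[leb3 R]_u
           ((h u - (\sum_(i < n) a i * \1_(A i) u)%:E) ^+ 2) < e%:E)%E &
        ('E_P[fun w => ((X w - \sum_(i < n) a i * W (A i) w) ^+ 2)%R] < e%:E)%E].

End white_noise.

Section kernels.
Context {R : realType} (q c : R3 R) (nu : R).
Implicit Types x u t : R3 R.

Definition rho (z1 z2 z3 : R) : R :=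
  (co1 c * `|z1| `^ (co1 q / nu) + co2 c * `|z2| `^ (co2 q / nu)
   + co3 c * `|z3| `^ (co3 q / nu)) `^ nu.

(* Integrands with respect to W(du).  The inverse of 0 is 0 here instead of
   +oo, which concerns at most one point t of each inner integral. *)

Definition g1 x u : \bar R :=
  (\int[leb3 R]_t
     (([&& 0 < co2 u < co2 x, 0 < co3 u < co3 x & 0 < co1 t < co1 x]%R%:R
       * (rho (co1 t - co1 u) (co2 t) (co3 t))^-1)%R)%:E)%E.

(* the integration variable is (t2, t3) *)
Definition g2 x u : \bar R :=
  (\int[leb2 R]_t
     ((((0 < co3 u < co3 x) && (0 < t.1 < co2 x))%R%:R
       * (rho (co1 u) (t.1 - co2 u) t.2)^-1)%R)%:E)%E.

Definition g3 x u : \bar R :=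
  (\int[@lebesgue_measure R]_t
     (((0 < t < co3 x)%R%:R
       * (rho (co1 u) (co2 u) (t - co3 u))^-1)%R)%:E)%E.

Definition g12 x u : \bar R :=
  (\int[leb3 R]_t
     (([&& 0 < co1 t < co1 x, 0 < co2 t < co2 x & 0 < co3 u < co3 x]%R%:R
       * (rho (co1 t - co1 u) (co2 t - co2 u) (co3 t))^-1)%R)%:E)%E.

(* the integration variable is (t2, t3) *)
Definition g23 x u : \bar R :=
  (\int[leb2 R]_t
     ((((0 < t.1 < co2 x) && (0 < t.2 < co3 x))%R%:R
       * (rho (co1 u) (t.1 - co2 u) (t.2 - co3 u))^-1)%R)%:E)%E.

Definition g0 x u : \bar R :=
  (\int[leb3 R]_t
     (([&& 0 < co1 t < co1 x, 0 < co2 t < co2 x & 0 < co3 t < co3 x]%R%:R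
       * (rho (co1 t - co1 u) (co2 t - co2 u) (co3 t - co3 u))^-1)%R)%:E)%E.

End kernels.

Section fields.
Context {R : realType}.

Definition well_defined (g : R3 R -> R3 R -> \bar R) : Prop :=
  forall x, closed_orthant x -> in_L2 (g x).

Context d (T : measurableType d) (P : probability T R).
Implicit Types Y : R3 R -> T -> R.

(* Y x = a x * \int g x u W(du) for x in the closed orthant *)
Definition is_field (W : set (R3 R) -> T -> R) (a : R3 R -> R)
    (g : R3 R -> R3 R -> \bar R) Y : Prop :=
  forall x, closed_orthant x ->
    exists2 Z, wiener_integral P W (g x) Z & Y x = (fun w => a x * Z w).

Context (W : set (R3 R) -> T -> R) (q c : R3 R) (nu : R).

Definition is_Y1 := is_field W (fun=> 1) (g1 q c nu).
Definition is_Y2 := is_field W (fun x => co1 x) (g2 q c nu).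
Definition is_Y3 := is_field W (fun x => co1 x * co2 x) (g3 q c nu).
Definition is_Y12 := is_field W (fun=> 1) (g12 q c nu).
Definition is_Y23 := is_field W (fun x => co1 x) (g23 q c nu).
Definition is_Y0 := is_field W (fun=> 1) (g0 q c nu).

Definition rect_increment Y (y x : R3 R) : T -> R := fun w =>
  Y (co1 x, co2 x, co3 x) w
  - Y (co1 x, co2 x, co3 y) w - Y (co1 x, co2 y, co3 x) w
  - Y (co1 y, co2 x, co3 x) w
  + Y (co1 x, co2 y, co3 y) w + Y (co1 y, co2 x, co3 y) w
  + Y (co1 y, co2 y, co3 x) w
  - Y (co1 y, co2 y, co3 y) w.

Definition stationary_rect_increments Y : Prop :=
  forall y, closed_orthant y ->
    fdd_eq [set x | prec3 y x] P P
      (fun x => rect_increment Y y x)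
      (fun x => rect_increment Y (0, 0, 0) (sub3 x y)).

End fields.

Section parameters.
Context {R : realType} (q : R3 R).
Let q1 := co1 q.
Let q2 := co2 q.
Let q3 := co3 q.

Definition region1 : Prop :=
  1 / (2 * q1) + (1 / q2 + 1 / q3) < 1 < 1 / q1 + 1 / q2 + 1 / q3.
Definition region2 : Prop :=
  1 / (2 * q1) + 1 / (2 * q2) + 1 / q3 < 1 < 1 / (2 * q1) + (1 / q2 + 1 / q3).
Definition region3 : Prop :=
  1 / (2 * q1) + 1 / (2 * q2) + 1 / (2 * q3) < 1
    < 1 / (2 * q1) + 1 / (2 * q2) + 1 / q3.
Definition region12 : Prop :=
  1 / (2 * q1) + 1 / (2 * q2) + 1 / q3 < 1 < 1 / q1 + 1 / q2 + 1 / q3.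
Definition region23 : Prop :=
  1 / (2 * q1) + 1 / (2 * q2) + 1 / (2 * q3) < 1
    < 1 / (2 * q1) + (1 / q2 + 1 / q3).
Definition region0 : Prop :=
  1 / (2 * q1) + 1 / (2 * q2) + 1 / (2 * q3) < 1 < 1 / q1 + 1 / q2 + 1 / q3.

Definition H1 : R := 3 / 2 - q1 * (1 - 1 / q2 - 1 / q3).
Definition H2 : R := 3 / 2 - q2 * (1 - 1 / (2 * q1) - 1 / q3).
Definition H3 : R := 3 / 2 - q3 * (1 - 1 / (2 * q1) - 1 / (2 * q2)).
Definition H12 : R := 3 / (2 * q1) + 3 / (2 * q2) + 1 / q3 - 1.
Definition H23 : R := 1 / (2 * q1) + 3 / (2 * q2) + 3 / (2 * q3) - 1.
Definition H0 : R := 3 / (2 * q1) + 3 / (2 * q2) + 3 / (2 * q3) - 1.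

End parameters.

Section fractional_brownian_sheet.
Context {R : realType}.

Definition is_fBs d (T : measurableType d) (P : probability T R)
    (h1 h2 h3 : R) (B : R3 R -> T -> R) : Prop :=
  [/\ [/\ 0 < h1 <= 1, 0 < h2 <= 1 & 0 < h3 <= 1],
      gaussian_process P closed_orthant B,
      centered P closed_orthant B &
      forall x y, closed_orthant x -> closed_orthant y ->
        'E_P[fun w => (B x w * B y w)%R]%E =
        (8^-1 *
         ((co1 x `^ (2 * h1) + co1 y `^ (2 * h1) - `|co1 x - co1 y| `^ (2 * h1))
        * (co2 x `^ (2 * h2) + co2 y `^ (2 * h2) - `|co2 x - co2 y| `^ (2 * h2))
        * (co3 x `^ (2 * h3) + co3 y `^ (2 * h3)
           - `|co3 x - co3 y| `^ (2 * h3))))%:E].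

Context d (T : measurableType d) (P : probability T R).

(* sigma = E[Y(1,1,1)^2]^(1/2) *)
Definition sigma (Y : R3 R -> T -> R) : R :=
  Num.sqrt (fine 'E_P[fun w => (Y (1, 1, 1) w ^+ 2)%R]).

(* Y has the finite-dimensional distributions of s * B_(h1,h2,h3).  The sheet is
   determined in law only, so Y is compared with all of its versions; the first
   clause says that there are some. *)
Definition fdd_eq_fBs (Y : R3 R -> T -> R) (s h1 h2 h3 : R) : Prop :=
  (exists d' (T' : measurableType d') (P' : probability T' R)
     (B : R3 R -> T' -> R), is_fBs P' h1 h2 h3 B) /\
  forall d' (T' : measurableType d') (P' : probability T' R)
    (B : R3 R -> T' -> R), is_fBs P' h1 h2 h3 B ->
    fdd_eq closed_orthant P P' Y (fun x w => s * B x w).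

End fractional_brownian_sheet.

(* Main.v *)
Require Import Defs.
From HB Require Import structures.
From mathcomp Require Import all_boot all_order all_algebra.
From mathcomp Require Import all_classical all_reals all_analysis.
From mathcomp Require Import measurable_realfun.
From mathcomp Require Import ring lra.

Set Implicit Arguments.
Unset Strict Implicit.
Unset Printing Implicit Defensive.

Import Order.TTheory GRing.Theory Num.Theory.
Import numFieldNormedType.Exports.

Local Open Scope classical_set_scope.
Local Open Scope ring_scope.

(** Each integrand is, up to null sets and the factors [x_j], the function of [u]
    obtained by integrating over [t] the product of the indicators of
    [0 < w_j <= x_j] and of [1 / rho(z)], where on each axis [(w_j, z_j)] is
    [(u_j, t_j)], [(t_j, t_j - u_j)] or [(t_j, u_j)]; in the last case the
    integral over [t_j] only produces [x_j].  It is square integrable since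
    [1 / rho] is at most a constant times a product of functions of one [z_j],
    powers [|z_j|^-a_j] near 0 and [|z_j|^-b_j] at infinity, whose exponents can
    be chosen because [1] lies between the two sums defining the region.

    The Wiener integral is an isometry and centered Gaussian families are
    determined by their covariances (Cramer-Wold), so stationarity and
    self-similarity are changes of variables, translations and dilations of
    [(u, t)], in the covariance [D(x, y)], an integral over [u].

    For the fractional Brownian sheets, [D(x, y)] does not change when [x_j] and
    [y_j] are exchanged on an axis of the first or third kind: in the first
    case the integrand only depends on [min(x_j, y_j)], in the third it is
    linear in [x_j] and in [y_j].  As [D] is symmetric, this holds on the one
    remaining axis as well.  With homogeneity and stationary increments in each
    [x_j], polarization gives
    [2 d(s, s') = (s^(2h) + s'^(2h) - |s - s'|^(2h)) d(1, 1)] axis by axis. *)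

(** The six fields are not treated one by one: each is the same integral over [t] in R^3 with an
    [axis_kind] per axis, and the kinds decide the integrability thresholds (the coefficients of
    [1 / q_j] in the two sums of a region), the Jacobians and the symmetries of the covariance.
    Boxes are half-open because these can be cut without remainder, so that a rectangular increment
    is the integral over a single box; the open boxes of the definitions differ from them on null
    sets only.

    No moment and no characteristic function of the normal law is computed. [W] of the unit cube has
    mean 0 and variance 1 by the definition of white noise, and every centered Gaussian variable is
    compared in law with a multiple of it. L^2 limits of Gaussian variables are reached through the
    means of [cos (X + phi)]. That such means determine a law is shown by producing the indicators
    of measurable sets from cosines by linear combinations and bounded pointwise limits.

    A sheet is shown to exist by dividing the field by its standard deviation at [(1, 1, 1)], hence
    the need for a strictly positive lower bound of the covariance there. *)

(** * Trigonometric polynomials determine the law of a random vector *)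

Section sign_polynomial.
Context {R : realType}.
Implicit Types x y : R.

(* [1 - sgn_step y = (1 - y)^2 (2 + y) / 2], so that the iterates of
   [sgn_step] tend to the sign of [y] on [[-1, 1]]. *)
Definition sgn_step y : R := 3 / 2 * y - y * y * y / 2.

Lemma sgn_step_bound y : `|y| <= 1 -> `|sgn_step y| <= 1.
Proof.
rewrite !ler_norml => /andP[a b].
have h1 : 0 <= (1 - y) ^+ 2 * (2 + y) by rewrite mulr_ge0 ?sqr_ge0//; lra.
have h2 : 0 <= (1 + y) ^+ 2 * (2 - y) by rewrite mulr_ge0 ?sqr_ge0//; lra.
rewrite /sgn_step; apply/andP; split; nra.
Qed.

Lemma iter_sgn_step_bound y k : `|y| <= 1 -> `|iter k sgn_step y| <= 1.
Proof. by move=> y1; elim: k => //= k; exact: sgn_step_bound. Qed.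

(** One step multiplies [1 - z] by [1 - (z + z ^+ 2) / 2]. Iterates never fall below the starting
    point [y], so this factor is at most the fixed number [1 - y / 2] and the convergence to 1 is
    geometric. *)
Lemma iter_sgn_step_pos y k : 0 < y <= 1 ->
  [/\ y <= iter k sgn_step y, iter k sgn_step y <= 1 &
      1 - iter k sgn_step y <= (1 - y / 2) ^+ k].
Proof.
move=> /andP[y0 y1]; elim: k => [|k [ge1 le1 IH]].
  by rewrite expr0; split => //=; lra.
rewrite iterS exprS; set z := iter k sgn_step y in ge1 le1 IH *.
have z1 : `|z| <= 1 by rewrite ler_norml; apply/andP; split; lra.
have := sgn_step_bound z1; rewrite ler_norml => /andP[_ l1].
have h : 0 <= (1 - z) * (z - y + z * z).
  by apply: mulr_ge0; have := sqr_ge0 z; rewrite ?expr2; lra.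
have e1 : 1 - sgn_step z <= (1 - y / 2) * (1 - z).
  by rewrite /sgn_step; nra.
split => //.
- have : 0 <= (1 - z) * (1 + z) * z by rewrite !mulr_ge0//; lra.
  rewrite /sgn_step; nra.
- by apply: (le_trans e1); rewrite ler_wpM2l//; lra.
Qed.

Lemma iter_sgn_stepN y k : iter k sgn_step (- y) = - iter k sgn_step y.
Proof. by elim: k => //= k ->; rewrite /sgn_step; ring. Qed.

Lemma iter_sgn_step0 k : iter k sgn_step 0 = 0.
Proof. by elim: k => //= k ->; rewrite /sgn_step; ring. Qed.

Lemma iter_sgn_step_cvg y : `|y| <= 1 ->
  iter k sgn_step y @[k --> \oo] --> Num.sg y.
Proof.
wlog y0 : y / 0 <= y.
  move=> H; have [y0|] := leP 0 y; first exact: H.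
  have [z ->] : exists z, y = - z by exists (- y); rewrite opprK.
  rewrite sgrN normrN => z0 z1.
  under eq_fun do rewrite iter_sgn_stepN.
  by apply: (@cvgN _ R^o); apply: H => //; lra.
rewrite ger0_norm// => y1.
move: y0; rewrite le_eqVlt => /predU1P[<-|y0].
  rewrite sgr0; under eq_fun do rewrite iter_sgn_step0.
  exact: cvg_cst.
rewrite gtr0_sg//.
apply: (@squeeze_cvgr _ _ _ _ (fun k => 1 - (1 - y / 2) ^+ k) (fun=> 1)).
- near=> k; have [] := @iter_sgn_step_pos y k; first by rewrite y0.
  by move=> _ h1 h2; apply/andP; split => //; lra.
- rewrite -[X in _ --> X]subr0; apply: (@cvgB _ R^o).
    exact: cvg_cst.
  by apply: cvg_expr; rewrite ger0_norm; lra.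
- exact: cvg_cst.
Unshelve. all: by end_near. Qed.

End sign_polynomial.

Section trigonometric_class.
Context {R : realType} (n : nat).
Implicit Types (f g : n.-tuple R -> R).

Definition wave (a : 'I_n -> R) (phi : R) (x : n.-tuple R) : R :=
  cos (\sum_(i < n) a i * tnth x i + phi).

(** Every constructor preserves equality of integrals under two laws: linearity for sums and
    multiples, dominated convergence for [trig_lim]. The uniform bound [M] is what dominated
    convergence asks for, and it also keeps products within the class. *)
Inductive trig_class : (n.-tuple R -> R) -> Prop :=
| trig_wave a phi : trig_class (wave a phi)
| trigD f g : trig_class f -> trig_class g -> trig_class (fun x => f x + g x)
| trigZ k f : trig_class f -> trig_class (fun x => k * f x)
| trig_lim (f_ : nat -> n.-tuple R -> R) f (M : R) :
    (forall k, trig_class (f_ k)) -> (forall k x, `|f_ k x| <= M) ->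
    (forall x, f_ k x @[k --> \oo] --> f x) -> trig_class f.

Lemma trig_class_bounded f : trig_class f -> exists M, forall x, `|f x| <= M.
Proof.
elim=> {f} [a phi|f g _ [M Mf] _ [N Ng]|k f _ [M Mf]|f_ f M _ _ Mf cf].
- by exists 1 => x; exact: cos_max.
- by exists (M + N) => x; rewrite (le_trans (ler_normD _ _))// lerD.
- by exists (`|k| * M) => x; rewrite normrM ler_wpM2l.
- exists M => x; have h : `|f_ k x| @[k --> \oo] --> `|f x|.
    apply: cvg_norm. exact: cf.
  by apply: (cvgr_to_le h); exact: nearW.
Qed.

Lemma trig_cst (k : R) : trig_class (fun=> k).
Proof.
rewrite (_ : (fun=> k) = fun x => k * wave (fun=> 0) 0 x); last first.
  apply/funext => x; rewrite /wave big1 ?addr0 ?cos0 ?mulr1// => i _.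
  by rewrite mul0r.
exact/trigZ/trig_wave.
Qed.

Lemma trigB f g : trig_class f -> trig_class g -> trig_class (fun x => f x - g x).
Proof.
move=> tf tg; rewrite (_ : (fun x => _) = fun x => f x + -1 * g x).
  exact/trigD/trigZ.
by apply/funext => x; rewrite mulN1r.
Qed.

Lemma wave_mul a b phi psi x : wave a phi x * wave b psi x =
  2^-1 * wave (fun i => a i + b i) (phi + psi) x +
  2^-1 * wave (fun i => a i - b i) (phi - psi) x.
Proof.
rewrite /wave.
under [in RHS]eq_bigr do rewrite mulrDl.
rewrite big_split/=.
under [in X in cos (X + (phi - psi))]eq_bigr do rewrite mulrBl.
rewrite sumrB; set u := \sum_(i < n) _; set v := \sum_(i < n) _.
rewrite (_ : u + v + _ = (u + phi) + (v + psi)); last by ring.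
rewrite (_ : u - v + _ = (u + phi) - (v + psi)); last by ring.
set U := u + phi; set V := v + psi; by rewrite (cosD U) cosB; field.
Qed.

(** Induction on each factor in turn. A product of two cosines is half a sum of two cosines, and a
    bounded limit in one factor passes to the product because the other factor is bounded. *)
Lemma trigM f g : trig_class f -> trig_class g -> trig_class (fun x => f x * g x).
Proof.
move=> tf tg; have [N Ng] := trig_class_bounded tg.
elim: tf => {f} [a phi|f1 f2 _ h1 _ h2|k f _ h|f_ f M _ h Mf cf].
- elim: tg {N Ng} => {g} [b psi|g1 g2 _ h1 _ h2|k g _ h|g_ g M _ h Mg cg].
  + under eq_fun do rewrite wave_mul.
    by apply: trigD; apply: trigZ; exact: trig_wave.
  + by under eq_fun do rewrite mulrDr; exact: trigD.
  + by under eq_fun do rewrite mulrCA; exact: trigZ.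
  + apply: (trig_lim h (M := M)) => [k x|x].
      by rewrite normrM -[leRHS]mul1r ler_pM// cos_max.
    by apply: (@cvgM R); [exact: cvg_cst|exact: cg].
- by under eq_fun do rewrite mulrDl; exact: trigD.
- by under eq_fun do rewrite -mulrA; exact: trigZ.
- apply: (trig_lim h (M := M * N)) => [k x|x].
    by rewrite normrM ler_pM.
  by apply: (@cvgM R); [exact: cf|exact: cvg_cst].
Qed.

Lemma trig_iter_sgn_step f k : trig_class f ->
  trig_class (fun x => iter k sgn_step (f x)).
Proof.
move=> tf; elim: k => //= k IH; rewrite /sgn_step.
apply: trigB; first exact: trigZ.
under eq_fun do rewrite mulrC.
by apply: trigZ; do 2 apply: trigM => //.
Qed.

(** A square wave: polynomials in a sine stay in the class, and the iterates of [sgn_step] carry the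
    sine to its sign. *)
Lemma trig_sgn_sin (c b : R) (i : 'I_n) :
  trig_class (fun x => Num.sg (sin (c * (b - tnth x i)))).
Proof.
have sE : (fun x : n.-tuple R => sin (c * (b - tnth x i))) =
          wave (fun j => if j == i then - c else 0) (c * b - pi / 2).
  apply/funext => x; rewrite -cosBpihalf /wave (bigD1 i)//= eqxx big1.
    by congr cos; ring.
  by move=> j /negbTE ->; rewrite mul0r.
pose f_ k := fun x : n.-tuple R => iter k sgn_step (sin (c * (b - tnth x i))).
apply: (@trig_lim f_ _ 1) => [k|k x|x].
- apply: (@trig_iter_sgn_step (fun x => sin (c * (b - tnth x i)))).
  by rewrite sE; exact: trig_wave.
- by apply: iter_sgn_step_bound; exact: sin_max.
- by apply: iter_sgn_step_cvg; exact: sin_max.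
Qed.

(** Square waves of growing period. Once [k.+1] exceeds [|b - tnth x i|], the argument of the sine
    lies in [(-pi, pi)], where the sine has the sign of its argument; the sequence is then
    constant. *)
Lemma trig_sgn (b : R) (i : 'I_n) : trig_class (fun x => Num.sg (b - tnth x i)).
Proof.
pose f_ k := fun x : n.-tuple R => Num.sg (sin (k.+1%:R^-1 * (b - tnth x i))).
apply: (@trig_lim f_ _ 1) => [k|k x|x].
- exact: trig_sgn_sin.
- by rewrite /f_ normr_sg; case: eqP.
- apply: cvg_near_cst; set y := b - tnth x i.
  near=> k; rewrite /f_ -/y.
  have k0 : (0 : R) < k.+1%:R by [].
  have yk : `|y| < k.+1%:R.
    apply: (@lt_le_trans _ _ k%:R); last by rewrite ler_nat.
    by near: k; exact: nbhs_infty_gtr.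
  have pi1 : (1 : R) < pi by have := @pi_ge2 R; lra.
  have h : `|k.+1%:R^-1 * y| < pi.
    rewrite normrM gtr0_norm ?invr_gt0// mulrC ltr_pdivrMr//.
    by rewrite (lt_le_trans yk)// ler_peMl// ltW.
  have [y0|y0|y0] := ltgtP 0 y; last by rewrite -y0 mulr0 sin0.
  + rewrite !gtr0_sg// sin_gt0_pi// mulr_gt0 ?invr_gt0//=.
    exact: le_lt_trans (ler_norm _) h.
  + rewrite -(opprK y) mulrN sinN [in RHS]sgrN [in LHS]sgrN; congr (- _).
    rewrite !gtr0_sg ?oppr_gt0// sin_gt0_pi// mulr_gt0 ?invr_gt0 ?oppr_gt0//=.
    by rewrite mulrN; apply: le_lt_trans h; rewrite -normrN ler_norm.
Unshelve. all: by end_near. Qed.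

Lemma trig_indic_lt (b : R) (i : 'I_n) :
  trig_class (\1_[set x | tnth x i < b] : n.-tuple R -> R).
Proof.
(* With the threshold [b] itself the value at [tnth x i = b] would be 1/2, since [Num.sg 0 = 0]. A
   threshold slightly below [b] gives 0 there for every [k], and each point below [b] is still
   reached eventually. *)
pose f_ (k : nat) (x : n.-tuple R) : R :=
  2^-1 * (1 + Num.sg ((b - k.+1%:R^-1) - tnth x i)).
apply: (@trig_lim f_ _ 1) => [k|k x|x].
- by apply: trigZ; apply: trigD; [exact: trig_cst|exact: trig_sgn].
- rewrite /f_; set s := Num.sg _; have : `|s| <= 1 by rewrite normr_sg; case: eqP.
  by rewrite !ler_norml => /andP[? ?]; apply/andP; split; lra.
- apply: cvg_near_cst; rewrite indicE.
  have [xb|xb] := ltP (tnth x i) b.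
  + have d0 : 0 < b - tnth x i by rewrite subr_gt0.
    near=> k; rewrite /f_ mem_set// gtr0_sg; first by rewrite mulr1n; lra.
    have : k.+1%:R^-1 < b - tnth x i.
      by near: k; exact: (near_infty_natSinv_lt (PosNum d0)).
    by rewrite addrAC subr_gt0.
  + near=> k; rewrite /f_ memNset /=; last by apply/negP; rewrite -leNgt.
    rewrite ltr0_sg; first by rewrite mulr0n; lra.
    by rewrite addrAC subr_lt0 (@le_lt_trans _ _ 0)// subr_le0.
Unshelve. all: by end_near. Qed.

Definition trig_set (B : set (n.-tuple R)) := trig_class (\1_B : _ -> R).

Lemma trig_setC B : trig_set B -> trig_set (~` B).
Proof.
rewrite /trig_set => tB; rewrite (_ : \1_(~` B) = fun x => 1 - \1_B x :> R).
  by apply: trigB => //; exact: trig_cst.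
by rewrite -setTD; apply/funext => x; rewrite !indicE in_setD in_setT/=;
  case: (x \in B); rewrite /= ?subrr ?subr0.
Qed.

Lemma trig_set0 : trig_set set0.
Proof. by rewrite /trig_set indic0; exact: trig_cst. Qed.

Lemma trig_setI A B : trig_set A -> trig_set B -> trig_set (A `&` B).
Proof.
rewrite /trig_set => tA tB; rewrite (_ : \1_(A `&` B) = fun x => \1_A x * \1_B x :> R).
  exact: trigM.
by rewrite indicI.
Qed.

Lemma trig_bigcap_mkord (F : nat -> set (n.-tuple R)) k :
  (forall j, trig_set (F j)) -> trig_set (\big[setI/setT]_(j < k) F j).
Proof.
move=> tF; elim: k => [|k IH].
  by rewrite big_ord0 -setC0; exact/trig_setC/trig_set0.
by rewrite big_ord_recr; exact: trig_setI.
Qed.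

Lemma trig_bigcap (F : nat -> set (n.-tuple R)) :
  (forall j, trig_set (F j)) -> trig_set (\bigcap_j F j).
Proof.
move=> tF; apply: (@trig_lim (fun k => \1_(\big[setI/setT]_(j < k) F j)) _ 1).
- by move=> k; exact: trig_bigcap_mkord.
- by move=> k x; rewrite indicE ger0_norm// lern1 leq_b1.
- move=> x; apply: cvg_near_cst.
  have [Fx|] := pselect ((\bigcap_j F j) x).
    near=> k; rewrite !indicE !mem_set// -bigcap_mkord => j _; exact: Fx.
  move=> Fx; have /existsNP[j /not_implyP[_ Fj]] := Fx.
  near=> k; rewrite !indicE !memNset// -bigcap_mkord => /(_ j) /= Fk.
  by apply/Fj/Fk; near: k; exact: nbhs_infty_gt.
Unshelve. all: by end_near. Qed.

Lemma trig_set_sigma_algebra : sigma_algebra setT trig_set.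
Proof.
split; first exact: trig_set0.
- by move=> A tA; rewrite setTD; exact: trig_setC.
- move=> F tF; rewrite -(setCK (\bigcup_ _ _)) setC_bigcup.
  by apply: trig_setC; apply: trig_bigcap => j; exact: trig_setC.
Qed.

(** Closure of [trig_class] under products makes [trig_set] stable under intersections, hence a
    sigma-algebra and not merely a Dynkin system; it is enough to reach the generators. *)
Lemma measurable_trig_set (B : set (n.-tuple R)) : measurable B -> trig_set B.
Proof.
apply: smallest_sub; first exact: trig_set_sigma_algebra.
move=> C; rewrite -bigcup_seq/= => -[i _ [A mA <-]]; rewrite setTI.
(* The generators are preimages of arbitrary Borel sets under one coordinate; a second sigma-algebra
   argument, on the line, reduces them to rays. *)
pose G : set (set R) := [set A | trig_set (@tnth n R ^~ i @^-1` A)].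
have sG : sigma_algebra setT G.
  split.
  - by rewrite /G/= preimage_set0; exact: trig_set0.
  - by move=> D; rewrite /G/= setTD preimage_setC; exact: trig_setC.
  - move=> F; rewrite /G/= preimage_bigcup.
    by case: trig_set_sigma_algebra => _ _; exact.
have : G A; last by [].
have : (RGenInftyO.G (R:=R)).-sigma.-measurable A.
  by rewrite -RGenInftyO.measurableE.
apply: (smallest_sub sG) => D [b ->]; rewrite /G/=.
rewrite (_ : _ @^-1` _ = [set x : n.-tuple R | tnth x i < b]).
  exact: trig_indic_lt.
by apply/seteqP; split => x /=; rewrite in_itv.
Qed.

Lemma measurable_wave a phi : measurable_fun setT (wave a phi).
Proof.
apply: measurableT_comp => //; first exact: continuous_measurable_fun (@continuous_cos R).
apply: measurable_funD => //; apply: measurable_sum => i.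
by apply: measurable_funM => //; exact: measurable_tnth.
Qed.

Section two_laws.
Variables mu1 mu2 : probability (n.-tuple R) R.
Hypothesis mu12 : forall a phi,
  (\int[mu1]_x (wave a phi x)%:E = \int[mu2]_x (wave a phi x)%:E)%E.

(** Measurability is carried along in the induction because it is not part of [trig_class], while
    linearity and dominated convergence both require it. *)
Lemma trig_class_integral f : trig_class f -> measurable_fun setT f /\
  (\int[mu1]_x (f x)%:E = \int[mu2]_x (f x)%:E)%E.
Proof.
have bnd_int (mu : probability (n.-tuple R) R) g : trig_class g ->
    measurable_fun setT g -> mu.-integrable setT (EFin \o g).
  move=> /trig_class_bounded[M Mg] mg.
  apply: (@measurable_bounded_integrable _ _ _ mu _ _ measurableT) => //.
    by rewrite (le_lt_trans (probability_le1 _ _))// ltry.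
  exists M; split; first by rewrite num_real.
  by move=> N MN x _; exact: le_trans (Mg x) (ltW MN).
elim=> {f} [a phi|f g tf [mf ef] tg [mg eg]|k f tf [mf ef]|f_ f M tf_ h Mf cf].
- by split; [exact: measurable_wave|exact: mu12].
- split; first exact: measurable_funD.
  under eq_integral do rewrite EFinD.
  under [RHS]eq_integral do rewrite EFinD.
  by rewrite !integralD//= ?ef ?eg//; exact: bnd_int.
- split; first exact: measurable_funM.
  under eq_integral do rewrite EFinM.
  under [RHS]eq_integral do rewrite EFinM.
  by rewrite !integralZl//= ?ef//; exact: bnd_int.
- have mf : measurable_fun setT f.
    apply: (measurable_EFinP _ _).1.
    apply: (@emeasurable_fun_cvg _ _ _ _ (fun k x => (f_ k x)%:E)).
      by move=> k; apply/measurable_EFinP; exact: (h k).1.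
    by move=> x _; apply: cvg_EFin; [exact: nearW|exact: cf].
  have cvgi (mu : probability (n.-tuple R) R) :
      (\int[mu]_x (f_ k x)%:E)%E @[k --> \oo] --> (\int[mu]_x (f x)%:E)%E.
    have [|||||_ _ lim] := @dominated_convergence _ _ _ mu setT measurableT
        (fun k x => (f_ k x)%:E) (EFin \o f) (cst M%:E).
    + by move=> k; apply/measurable_EFinP; exact: (h k).1.
    + exact/measurable_EFinP.
    + by apply: aeW => x _; apply: cvg_EFin; [exact: nearW|exact: cf].
    + by apply: finite_measure_integrable_cst.
    + by apply: aeW => x k _; rewrite lee_fin.
    + exact: lim.
  split => //; have := cvgi mu1.
  under eq_fun do rewrite (h _).2.
  by move/(cvg_unique _)/(_ (cvgi mu2)); apply.
Qed.

Lemma waves_determine_law (B : set (n.-tuple R)) : measurable B -> mu1 B = mu2 B.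
Proof.
move=> mB; have [_] := trig_class_integral (measurable_trig_set mB).
by rewrite !integral_indic// !setIT.
Qed.

End two_laws.

End trigonometric_class.

Section cramer_wold.
Context {R : realType}.

(* Cramer-Wold device, with the real characteristic functions
   [E cos(Z + phi)] of the linear combinations [Z]. *)
Lemma cramer_wold (I : Type) (D : set I)
    d1 (T1 : measurableType d1) (P1 : probability T1 R)
    d2 (T2 : measurableType d2) (P2 : probability T2 R)
    (X1 : I -> T1 -> R) (X2 : I -> T2 -> R) :
  (forall t, D t -> measurable_fun setT (X1 t)) ->
  (forall t, D t -> measurable_fun setT (X2 t)) ->
  (forall n (t : 'I_n -> I) (a : 'I_n -> R) (phi : R), (forall i, D (t i)) ->
    (\int[P1]_w (cos (\sum_(i < n) a i * X1 (t i) w + phi))%:E =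
     \int[P2]_w (cos (\sum_(i < n) a i * X2 (t i) w + phi))%:E)%E) ->
  fdd_eq D P1 P2 X1 X2.
Proof.
move=> m1 m2 H n t Dt B mB.
pose F1 w := [tuple X1 (t i) w | i < n]; pose F2 w := [tuple X2 (t i) w | i < n].
have mF1 : measurable_fun setT F1.
  apply/measurable_fun_tnthP => i; rewrite (_ : _ \o _ = X1 (t i)).
    exact: m1.
  by apply/funext => w /=; rewrite tnth_mktuple.
have mF2 : measurable_fun setT F2.
  apply/measurable_fun_tnthP => i; rewrite (_ : _ \o _ = X2 (t i)).
    exact: m2.
  by apply/funext => w /=; rewrite tnth_mktuple.
pose f1 : {RV P1 >-> n.-tuple R} := HB.pack F1 (isMeasurableFun.Build _ _ _ _ F1 mF1).
pose f2 : {RV P2 >-> n.-tuple R} := HB.pack F2 (isMeasurableFun.Build _ _ _ _ F2 mF2).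
apply: (@waves_determine_law _ _ (distribution P1 f1) (distribution P2 f2)) => //.
move=> a phi.
have bnd d (T : measurableType d) (P : probability T R) (F : {RV P >-> n.-tuple R}) :
    P.-integrable setT (EFin \o (wave a phi \o F)).
  apply: (@measurable_bounded_integrable _ _ _ P _ _ measurableT) => //.
  - by rewrite (le_lt_trans (probability_le1 _ _))// ltry.
  - by apply: measurableT_comp => //; exact: measurable_wave.
  - exists 1; split; first by rewrite num_real.
    by move=> N MN x _; exact: le_trans (cos_max _) (ltW MN).
have pf d (T : measurableType d) (P : probability T R) (F : {RV P >-> n.-tuple R}) :
    (\int[distribution P F]_x (wave a phi x)%:E = \int[P]_w (wave a phi (F w))%:E)%E.
  rewrite /distribution integral_pushforward//= ?preimage_setT//.
  - by apply/measurable_EFinP; exact: measurable_wave.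
  - exact: bnd.
rewrite !pf.
transitivity (\int[P1]_w (cos (\sum_(i < n) a i * X1 (t i) w + phi))%:E)%E.
  apply: eq_integral => w _; rewrite /wave/=; congr (cos (_ + _))%:E.
  by apply: eq_bigr => i _; rewrite tnth_mktuple.
rewrite H//; apply: eq_integral => w _; rewrite /wave/=; congr (cos (_ + _))%:E.
by apply: eq_bigr => i _; rewrite tnth_mktuple.
Qed.

End cramer_wold.

(** * Square integrable functions and their inner product *)

Section square_integrable.
Context {R : realType} d (T : measurableType d) (mu : {measure set T -> \bar R}).
Implicit Types f g h : T -> R.

Definition L2 f :=
  measurable_fun setT f /\ (\int[mu]_x (f x ^+ 2)%:E < +oo)%E.

Definition ip f g : R := \int[mu]_x (f x * g x).

Definition nrm f : R := ip f f.

Lemma L2_sqr_integrable f : L2 f -> mu.-integrable setT (fun x => (f x ^+ 2)%:E).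
Proof.
move=> [mf fi]; apply/integrableP; split.
  by apply/measurable_EFinP; exact: measurable_funX.
by under eq_integral do rewrite gee0_abs ?lee_fin ?sqr_ge0//.
Qed.

Lemma L2_mul_integrable f g : L2 f -> L2 g ->
  mu.-integrable setT (fun x => (f x * g x)%:E).
Proof.
move=> Lf Lg; apply: (@le_integrable _ _ _ mu _ measurableT _
    (fun x => (f x ^+ 2)%:E + (g x ^+ 2)%:E)%E).
- apply/measurable_EFinP; apply: measurable_funM;
    [exact: Lf.1|exact: Lg.1].
- move=> x _ /=; rewrite lee_fin [leRHS]ger0_norm ?addr_ge0 ?sqr_ge0//.
  rewrite ler_norml; apply/andP; split; have := sqr_ge0 (f x); have := sqr_ge0 (g x);
  have := sqr_ge0 (f x + g x); have := sqr_ge0 (f x - g x); rewrite !expr2; nra.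
- by apply: integrableD => //; exact: L2_sqr_integrable.
Qed.

Lemma L2D f g : L2 f -> L2 g -> L2 (fun x => f x + g x).
Proof.
move=> Lf Lg; split; first by apply: measurable_funD; [exact: Lf.1|exact: Lg.1].
apply: (@le_lt_trans _ _ (\int[mu]_x ((2 * f x ^+ 2)%:E + (2 * g x ^+ 2)%:E))%E).
  apply: ge0_le_integral => //.
  - by move=> x _; rewrite lee_fin sqr_ge0.
  - apply/measurable_EFinP; apply: measurable_funX.
    by apply: measurable_funD; [exact: Lf.1|exact: Lg.1].
  - apply: emeasurable_funD; apply/measurable_EFinP; apply: measurable_funM => //;
    by apply: measurable_funX; first [exact: Lf.1|exact: Lg.1].
  - move=> x _; rewrite lee_fin; have := sqr_ge0 (f x - g x); rewrite !expr2; nra.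
rewrite integralD//=.
- rewrite lte_add_pinfty//.
  + under eq_integral do rewrite EFinM.
    rewrite integralZl//; last exact: L2_sqr_integrable.
    by rewrite lte_mul_pinfty ?lee_fin//; exact: Lf.2.
  + under eq_integral do rewrite EFinM.
    rewrite integralZl//; last exact: L2_sqr_integrable.
    by rewrite lte_mul_pinfty ?lee_fin//; exact: Lg.2.
- by under eq_fun do rewrite EFinM; apply: integrableZl => //; exact: L2_sqr_integrable.
- by under eq_fun do rewrite EFinM; apply: integrableZl => //; exact: L2_sqr_integrable.
Qed.

Lemma L2Z k f : L2 f -> L2 (fun x => k * f x).
Proof.
move=> Lf; split; first by apply: measurable_funM => //; exact: Lf.1.
under eq_integral do rewrite exprMn EFinM.
rewrite integralZl//; last exact: L2_sqr_integrable.
by rewrite lte_mul_pinfty ?lee_fin ?sqr_ge0//; exact: Lf.2.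
Qed.

Lemma L20 : L2 (fun=> 0).
Proof. by split => //; rewrite integral0_eq// => x _; rewrite expr0n. Qed.

Lemma L2B f g : L2 f -> L2 g -> L2 (fun x => f x - g x).
Proof.
move=> Lf Lg; rewrite (_ : (fun x => _) = fun x => f x + -1 * g x).
  by apply: L2D => //; exact: L2Z.
by apply/funext => x; rewrite mulN1r.
Qed.

Lemma ipC f g : ip f g = ip g f.
Proof. by apply: eq_Rintegral => x _; rewrite mulrC. Qed.

Lemma ipDl f g h : L2 f -> L2 g -> L2 h ->
  ip (fun x => f x + g x) h = ip f h + ip g h.
Proof.
move=> Lf Lg Lh; rewrite /ip.
under eq_Rintegral do rewrite mulrDl.
by rewrite RintegralD//; exact: L2_mul_integrable.
Qed.

Lemma ipZl k f h : L2 f -> L2 h -> ip (fun x => k * f x) h = k * ip f h.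
Proof.
move=> Lf Lh; rewrite /ip.
under eq_Rintegral do rewrite -mulrA.
by rewrite RintegralZl//; exact: L2_mul_integrable.
Qed.

Lemma ipDr f g h : L2 f -> L2 g -> L2 h ->
  ip h (fun x => f x + g x) = ip h f + ip h g.
Proof. by move=> *; rewrite !(ipC h) ipDl. Qed.

Lemma ipZr k f h : L2 f -> L2 h -> ip h (fun x => k * f x) = k * ip h f.
Proof. by move=> *; rewrite !(ipC h) ipZl. Qed.

Lemma ip0l h : ip (fun=> 0) h = 0.
Proof.
rewrite /ip (@eq_Rintegral _ _ _ _ _ (cst 0)); last by move=> x _; rewrite mul0r.
by rewrite /Rintegral integral0.
Qed.

Lemma ip_suml (I : Type) (r : seq I) (F : I -> T -> R) h :
  (forall i, L2 (F i)) -> L2 h ->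
  L2 (fun x => \sum_(i <- r) F i x) /\
  ip (fun x => \sum_(i <- r) F i x) h = \sum_(i <- r) ip (F i) h.
Proof.
move=> LF Lh; elim: r => [|i r [Lr IH]].
  under eq_fun do rewrite big_nil.
  by rewrite big_nil ip0l; split => //; exact: L20.
under eq_fun do rewrite big_cons.
by split; [exact: L2D|rewrite ipDl// IH big_cons].
Qed.

Lemma L2_sum (I : Type) (r : seq I) (F : I -> T -> R) :
  (forall i, L2 (F i)) -> L2 (fun x => \sum_(i <- r) F i x).
Proof. by move=> LF; have [] := ip_suml r LF L20. Qed.

Lemma nrm_ge0 f : 0 <= nrm f.
Proof.
by rewrite /nrm /ip; apply: Rintegral_ge0 => x _; rewrite -expr2 sqr_ge0.
Qed.

Lemma nrm_eint f : L2 f -> (\int[mu]_x (f x ^+ 2)%:E = (nrm f)%:E)%E.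
Proof.
move=> Lf; rewrite /nrm /ip /Rintegral fineK.
  by apply: eq_integral => x _; rewrite expr2.
under eq_integral do rewrite -expr2.
by rewrite ge0_fin_numE; [exact: Lf.2|apply: integral_ge0 => x _; rewrite lee_fin sqr_ge0].
Qed.

Lemma nrmD f g : L2 f -> L2 g ->
  nrm (fun x => f x + g x) = nrm f + 2 * ip f g + nrm g.
Proof.
move=> Lf Lg; have Lfg := L2D Lf Lg.
by rewrite /nrm ipDl// !ipDr// (ipC g f); ring.
Qed.

Lemma nrmZ k f : L2 f -> nrm (fun x => k * f x) = k ^+ 2 * nrm f.
Proof. by move=> Lf; rewrite /nrm ipZl ?ipZr// ?mulrA//; exact: L2Z. Qed.

(** Expansion of [nrm (sqrt e * f + s / sqrt e * g) >= 0] for [s = 1] and [s = -1]. With [e] free at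
    each use, this takes the place of the Cauchy-Schwarz inequality and avoids square roots of
    [nrm]. *)
Lemma ip_young e f g : 0 < e -> L2 f -> L2 g ->
  `|2 * ip f g| <= e * nrm f + e^-1 * nrm g.
Proof.
move=> e0 Lf Lg.
have key s : s ^+ 2 = 1 -> 0 <= e * nrm f + s * (2 * ip f g) + e^-1 * nrm g.
  move=> s1; have := nrm_ge0 (fun x => Num.sqrt e * f x + s * (Num.sqrt e)^-1 * g x).
  rewrite nrmD; [|exact: L2Z|exact: L2Z].
  rewrite !nrmZ// ipZl//; last exact: L2Z.
  rewrite ipZr// exprMn s1 mul1r exprVn (sqr_sqrtr (ltW e0)).
  suff -> : 2 * (Num.sqrt e * (s * (Num.sqrt e)^-1 * ip f g)) = s * (2 * ip f g) by [].
  by field; rewrite gt_eqF// sqrtr_gt0.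
have := key 1; have := key (-1); rewrite sqrrN expr1n mulN1r mul1r => h1 h2.
by rewrite ler_norml; apply/andP; split; [have := h2 erefl|have := h1 erefl]; lra.
Qed.

(** [g] is written as [f - (f - g)], and the cross term of the expansion is absorbed by [ip_young].
    This is the continuity of [nrm] along L^2 approximations. *)
Lemma nrm_dist e f g : 0 < e -> L2 f -> L2 g ->
  `|nrm f - nrm g| <= e * nrm f + (e^-1 + 1) * nrm (fun x => f x - g x).
Proof.
move=> e0 Lf Lg; have Lfg := L2B Lf Lg.
have h := nrmD Lf (L2Z (-1) Lfg).
rewrite ipZr// nrmZ// (_ : (fun x => _) = g) in h; last first.
  by apply/funext => x; ring.
rewrite h {h}.
have := ip_young e0 Lf Lfg; have := nrm_ge0 (fun x => f x - g x).
by rewrite !ler_norml => ? /andP[? ?]; apply/andP; split; lra.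
Qed.

Lemma nrmD_le f g : L2 f -> L2 g ->
  nrm (fun x => f x + g x) <= 2 * nrm f + 2 * nrm g.
Proof.
move=> Lf Lg; rewrite nrmD//.
by have := ip_young ltr01 Lf Lg; rewrite invr1 ler_norml => /andP[_ ?]; lra.
Qed.

Lemma ip_polarization f g : L2 f -> L2 g ->
  ip f g = 2^-1 * (nrm (fun x => f x + g x) - nrm f - nrm g).
Proof. by move=> Lf Lg; rewrite nrmD//; field. Qed.

Lemma ip_ae_eq f f' g g' : L2 f -> L2 f' -> L2 g -> L2 g' ->
  {ae mu, forall x, f x = f' x} -> {ae mu, forall x, g x = g' x} ->
  ip f g = ip f' g'.
Proof.
move=> Lf Lf' Lg Lg' ff' gg'; rewrite /ip /Rintegral; congr fine.
apply: ae_eq_integral => //.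
- by apply/measurable_EFinP; apply: measurable_funM; [exact: Lf.1|exact: Lg.1].
- by apply/measurable_EFinP; apply: measurable_funM; [exact: Lf'.1|exact: Lg'.1].
- by apply: filterS2 ff' gg' => x -> -> _.
Qed.

End square_integrable.

Section limits_of_norms.
Context {R : realType}.

Lemma eq_by_small (a b K : R) :
  (forall e, 0 < e -> `|a - b| <= e * K) -> a = b.
Proof.
move=> H; apply/eqP; rewrite -subr_eq0 -normr_eq0; apply/eqP/le_anti.
rewrite normr_ge0 andbT; apply/ler_addgt0Pr => e e0; rewrite add0r.
have K0 : 0 < `|K| + 1 by rewrite ltr_wpDl.
apply: (le_trans (H (e / (`|K| + 1)) _)); first by rewrite divr_gt0.
rewrite mulrAC ler_pdivrMr// ler_pM2l// (le_trans (ler_norm K))//.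
by rewrite lerDl.
Qed.

Lemma nrm_limit_eq d1 (T1 : measurableType d1) (mu1 : {measure set T1 -> \bar R})
    d2 (T2 : measurableType d2) (mu2 : {measure set T2 -> \bar R})
    (f1 : T1 -> R) (f2 : T2 -> R) :
  L2 mu1 f1 -> L2 mu2 f2 ->
  (forall e, 0 < e -> exists g1 g2, [/\ L2 mu1 g1, L2 mu2 g2,
     nrm mu1 g1 = nrm mu2 g2, nrm mu1 (fun x => f1 x - g1 x) < e &
     nrm mu2 (fun x => f2 x - g2 x) < e]) ->
  nrm mu1 f1 = nrm mu2 f2.
Proof.
move=> L1 L2' H; apply: (@eq_by_small _ _ (nrm mu1 f1 + nrm mu2 f2 + 2)) => e e0.
have ee : 0 < e^-1 + 1 by rewrite addr_gt0 ?invr_gt0.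
(* The tolerance compensates the factor [e^-1 + 1] in [nrm_dist], so that each approximation costs
   [e] at most. *)
have [|g1 [g2 [Lg1 Lg2 gg n1 n2]]] := H (e / (e^-1 + 1)); first by rewrite divr_gt0.
have := nrm_dist e0 L1 Lg1; have := nrm_dist e0 L2' Lg2.
rewrite ltr_pdivlMr// mulrC in n1; rewrite ltr_pdivlMr// mulrC in n2.
rewrite gg !ler_norml => /andP[? ?] /andP[? ?]; apply/andP; split; lra.
Qed.

End limits_of_norms.

Section square_integrable_random_variables.
Context {R : realType} d (T : measurableType d) (P : probability T R).
Implicit Types X Y : T -> R.

Lemma L2_cst (k : R) : L2 P (fun=> k).
Proof.
split => //; rewrite integral_cst//.
by rewrite lte_mul_pinfty ?lee_fin ?sqr_ge0// (le_lt_trans (probability_le1 _ _))// ltry.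
Qed.

Lemma L2_integrable X : L2 P X -> P.-integrable setT (EFin \o X).
Proof.
move=> LX; have := L2_mul_integrable LX (L2_cst 1).
by under eq_fun do rewrite mulr1.
Qed.

Lemma expectation_L2 X : L2 P X -> ('E_P[X] = (ip P X (fun=> 1))%:E)%E.
Proof.
move=> LX; rewrite unlock /ip.
under eq_Rintegral do rewrite mulr1.
by rewrite /Rintegral fineK//; exact: integrable_fin_num (L2_integrable LX).
Qed.

Lemma expectation_mul X Y : L2 P X -> L2 P Y ->
  ('E_P[fun w => (X w * Y w)%R] = (ip P X Y)%:E)%E.
Proof.
move=> LX LY; rewrite unlock /ip /Rintegral fineK//.
exact: integrable_fin_num (L2_mul_integrable LX LY).
Qed.

Lemma nrm_cst (k : R) : nrm P (fun=> k) = k ^+ 2.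
Proof.
rewrite /nrm /ip Rintegral_cst//=.
have -> : (P : {measure set T -> \bar R}) setT = 1%E by exact: probability_setT.
by rewrite /= mulr1 expr2.
Qed.

End square_integrable_random_variables.

(** * Changes of variables for Lebesgue measure on R^3 *)

Section change_of_variables.
Context {R : realType}.

(** Restricting to nonnegative [f] leaves no integrability to check, and in this form the factors
    multiply under product measures by Tonelli. *)
Definition scales_measure d (T : measurableType d) (m : {measure set T -> \bar R})
    (phi : T -> T) (a : R) : Prop :=
  measurable_fun setT phi /\
  forall f : T -> \bar R, measurable_fun setT f -> (forall x, 0 <= f x)%E ->
    (a%:E * \int[m]_x f (phi x) = \int[m]_x f x)%E.

(** [a] times the image of Lebesgue measure under the map gives every half-open interval its length,
    hence is Lebesgue measure by uniqueness. *)
Lemma lebesgue_scales (a b : R) : 0 < a ->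
  scales_measure (@lebesgue_measure R) (fun x => a * x + b) a.
Proof.
move=> a0.
have mphi : measurable_fun setT (fun x : R => a * x + b).
  by apply: measurable_funD => //; exact: measurable_funM.
split => // f mf f0.
have mphi' : @measurable_fun _ _ (measurableTypeR R) (measurableTypeR R) setT
  (fun x : R => a * x + b) by exact: mphi.
pose phi : measurableTypeR R -> measurableTypeR R := fun x => a * x + b.
have a0' : 0 <= a by exact: ltW.
pose m0 : {measure set (measurableTypeR R) -> \bar R} :=
  mscale (NngNum a0') (pushforward (@lebesgue_measure R) phi).
pose m' := m0 mphi'.
transitivity (\int[m']_x f x)%E.
  rewrite ge0_integral_mscale//=; congr (_ * _)%E.
  rewrite ge0_integral_pushforward//.
apply: eq_measure_integral => A mA _; apply/esym.
apply: lebesgue_measure_unique => //= _ [[u v] _ <-].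
rewrite /m' /m0 /= /mscale/= /pushforward.
rewrite (_ : _ @^-1` _ = `](u - b) / a, (v - b) / a]%classic); last first.
  apply/seteqP; split => x /=; rewrite !in_itv/= ltr_pdivrMr// ler_pdivlMr//;
  by rewrite ltrBlDr lerBrDr (mulrC x).
rewrite !lebesgue_measure_itv/= !lte_fin ltr_pM2r ?invr_gt0// ltrD2r.
case: ifPn => _; last by rewrite mule0.
rewrite -!EFinB -EFinM; congr EFin; by field; rewrite gt_eqF.
Qed.

End change_of_variables.

Section product_change.
Context {R : realType} d1 (T1 : measurableType d1) d2 (T2 : measurableType d2).
Variable m1 : {sigma_finite_measure set T1 -> \bar R}.
Variable m2 : {sigma_finite_measure set T2 -> \bar R}.

Lemma product_scales phi1 phi2 (a1 a2 : R) : 0 <= a1 -> 0 <= a2 ->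
  scales_measure m1 phi1 a1 -> scales_measure m2 phi2 a2 ->
  scales_measure (m1 \x m2)%E (fun z => (phi1 z.1, phi2 z.2)) (a1 * a2).
Proof.
move=> a10 a20 [mp1 s1] [mp2 s2].
have mp : measurable_fun setT (fun z : T1 * T2 => (phi1 z.1, phi2 z.2)).
  by apply: measurable_fun_pair; exact: measurableT_comp.
split => // f mf f0.
rewrite fubini_tonelli1//; last exact: measurableT_comp.
rewrite [RHS]fubini_tonelli1// /fubini_F/=.
rewrite -[RHS](s1 (fun x => \int[m2]_y f (x, y))%E); last 2 first.
- exact: (@measurable_fun_fubini_tonelli_F _ _ _ _ _ m2 f mf f0).
- by move=> x; exact: integral_ge0.
rewrite EFinM -muleA; congr (_ * _)%E.
rewrite -ge0_integralZl//; last 2 first.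
- apply: (@measurable_fun_fubini_tonelli_F _ _ _ _ _ m2
     (fun z => f (phi1 z.1, phi2 z.2))) => //; exact: measurableT_comp.
- by move=> x _; exact: integral_ge0.
apply: eq_integral => x _.
rewrite -(s2 (fun y => f (phi1 x, y)))//.
by apply: measurableT_comp => //; exact: pair1_measurable.
Qed.

End product_change.

Lemma product_sigma_finite {R : realType} d1 (T1 : measurableType d1) d2
    (T2 : measurableType d2) (m1 : {sigma_finite_measure set T1 -> \bar R})
    (m2 : {sigma_finite_measure set T2 -> \bar R}) : sigma_finite setT (m1 \x m2)%E.
Proof.
have /sigma_finiteP[F [TF ndF Foo]] := sigma_finiteT m1.
have /sigma_finiteP[G [TG ndG Goo]] := sigma_finiteT m2.
exists (fun n => F n `*` G n) => [|k].
  apply/esym; rewrite -subTset => -[x y] _.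
  have [i _ Fx] : (\bigcup_i F i) x by rewrite -TF.
  have [j _ Gy] : (\bigcup_i G i) y by rewrite -TG.
  exists (maxn i j) => //; split => /=.
    by move: Fx; apply/subsetPset/ndF/leq_maxl.
  by move: Gy; apply/subsetPset/ndG/leq_maxr.
have [? ?] := Foo k; have [? ?] := Goo k; split; first exact: measurableX.
by rewrite product_measure1E// lte_mul_pinfty// ge0_fin_numE.
Qed.

Section leb3_theory.
Context {R : realType}.
Notation mu := (@lebesgue_measure R).

(* The canonical instance of the product measure is not found for two copies of
   [lebesgue_measure]; it is given to [leb2] and [leb3] explicitly. *)
Let leb2_measure :
  {measure set (measurableTypeR R * measurableTypeR R)%type -> \bar R} := (mu \x mu)%E.

HB.instance Definition _ := isMeasure.Build _ _ _ (leb2 R) (measure0 leb2_measure)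
  (measure_ge0 leb2_measure) (@measure_semi_sigma_additive _ _ _ leb2_measure).
HB.instance Definition _ := Measure_isSigmaFinite.Build _ _ _ (leb2 R)
  (@product_sigma_finite _ _ _ _ _ mu mu).

Let leb3_measure :
  {measure set (measurableTypeR R * measurableTypeR R * measurableTypeR R)%type -> \bar R}
  := (leb2 R \x mu)%E.
HB.instance Definition _ := isMeasure.Build _ _ _ (leb3 R) (measure0 leb3_measure)
  (measure_ge0 leb3_measure) (@measure_semi_sigma_additive _ _ _ leb3_measure).
HB.instance Definition _ := Measure_isSigmaFinite.Build _ _ _ (leb3 R)
  (@product_sigma_finite _ _ _ _ _ (leb2 R) mu).

Lemma measurable_co1 : measurable_fun setT (@co1 R).
Proof. by rewrite (_ : @co1 R = fst \o fst)//; exact: measurableT_comp. Qed.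

Lemma measurable_co2 : measurable_fun setT (@co2 R).
Proof. by rewrite (_ : @co2 R = snd \o fst)//; exact: measurableT_comp. Qed.

Lemma measurable_co3 : measurable_fun setT (@co3 R).
Proof. exact: measurable_snd. Qed.

Lemma leb3_scales (a b : R3 R) : open_orthant a ->
  scales_measure (leb3 R)
    (fun x => (co1 a * co1 x + co1 b, co2 a * co2 x + co2 b, co3 a * co3 x + co3 b))
    (co1 a * co2 a * co3 a).
Proof.
move=> [a1 a2 a3].
have h := @product_scales _ _ _ _ _ mu mu _ _ _ _ (ltW a1) (ltW a2)
  (lebesgue_scales (co1 b) a1) (lebesgue_scales (co2 b) a2).
have a12 : 0 <= co1 a * co2 a by rewrite mulr_ge0// ltW.
exact: (@product_scales _ _ _ _ _ (leb2 R) mu _ _ _ _ a12 (ltW a3) h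
  (lebesgue_scales (co3 b) a3)).
Qed.

Lemma leb2_tonelli (f : R * R -> \bar R) : measurable_fun setT f ->
  (forall x, 0 <= f x)%E ->
  (\int[leb2 R]_x f x = \int[mu]_x1 \int[mu]_x2 f (x1, x2))%E.
Proof. by move=> mf f0; rewrite (@fubini_tonelli1 _ _ _ _ _ mu mu). Qed.

Lemma leb3_tonelli (f : R3 R -> \bar R) : measurable_fun setT f ->
  (forall x, 0 <= f x)%E ->
  (\int[leb3 R]_x f x = \int[mu]_x1 \int[mu]_x2 \int[mu]_x3 f (x1, x2, x3))%E.
Proof.
move=> mf f0; rewrite (@fubini_tonelli1 _ _ _ _ _ (leb2 R) mu)// leb2_tonelli//.
  exact: (@measurable_fun_fubini_tonelli_F _ _ _ _ _ mu f mf f0).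
by move=> x; exact: integral_ge0.
Qed.

Lemma leb3_prod (f1 f2 f3 : R -> \bar R) :
  measurable_fun setT f1 -> measurable_fun setT f2 -> measurable_fun setT f3 ->
  (forall x, 0 <= f1 x)%E -> (forall x, 0 <= f2 x)%E -> (forall x, 0 <= f3 x)%E ->
  (\int[leb3 R]_x (f1 (co1 x) * f2 (co2 x) * f3 (co3 x)) =
   \int[mu]_x f1 x * \int[mu]_x f2 x * \int[mu]_x f3 x)%E.
Proof.
move=> m1 m2 m3 p1 p2 p3; rewrite leb3_tonelli; last 2 first.
- apply: emeasurable_funM; last by apply: measurableT_comp => //; exact: measurable_co3.
  apply: emeasurable_funM; apply: measurableT_comp => //;
    [exact: measurable_co1|exact: measurable_co2].
- by move=> x; rewrite !mule_ge0.
under eq_integral => x1 _.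
  under eq_integral => x2 _.
    rewrite /co1/co2/co3/= ge0_integralZl//; last by rewrite mule_ge0.
    over.
  rewrite ge0_integralZr//; last 3 first.
  - by apply: emeasurable_funM.
  - by move=> *; rewrite mule_ge0.
  - exact: integral_ge0.
  rewrite ge0_integralZl//.
  over.
rewrite ge0_integralZr//; last exact: integral_ge0.
  rewrite ge0_integralZr//; exact: integral_ge0.
  by apply: emeasurable_funM.
by move=> *; rewrite mule_ge0// integral_ge0.
Qed.

Lemma leb3_box (A1 A2 A3 : set R) : measurable A1 -> measurable A2 ->
  measurable A3 ->
  (leb3 R [set x | [/\ A1 (co1 x), A2 (co2 x) & A3 (co3 x)]] =
   mu A1 * mu A2 * mu A3)%E.
Proof.
move=> m1 m2 m3.
rewrite (_ : [set x | _] = (A1 `*` A2) `*` A3); last first.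
  apply/seteqP; split => -[[x1 x2] x3] /=; first by case.
  by move=> [[]].
rewrite [LHS](@product_measure1E _ _ _ _ _ (leb2 R) mu)//; last exact: measurableX.
by rewrite [X in (X * _)%E](@product_measure1E _ _ _ _ _ mu mu).
Qed.

Lemma measurable_box (A1 A2 A3 : set R) : measurable A1 -> measurable A2 ->
  measurable A3 ->
  measurable [set x : R3 R | [/\ A1 (co1 x), A2 (co2 x) & A3 (co3 x)]].
Proof.
move=> m1 m2 m3.
rewrite (_ : [set x | _] = (A1 `*` A2) `*` A3); last first.
  apply/seteqP; split => -[[x1 x2] x3] /=; first by case.
  by move=> [[]].
by apply: measurableX => //; exact: measurableX.
Qed.

#[global] Instance leb3_ae_filter : Filter (nbhs (almost_everywhere (leb3 R))).
Proof. exact: (ae_filter_ringOfSetsType (leb3 R)). Qed.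

(** Discards the hyperplanes on which open and half-open boxes differ, and those on which some
    argument of [rho] is 0, where the bound of its inverse by a product of powers fails. *)
Lemma leb3_ae_neq (c : R3 R) : {ae leb3 R, forall x,
  [/\ co1 x != co1 c, co2 x != co2 c & co3 x != co3 c]}.
Proof.
have h1 : {ae leb3 R, forall x, co1 x != co1 c}.
  exists [set x | [/\ [set co1 c] (co1 x), setT (co2 x) & setT (co3 x)]]; split.
  - exact: measurable_box.
  - by rewrite leb3_box// lebesgue_measure_set1 !mul0e.
  - by move=> x /= /negP; rewrite negbK => /eqP ->.
have h2 : {ae leb3 R, forall x, co2 x != co2 c}.
  exists [set x | [/\ setT (co1 x), [set co2 c] (co2 x) & setT (co3 x)]]; split.
  - exact: measurable_box.
  - by rewrite leb3_box// lebesgue_measure_set1 mule0 !mul0e.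
  - by move=> x /= /negP; rewrite negbK => /eqP ->.
have h3 : {ae leb3 R, forall x, co3 x != co3 c}.
  exists [set x | [/\ setT (co1 x), setT (co2 x) & [set co3 c] (co3 x)]]; split.
  - exact: measurable_box.
  - by rewrite leb3_box// lebesgue_measure_set1 mule0.
  - by move=> x /= /negP; rewrite negbK => /eqP ->.
by apply: filterS3 h1 h2 h3 => x -> -> ->.
Qed.

End leb3_theory.

(** * Gaussian laws and centered Gaussian families *)

Section equality_in_law.
Context {R : realType}.

Definition law_eq d1 (T1 : measurableType d1) (P1 : probability T1 R)
    d2 (T2 : measurableType d2) (P2 : probability T2 R)
    (X1 : T1 -> R) (X2 : T2 -> R) : Prop :=
  forall A : set R, measurable A -> P1 (X1 @^-1` A) = P2 (X2 @^-1` A).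

Context d1 (T1 : measurableType d1) (P1 : probability T1 R)
        d2 (T2 : measurableType d2) (P2 : probability T2 R)
        (X1 : T1 -> R) (X2 : T2 -> R).
Hypotheses (m1 : measurable_fun setT X1) (m2 : measurable_fun setT X2).
Hypothesis X12 : law_eq P1 P2 X1 X2.

Lemma law_eq_comp (f : R -> R) : measurable_fun setT f ->
  law_eq P1 P2 (fun w => f (X1 w)) (fun w => f (X2 w)).
Proof.
move=> mf A mA; have mfA : measurable (f @^-1` A) by rewrite -[X in measurable X]setTI; exact: mf.
exact: X12 mfA.
Qed.

Lemma law_eq_integral_ge0 (f : R -> \bar R) : measurable_fun setT f ->
  (forall x, 0 <= f x)%E -> (\int[P1]_w f (X1 w) = \int[P2]_w f (X2 w))%E.
Proof.
move=> mf f0.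
pose D1 := distribution P1 (HB.pack X1 (isMeasurableFun.Build _ _ _ _ X1 m1) : {RV P1 >-> R}).
pose D2 := distribution P2 (HB.pack X2 (isMeasurableFun.Build _ _ _ _ X2 m2) : {RV P2 >-> R}).
transitivity (\int[D1]_x f x)%E.
  by rewrite /D1 ge0_integral_distribution.
transitivity (\int[D2]_x f x)%E; last by rewrite /D2 ge0_integral_distribution.
by apply: eq_measure_integral => A mA _; exact: X12.
Qed.

Lemma law_eq_integral (f : R -> R) : measurable_fun setT f ->
  (\int[P1]_w (f (X1 w))%:E = \int[P2]_w (f (X2 w))%:E)%E.
Proof.
move=> mf; rewrite integralE [RHS]integralE.
have mf' : measurable_fun setT (fun y => (f y)%:E) by exact/measurable_EFinP.
congr (_ - _)%E.
- under eq_integral do rewrite funeposE.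
  under [RHS]eq_integral do rewrite funeposE.
  apply: (@law_eq_integral_ge0 (fun x => maxe (f x)%:E 0)%E) => [|x].
    exact: measurable_maxe.
  by rewrite le_max lexx orbT.
- under eq_integral do rewrite funenegE.
  under [RHS]eq_integral do rewrite funenegE.
  apply: (@law_eq_integral_ge0 (fun x => maxe (- (f x)%:E) 0)%E) => [|x].
    by apply: measurable_maxe => //; exact: measurableT_comp.
  by rewrite le_max lexx orbT.
Qed.

Lemma law_eq_L2 : L2 P1 X1 -> L2 P2 X2 /\ nrm P2 X2 = nrm P1 X1.
Proof.
move=> L1; have e := @law_eq_integral (fun x => x ^+ 2) (exprn_measurable 2).
have L2' : L2 P2 X2 by split => //; rewrite -e; exact: L1.2.
by split => //; apply: EFin_inj; rewrite -!nrm_eint.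
Qed.

Lemma law_eq_mean : ip P1 X1 (fun=> 1) = ip P2 X2 (fun=> 1).
Proof.
rewrite /ip /Rintegral; congr fine.
under eq_integral do rewrite mulr1.
under [RHS]eq_integral do rewrite mulr1.
exact: (law_eq_integral (@measurable_id _ _ _)).
Qed.

End equality_in_law.

Section standard_normal_representation.
Context {R : realType}.

Definition N01 : probability (measurableTypeR R) R := normal_prob 0 1.

Lemma normal_prob_affine (m s : R) (A : set R) : s != 0 -> measurable A ->
  normal_prob m s A = N01 [set x | A (m + `|s| * x)].
Proof.
move=> s0 mA; have s0' : 0 < `|s| by rewrite normr_gt0.
have mpre : measurable [set x | A (m + `|s| * x)].
  have : measurable_fun setT (fun x : R => m + `|s| * x).
    by apply: measurable_funD => //; exact: measurable_funM.
  by move=> /(_ measurableT _ mA); rewrite setTI.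
rewrite /N01 /= /normal_prob [LHS]integral_mkcond [RHS]integral_mkcond.
have [_ sc] := lebesgue_scales m s0'.
set g := (_ \_ A).
have mg : measurable_fun setT g.
  apply/(measurable_restrictT _ _).1 => //.
  by apply/measurable_EFinP/measurable_funTS; exact: measurable_normal_pdf.
have g0 x : (0 <= g x)%E.
  by rewrite /g patchE; case: ifP => // _; rewrite lee_fin normal_pdf_ge0.
rewrite -sc// -ge0_integralZl//; last first.
  apply: (measurableT_comp mg).
  by apply: measurable_funD => //; exact: measurable_funM.
apply: eq_integral => x _; rewrite /g !patchE.
have -> : (`|s| * x + m \in A) = (x \in [set x | A (m + `|s| * x)]).
  by apply/idP/idP => /set_mem h; apply/mem_set; move: h; rewrite /= addrC.
case: ifP => _; last by rewrite mule0.
rewrite -EFinM; congr EFin; rewrite !normal_pdfE ?oner_eq0//.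
rewrite /normal_peak /normal_fun expr1n mul1r subr0 addrK -mulrnAr.
rewrite sqrtrM ?sqr_ge0// sqrtr_sqr invfM mulrA mulrA mulfV ?gt_eqF// mul1r.
congr (_ * expR _); rewrite exprMn real_normK ?num_real//.
by field.
Qed.

(** At [s = 0] the affine image of the standard normal law is the Dirac mass at [m], so one formula
    covers both branches of [gaussian_rv]; the absolute value of the given [s] yields a nonnegative
    scale. *)
Lemma gaussian_rv_law d (T : measurableType d) (P : probability T R) (X : T -> R) :
  gaussian_rv P X ->
  exists m s, 0 <= s /\ law_eq P N01 X (fun x : R => m + s * x).
Proof.
move=> [mX [m [s Xms]]]; exists m, `|s|; split => // A mA.
rewrite Xms//; case: eqP => [->|/eqP s0]; last exact: normal_prob_affine.
rewrite normr0 diracE; have [/set_mem Am|Am] := boolP (m \in A).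
  rewrite [X in N01 X](_ : _ = setT) ?probability_setT//.
  by apply/seteqP; split => // x _ /=; rewrite mul0r addr0.
rewrite [X in N01 X](_ : _ = set0) ?measure0//.
apply/seteqP; split => // x /=; rewrite mul0r addr0 => /mem_set.
exact/negP.
Qed.

Lemma law_gaussian_rv d (T : measurableType d) (P : probability T R) (X : T -> R)
    (m s : R) : measurable_fun setT X -> 0 <= s ->
  law_eq P N01 X (fun x : R => m + s * x) -> gaussian_rv P X.
Proof.
move=> mX s0 Xms; split => //; exists m, s => A mA; rewrite Xms//.
case: eqP => [->|/eqP s1]; last by rewrite normal_prob_affine// ger0_norm.
rewrite diracE; have [/set_mem Am|Am] := boolP (m \in A).
  rewrite [X in N01 X](_ : _ = setT) ?probability_setT//.
  by apply/seteqP; split => // x _ /=; rewrite mul0r addr0.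
rewrite [X in N01 X](_ : _ = set0) ?measure0//.
apply/seteqP; split => // x /=; rewrite mul0r addr0 => /mem_set.
exact/negP.
Qed.

End standard_normal_representation.

Section unit_normal.
Context {R : realType}.

Definition unit_normal d (T : measurableType d) (P : probability T R) (X : T -> R) :=
  [/\ gaussian_rv P X, L2 P X, ip P X (fun=> 1) = 0 & nrm P X = 1].

Lemma nrm_affine d (T : measurableType d) (P : probability T R) (X : T -> R) (m s : R) :
  L2 P X -> ip P X (fun=> 1) = 0 ->
  [/\ L2 P (fun w => m + s * X w),
      ip P (fun w => m + s * X w) (fun=> 1) = m &
      nrm P (fun w => m + s * X w) = m ^+ 2 + s ^+ 2 * nrm P X].
Proof.
move=> LX X0; have Lm := L2_cst P m; have LsX := L2Z s LX; have L1 := L2_cst P 1.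
have ipm : ip P (fun=> m) (fun=> 1) = m.
  rewrite -[RHS](mulr1 m) -[in RHS](expr1n _ 2) -(nrm_cst P 1) -ipZl//.
  by congr ip; apply/funext => w; rewrite mulr1.
split; first exact: L2D.
- by rewrite ipDl// ipZl// X0 mulr0 addr0.
- rewrite nrmD// nrm_cst nrmZ// ipZr//.
  rewrite (_ : ip P (fun=> m) X = m * ip P (fun=> 1) X); last first.
    by rewrite -ipZl//; congr ip; apply/funext => w; rewrite mulr1.
  by rewrite (ipC _ _ X) X0 !mulr0 addr0.
Qed.

Lemma law_eq_sym d1 (T1 : measurableType d1) (P1 : probability T1 R)
    d2 (T2 : measurableType d2) (P2 : probability T2 R) (X1 : T1 -> R) (X2 : T2 -> R) :
  law_eq P1 P2 X1 X2 -> law_eq P2 P1 X2 X1.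
Proof. by move=> h A mA; rewrite h. Qed.

Lemma law_eq_trans d1 (T1 : measurableType d1) (P1 : probability T1 R)
    d2 (T2 : measurableType d2) (P2 : probability T2 R)
    d3 (T3 : measurableType d3) (P3 : probability T3 R)
    (X1 : T1 -> R) (X2 : T2 -> R) (X3 : T3 -> R) :
  law_eq P1 P2 X1 X2 -> law_eq P2 P3 X2 X3 -> law_eq P1 P3 X1 X3.
Proof. by move=> h1 h2 A mA; rewrite h1// h2. Qed.

Let affine_measurable (m s : R) : measurable_fun setT (fun x : R => m + s * x).
Proof. by apply: measurable_funD => //; exact: measurable_funM. Qed.

Let affine_comp_measurable d (T : measurableType d) (X : T -> R) (m s : R) :
  measurable_fun setT X -> measurable_fun setT (fun w => m + s * X w).
Proof. by move=> mX; apply: measurable_funD => //; exact: measurable_funM. Qed.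

Lemma gaussian_affine d (T : measurableType d) (P : probability T R) (X : T -> R)
    (m s : R) : 0 <= s -> gaussian_rv P X -> gaussian_rv P (fun w => m + s * X w).
Proof.
move=> s0 gX; have mX := gX.1.
have [m' [s' [s'0 l']]] := gaussian_rv_law gX.
apply: (@law_gaussian_rv _ _ _ _ _ (m + s * m') (s * s')).
- exact: affine_comp_measurable.
- exact: mulr_ge0.
- have := law_eq_comp l' (affine_measurable m s).
  congr law_eq; apply/funext => x; ring.
Qed.

Lemma law_eq_gaussian d1 (T1 : measurableType d1) (P1 : probability T1 R)
    d2 (T2 : measurableType d2) (P2 : probability T2 R) (X1 : T1 -> R) (X2 : T2 -> R) :
  measurable_fun setT X1 -> law_eq P1 P2 X1 X2 -> gaussian_rv P2 X2 -> gaussian_rv P1 X1.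
Proof.
move=> m1 l [m2 [m [s h]]]; split => //; exists m, s => A mA.
by rewrite l// h.
Qed.

Section representation.
Context d (T : measurableType d) (P : probability T R) (eta : T -> R).
Hypothesis eta1 : unit_normal P eta.

(** [X] and [eta] are both affine images of the standard normal law. Inverting the affine map of
    [eta] makes [X] an affine image of [eta] in law, and the mean and [nrm] of [X] then fix its two
    constants. *)
Lemma gaussian_unit_law d' (T' : measurableType d') (P' : probability T' R)
    (X : T' -> R) : gaussian_rv P' X -> L2 P' X -> ip P' X (fun=> 1) = 0 ->
  law_eq P' P X (fun w => Num.sqrt (nrm P' X) * eta w).
Proof.
case: eta1 => geta Leta eta0 eta2 gX LX X0.
have [m [s [s0 lX]]] := gaussian_rv_law gX.
have [m' [s' [s'0 leta]]] := gaussian_rv_law geta.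
(* Otherwise [eta] would have the law of a constant, equal to its mean 0, and [nrm] would be 0
   instead of 1. *)
have s'1 : s' != 0.
  apply/eqP => s'E; have lc : law_eq P N01 eta (fun=> m').
    by move: leta; rewrite s'E; congr law_eq; apply/funext => x; rewrite mul0r addr0.
  have e0 := law_eq_mean Leta.1 (measurable_cst m') lc.
  have [_ e1] := law_eq_L2 Leta.1 (measurable_cst m') lc Leta.
  have [_ e2 _] := nrm_affine m' 0 (L20 _) (ip0l N01 (fun=> 1)).
  move: e2; under eq_fun do rewrite mul0r addr0.
  rewrite -e0 eta0 => m0; move: e1; rewrite nrm_cst -m0 expr0n eta2.
  by move=> /esym/eqP; rewrite oner_eq0.
pose r := s / s'; have r0 : 0 <= r by rewrite divr_ge0.
have lN : law_eq P N01 (fun w => - (m' / s') + s'^-1 * eta w) (fun x => x).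
  have := law_eq_comp leta (affine_measurable (- (m' / s')) s'^-1).
  by congr law_eq; apply/funext => x; field.
have lE : law_eq P' P X (fun w => (m - r * m') + r * eta w).
  apply: (law_eq_trans lX); apply: law_eq_sym.
  have := law_eq_comp lN (affine_measurable m s).
  by congr law_eq; apply/funext => w; rewrite /r; field.
have [LA A0 A2] := nrm_affine (m - r * m') r Leta eta0.
have := law_eq_mean LX.1 LA.1 lE; rewrite X0 A0 => /esym c0.
have [_] := law_eq_L2 LX.1 LA.1 lE LX.
rewrite A2 c0 expr0n add0r eta2 mulr1 => <-.
rewrite sqrtr_sqr ger0_norm//; move: lE; rewrite c0.
by congr law_eq; apply/funext => w; rewrite add0r.
Qed.

(** Corresponding linear combinations are centered Gaussian with the same variance, hence both equal
    in law to the same multiple of [eta], and Cramer-Wold applies. [eta] is an intermediary that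
    need not live on either of the two probability spaces. *)
Lemma gaussian_process_fdd_eq (I : Type) (D : set I)
    d1 (T1 : measurableType d1) (P1 : probability T1 R)
    d2 (T2 : measurableType d2) (P2 : probability T2 R)
    (X1 : I -> T1 -> R) (X2 : I -> T2 -> R) :
  gaussian_process P1 D X1 -> gaussian_process P2 D X2 ->
  (forall t, D t -> L2 P1 (X1 t)) -> (forall t, D t -> L2 P2 (X2 t)) ->
  (forall t, D t -> ip P1 (X1 t) (fun=> 1) = 0) ->
  (forall t, D t -> ip P2 (X2 t) (fun=> 1) = 0) ->
  (forall s t, D s -> D t -> ip P1 (X1 s) (X1 t) = ip P2 (X2 s) (X2 t)) ->
  fdd_eq D P1 P2 X1 X2.
Proof.
move=> g1 g2 L1 L2' c1 c2 cov.
apply: cramer_wold => [t Dt|t Dt|n t a phi Dt]; [exact: (L1 t Dt).1|exact: (L2' t Dt).1|].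
have LC d0 (T0 : measurableType d0) (P0 : probability T0 R) (X : I -> T0 -> R) :
    (forall t, D t -> L2 P0 (X t)) -> (forall t, D t -> ip P0 (X t) (fun=> 1) = 0) ->
    [/\ L2 P0 (fun w => \sum_(i < n) a i * X (t i) w),
     ip P0 (fun w => \sum_(i < n) a i * X (t i) w) (fun=> 1) = 0 &
     nrm P0 (fun w => \sum_(i < n) a i * X (t i) w) =
     \sum_(i < n) \sum_(j < n) a i * (a j * ip P0 (X (t i)) (X (t j)))].
  move=> LX X0; have LaX i := L2Z (a i) (LX _ (Dt i)).
  have Ls : L2 P0 (fun w => \sum_(i < n) a i * X (t i) w) by exact: L2_sum.
  split => //.
    have [_ ->] := ip_suml (index_enum 'I_n) LaX (L2_cst P0 1).
    by rewrite big1// => i _; rewrite ipZl ?X0 ?mulr0//; [exact: LX|exact: L2_cst].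
  rewrite /nrm; have [_ ->] := ip_suml (index_enum 'I_n) LaX Ls.
  apply: eq_bigr => i _; rewrite ipC.
  have [_ ->] := ip_suml (index_enum 'I_n) LaX (LaX i).
  apply: eq_bigr => j _; rewrite ipC ipZl ?ipZr//; exact: LX.
have [A1 A2 A3] := LC _ _ _ _ L1 c1; have [B1 B2 B3] := LC _ _ _ _ L2' c2.
have n12 : nrm P1 (fun w => \sum_(i < n) a i * X1 (t i) w) =
           nrm P2 (fun w => \sum_(i < n) a i * X2 (t i) w).
  rewrite A3 B3; apply: eq_bigr => i _; apply: eq_bigr => j _.
  by rewrite cov.
have l1 := gaussian_unit_law (g1 n t a Dt) A1 A2.
have l2 := gaussian_unit_law (g2 n t a Dt) B1 B2.
rewrite -n12 in l2; have l := law_eq_trans l1 (law_eq_sym l2).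
apply: (law_eq_integral A1.1 B1.1 l (f := fun x => cos (x + phi))).
apply: measurableT_comp; first exact: continuous_measurable_fun (@continuous_cos R).
exact: measurable_funD.
Qed.

End representation.

End unit_normal.

Section gaussian_square_integrability.
Context {R : realType}.

(** Meant for an arbitrary sheet: its square integrability is not assumed but follows from its
    second moments being real numbers. *)
Lemma gaussian_process_L2 d (T : measurableType d) (P : probability T R) (I : Type)
    (D : set I) (B : I -> T -> R) (C : I -> R) :
  gaussian_process P D B ->
  (forall t, D t -> 'E_P[fun w => (B t w * B t w)%R]%E = (C t)%:E) ->
  forall t, D t -> L2 P (B t).
Proof.
move=> gB covB t Dt; split.
  have := (gB 1%N (fun=> t) (fun=> 1) (fun=> Dt)).1.
  by congr measurable_fun; apply/funext => w; rewrite big_ord1 mul1r.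
have := covB t Dt; rewrite unlock => e.
by under eq_integral do rewrite expr2; rewrite e ltry.
Qed.

End gaussian_square_integrability.

(** * Wiener integrals: isometry, Gaussianity, equality of distributions *)

Section cosine_means.
Context {R : realType}.

Lemma cos_lipschitz (x y : R) : `|cos x - cos y| <= `|x - y|.
Proof.
wlog xy : x y / y <= x.
  move=> H; have [xy|/ltW xy] := leP y x; first exact: H.
  by rewrite distrC (distrC x); exact: H.
have [|c _ ->] := @MVT_segment R cos (fun x => - sin x) y x xy.
- by apply: continuous_subspaceT => z; exact: continuous_cos.
- by rewrite normrM normrN ler_piMl// sin_max.
Qed.

Context d (T : measurableType d) (P : probability T R).

Definition cos_mean (X : T -> R) (phi : R) : R := \int[P]_w cos (X w + phi).

Lemma cos_integrable (X : T -> R) phi : measurable_fun setT X ->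
  P.-integrable setT (fun w => (cos (X w + phi))%:E).
Proof.
move=> mX; apply: (@measurable_bounded_integrable _ _ _ P _ _ measurableT).
- by rewrite (le_lt_trans (probability_le1 _ _))// ltry.
- apply: measurableT_comp; first exact: continuous_measurable_fun (@continuous_cos R).
  exact: measurable_funD.
- exists 1; split; first by rewrite num_real.
  by move=> N MN x _; exact: le_trans (cos_max _) (ltW MN).
Qed.

Lemma cos_mean_fin (X : T -> R) phi : measurable_fun setT X ->
  (\int[P]_w (cos (X w + phi))%:E = (cos_mean X phi)%:E)%E.
Proof.
move=> mX; rewrite /cos_mean /Rintegral fineK//.
exact: integrable_fin_num (cos_integrable phi mX).
Qed.

(** The cosine is 1-Lipschitz, and [|t| <= e + e^-1 * t ^+ 2] follows from [(|t| - e) ^+ 2 >= 0]. *)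
Lemma cos_mean_dist (X Y : T -> R) phi e : 0 < e -> L2 P X -> L2 P Y ->
  `|cos_mean X phi - cos_mean Y phi| <= e + e^-1 * nrm P (fun w => X w - Y w).
Proof.
move=> e0 LX LY; have LXY := L2B LX LY.
have iX := cos_integrable phi LX.1; have iY := cos_integrable phi LY.1.
have iXY : P.-integrable setT (fun w => (cos (X w + phi) - cos (Y w + phi))%:E).
  by under eq_fun do rewrite EFinB; exact: integrableB.
rewrite /cos_mean -RintegralB//.
apply: (le_trans (le_normr_Rintegral _ _)) => //.
have iq : P.-integrable setT (fun w => (e^-1 * ((X w - Y w) * (X w - Y w)))%:E).
  under eq_fun do rewrite EFinM.
  by apply: integrableZl => //; exact: L2_mul_integrable.
have ie : P.-integrable setT (fun=> e%:E) by exact: L2_integrable (L2_cst P e).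
have -> : e + e^-1 * nrm P (fun w => X w - Y w) =
    \int[P]_w (e + e^-1 * ((X w - Y w) * (X w - Y w))).
  rewrite RintegralD// RintegralZl//; last exact: L2_mul_integrable.
  rewrite Rintegral_cst//.
  have -> : (P : {measure set T -> \bar R}) setT = 1%E by exact: probability_setT.
  by rewrite /= mulr1.
apply: le_Rintegral => //.
- exact: (integrable_norm iXY).
- have : P.-integrable setT (fun w => e%:E + (e^-1 * ((X w - Y w) * (X w - Y w)))%:E)%E.
    exact: integrableD.
  by under eq_fun do rewrite -EFinD.
- move=> w _; apply: (le_trans (cos_lipschitz _ _)).
  rewrite (_ : X w + phi - (Y w + phi) = X w - Y w); last by ring.
  set t := X w - Y w; rewrite -(ler_pM2l e0) mulrDr mulVKf ?gt_eqF//.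
  have t2 : `|t| * `|t| = t * t by rewrite -normrM ger0_norm// -expr2 sqr_ge0.
  have := normr_ge0 t; have := sqr_ge0 (`|t| - e); rewrite expr2; nra.
Qed.

End cosine_means.

Section white_noise_integrals.
Context {R : realType} d (T : measurableType d) (P : probability T R).
Variable W : set (R3 R) -> T -> R.
Hypothesis whiteW : white_noise P W.
Implicit Types (h : R3 R -> R) (X : T -> R).

Let m3 : {measure set _ -> \bar R} := leb3 R.

Lemma white_noise_measurable A : finite_borel A -> measurable_fun setT (W A).
Proof.
move=> fA; case: whiteW => gW _ _.
have := (gW 1%N (fun=> A) (fun=> 1) (fun=> fA)).1.
by congr measurable_fun; apply/funext => w; rewrite big_ord1 mul1r.
Qed.

Lemma white_noise_L2 A : finite_borel A -> L2 P (W A).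
Proof.
move=> fA; case: whiteW => _ _ cov; split; first exact: white_noise_measurable.
have := cov A A fA fA; rewrite setIid unlock => h.
by under eq_integral do rewrite expr2; rewrite h; exact: fA.2.
Qed.

Lemma white_noise_mean A : finite_borel A -> ip P (W A) (fun=> 1) = 0.
Proof.
move=> fA; case: whiteW => _ cW _; have := cW A fA.
by rewrite expectation_L2; [case|exact: white_noise_L2].
Qed.

Lemma indic_L2 (A : set (R3 R)) : finite_borel A -> L2 m3 (\1_A : R3 R -> R).
Proof.
move=> [mA fA]; split; first exact: measurable_indic.
rewrite (_ : (\int[m3]_x _)%E = m3 A)//.
transitivity (\int[m3]_u (\1_A u)%:E)%E; last by rewrite integral_indic// setIT.
apply: eq_integral => u _; rewrite indicE.
by case: (u \in A); rewrite ?expr1n ?expr0n.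
Qed.

Lemma ip_indic (A B : set (R3 R)) : finite_borel A -> finite_borel B ->
  ip m3 (\1_A : R3 R -> R) (\1_B : R3 R -> R) = ip P (W A) (W B).
Proof.
move=> fA fB; case: whiteW => _ _ cov.
apply: EFin_inj; rewrite -expectation_mul; [|exact: white_noise_L2|exact: white_noise_L2].
rewrite cov// /ip /Rintegral.
have mAB : measurable (A `&` B) by apply: measurableI; [exact: fA.1|exact: fB.1].
have -> : (\int[m3]_u (\1_A u * \1_B u)%:E = leb3 R (A `&` B))%E.
  transitivity (\int[m3]_u (\1_(A `&` B) u)%:E)%E; last by rewrite integral_indic ?setIT.
  by apply: eq_integral => u _; rewrite indicI.
rewrite fineK// ge0_fin_numE ?measure_ge0//; apply: le_lt_trans fA.2.
by apply: (@le_measure _ _ _ (leb3 R)); rewrite ?inE; [|exact: fA.1|exact: subIsetl].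
Qed.

Definition simple_pair h X : Prop :=
  exists n (a : 'I_n -> R) (A : 'I_n -> set (R3 R)),
  [/\ forall i, finite_borel (A i),
      h = (fun u => \sum_(i < n) a i * \1_(A i) u) &
      X = (fun w => \sum_(i < n) a i * W (A i) w)].

Lemma simple_pair_L2 h X : simple_pair h X ->
  [/\ L2 m3 h, L2 P X, ip P X (fun=> 1) = 0, nrm P X = nrm m3 h & gaussian_rv P X].
Proof.
move=> [n [a [A [fA -> ->]]]].
have L1 i : L2 m3 (fun u => a i * \1_(A i) u) by apply: L2Z; exact: indic_L2.
have L2' i : L2 P (fun w => a i * W (A i) w) by apply: L2Z; exact: white_noise_L2.
have S1 := L2_sum (index_enum 'I_n) L1; have S2 := L2_sum (index_enum 'I_n) L2'.
split => //.
- have [_ ->] := ip_suml (index_enum 'I_n) L2' (L2_cst P 1).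
  rewrite big1// => i _; rewrite ipZl; [|exact: white_noise_L2|exact: L2_cst].
  by rewrite white_noise_mean ?mulr0.
- rewrite /nrm; have [_ ->] := ip_suml (index_enum 'I_n) L2' S2.
  have [_ ->] := ip_suml (index_enum 'I_n) L1 S1.
  apply: eq_bigr => i _; rewrite ipC [RHS]ipC.
  have [_ ->] := ip_suml (index_enum 'I_n) L2' (L2' i).
  have [_ ->] := ip_suml (index_enum 'I_n) L1 (L1 i).
  apply: eq_bigr => j _.
  rewrite !ipZl ?ipZr ?ip_indic//; by [exact: white_noise_L2|exact: indic_L2].
- by case: whiteW => gW _ _; exact: gW.
Qed.

Lemma simple_pairD h1 X1 h2 X2 : simple_pair h1 X1 -> simple_pair h2 X2 ->
  simple_pair (fun u => h1 u + h2 u) (fun w => X1 w + X2 w).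
Proof.
move=> [n [a [A [fA -> ->]]]] [m [b [B [fB -> ->]]]].
exists (n + m)%N, (fun i : 'I_(n + m) =>
    match fintype.split i with inl j => a j | inr k => b k end),
  (fun i : 'I_(n + m) =>
    match fintype.split i with inl j => A j | inr k => B k end).
split.
- by move=> i; case: (fintype.split i).
- apply/funext => u; rewrite big_split_ord/=; congr (_ + _); apply: eq_bigr => i _.
    by rewrite (unsplitK (inl i)).
  by rewrite (unsplitK (inr i)).
- apply/funext => u; rewrite big_split_ord/=; congr (_ + _); apply: eq_bigr => i _.
    by rewrite (unsplitK (inl i)).
  by rewrite (unsplitK (inr i)).
Qed.

Lemma simple_pairZ k h X : simple_pair h X ->
  simple_pair (fun u => k * h u) (fun w => k * X w).
Proof.
move=> [n [a [A [fA -> ->]]]]; exists n, (fun i => k * a i), A; split => //.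
- by apply/funext => u; rewrite mulr_sumr; apply: eq_bigr => i _; rewrite mulrA.
- by apply/funext => u; rewrite mulr_sumr; apply: eq_bigr => i _; rewrite mulrA.
Qed.

(** The closure of the simple pairs in the product of L^2(R^3) and L^2(P), that is, the graph of the
    Wiener integral. As a relation it requires neither an existence proof nor the choice of a
    version, and linearity is closure under sums and multiples. *)
Definition wint h X : Prop :=
  [/\ L2 m3 h, L2 P X & forall e, 0 < e -> exists s S,
    [/\ simple_pair s S, nrm m3 (fun u => h u - s u) < e &
        nrm P (fun w => X w - S w) < e]].

Lemma wintD h1 X1 h2 X2 : wint h1 X1 -> wint h2 X2 ->
  wint (fun u => h1 u + h2 u) (fun w => X1 w + X2 w).
Proof.
move=> [Lh1 LX1 H1] [Lh2 LX2 H2]; split; [exact: L2D|exact: L2D|] => e e0.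
have e4 : 0 < e / 4 by rewrite divr_gt0.
have [s1 [S1 [p1 a1 b1]]] := H1 _ e4; have [s2 [S2 [p2 a2 b2]]] := H2 _ e4.
have [Ls1 LS1 _ _ _] := simple_pair_L2 p1; have [Ls2 LS2 _ _ _] := simple_pair_L2 p2.
exists (fun u => s1 u + s2 u), (fun w => S1 w + S2 w); split.
- exact: simple_pairD.
- under eq_fun do rewrite opprD addrACA.
  apply: (le_lt_trans (nrmD_le (L2B Lh1 Ls1) (L2B Lh2 Ls2))); lra.
- under eq_fun do rewrite opprD addrACA.
  apply: (le_lt_trans (nrmD_le (L2B LX1 LS1) (L2B LX2 LS2))); lra.
Qed.

Lemma wintZ k h X : wint h X -> wint (fun u => k * h u) (fun w => k * X w).
Proof.
move=> [Lh LX H]; split; [exact: L2Z|exact: L2Z|] => e e0.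
have k0 : 0 < k ^+ 2 + 1 by rewrite ltr_wpDl// sqr_ge0.
have [|s [S [p a b]]] := H (e / (k ^+ 2 + 1)); first by rewrite divr_gt0.
have [Ls LS _ _ _] := simple_pair_L2 p.
have small x : 0 <= x -> x < e / (k ^+ 2 + 1) -> k ^+ 2 * x < e.
  by move=> x0; rewrite ltr_pdivlMr// => h'; lra.
exists (fun u => k * s u), (fun w => k * S w); split.
- exact: simple_pairZ.
- under eq_fun do rewrite -mulrBr.
  by rewrite nrmZ; [exact: small (nrm_ge0 _ _) a|exact: L2B].
- under eq_fun do rewrite -mulrBr.
  by rewrite nrmZ; [exact: small (nrm_ge0 _ _) b|exact: L2B].
Qed.

Lemma wint0 : wint (fun=> 0) (fun=> 0).
Proof.
split; [exact: L20|exact: L20|] => e e0.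
exists (fun=> 0), (fun=> 0); split.
- exists 0%N, (fun=> 0), (fun=> set0); split; first by case.
  + by apply/funext => u; rewrite big_ord0.
  + by apply/funext => u; rewrite big_ord0.
- by under eq_fun do rewrite subrr; rewrite /nrm ip0l.
- by under eq_fun do rewrite subrr; rewrite /nrm ip0l.
Qed.

Lemma wint_sum (I : Type) (r : seq I) (h : I -> R3 R -> R) (X : I -> T -> R) :
  (forall i, wint (h i) (X i)) ->
  wint (fun u => \sum_(i <- r) h i u) (fun w => \sum_(i <- r) X i w).
Proof.
move=> H; elim: r => [|i r IH].
  by under eq_fun do rewrite big_nil; under [X in wint _ X]eq_fun do rewrite big_nil;
    exact: wint0.
under eq_fun do rewrite big_cons; under [X in wint _ X]eq_fun do rewrite big_cons.
exact: wintD.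
Qed.

Lemma wint_ae h h' X : wint h X -> L2 m3 h' ->
  {ae m3, forall u, h u = h' u} -> wint h' X.
Proof.
move=> [Lh LX H] Lh' hh'.
split => // e e0; have [s [S [p a b]]] := H e e0; exists s, S; split => //.
have [Ls _ _ _ _] := simple_pair_L2 p.
have hs : {ae m3, forall u, h' u - s u = h u - s u} by apply: filterS hh' => u ->.
by rewrite /nrm (ip_ae_eq _ _ _ _ hs hs)//; exact: L2B.
Qed.

Lemma wint_nrm h X : wint h X -> nrm P X = nrm m3 h.
Proof.
move=> [Lh LX H]; apply: nrm_limit_eq => // e e0.
have [s [S [p a b]]] := H e e0; have [Ls LS _ n12 _] := simple_pair_L2 p.
by exists S, s.
Qed.

Lemma wint_ip h1 X1 h2 X2 : wint h1 X1 -> wint h2 X2 ->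
  ip P X1 X2 = ip m3 h1 h2.
Proof.
move=> w1 w2; have w12 := wintD w1 w2.
case: (w1) (w2) => Lh1 LX1 _ [Lh2 LX2 _].
by rewrite !ip_polarization// (wint_nrm w12) (wint_nrm w1) (wint_nrm w2).
Qed.

Lemma wint_mean h X : wint h X -> ip P X (fun=> 1) = 0.
Proof.
move=> [Lh LX H]; apply: (@eq_by_small _ _ _ 1) => e e0; rewrite subr0 mulr1.
(* [S] has mean 0, so the mean of [X] is that of [X - S]. Young's inequality with weight [e^-1]
   bounds twice this mean by [e^-1 * nrm (X - S) + e], which is below [2 * e] for this tolerance. *)
have [|s [S [p _ b]]] := H (e ^+ 2); first by rewrite exprn_gt0.
have [Ls LS mS _ _] := simple_pair_L2 p; have LXS := L2B LX LS.
have -> : ip P X (fun=> 1) = ip P (fun w => X w - S w) (fun=> 1).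
  rewrite (_ : (fun w => X w - S w) = fun w => X w + -1 * S w); last first.
    by apply/funext => w; rewrite mulN1r.
  have LS' := L2Z (-1) LS; have L1 := L2_cst P 1.
  by rewrite ipDl// ipZl// mS mulr0 addr0.
have ei : 0 < e^-1 by rewrite invr_gt0.
have := ip_young ei LXS (L2_cst P 1); rewrite nrm_cst expr1n invrK mulr1.
rewrite normrM ger0_norm// => h1.
have h2 : e^-1 * nrm P (fun w => X w - S w) < e.
  by rewrite mulrC ltr_pdivrMr// -expr2.
lra.
Qed.

Lemma unit_cube_finite_borel : finite_borel
  [set u : R3 R | [/\ `]0, 1]%classic (co1 u), `]0, 1]%classic (co2 u) &
                      `]0, 1]%classic (co3 u)]].
Proof.
split; first exact: measurable_box.
by rewrite leb3_box// lebesgue_measure_itv/= lte_fin ltr01 oppr0 adde0 !mule1 ltry.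
Qed.

Lemma simple_pair_wint h X : simple_pair h X -> wint h X.
Proof.
move=> p; have [Lh LX _ _ _] := simple_pair_L2 p; split => // e e0.
exists h, X; split => //.
- by under eq_fun do rewrite subrr; rewrite /nrm ip0l.
- by under eq_fun do rewrite subrr; rewrite /nrm ip0l.
Qed.

(** A set of volume 1 is enough. That [eta] is itself a Wiener integral lets the cosine formula be
    applied to its multiples as well. *)
Lemma white_noise_unit_normal :
  exists eta, unit_normal P eta /\ exists h, wint h eta.
Proof.
have fA := unit_cube_finite_borel; set A := (X in finite_borel X) in fA.
exists (W A); split; last first.
  exists (fun u => \sum_(i < 1) 1 * \1_A u); apply: simple_pair_wint.
  exists 1%N, (fun=> 1), (fun=> A); split => //.
  by apply/funext => w; rewrite big_ord1 mul1r.
split.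
- case: whiteW => gW _ _.
  have := gW 1%N (fun=> A) (fun=> 1) (fun=> fA).
  by congr gaussian_rv; apply/funext => w; rewrite big_ord1 mul1r.
- exact: white_noise_L2.
- exact: white_noise_mean.
- case: whiteW => _ _ cov; have := cov A A fA fA.
  rewrite (expectation_mul (white_noise_L2 fA) (white_noise_L2 fA)) setIid.
  rewrite /A leb3_box// lebesgue_measure_itv/= lte_fin ltr01 oppr0 adde0 !mule1.
  by move=> h; apply: EFin_inj; rewrite /nrm h.
Qed.

Section gaussian_integrals.
Context (eta : T -> R).
Hypothesis eta1 : unit_normal P eta.

Lemma wint_approx h X e : wint h X -> 0 < e -> exists S,
  [/\ L2 P S, ip P S (fun=> 1) = 0, gaussian_rv P S,
      nrm P (fun w => X w - S w) <= e & `|nrm P X - nrm P S| <= e].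
Proof.
move=> [Lh LX H] e0; have nX := nrm_ge0 P X.
(* Chosen so that [e1 * nrm X <= e / 2] in [nrm_dist]; the simple integral is then taken close
   enough for the other term, of factor [e1^-1 + 1], to be at most [e / 2] too. *)
pose e1 := e / 2 / (nrm P X + 1).
have nX1 : 0 < nrm P X + 1 by rewrite ltr_wpDl.
have e10 : 0 < e1 by rewrite !divr_gt0.
have k0 : 1 <= e1^-1 + 1 by rewrite lerDr invr_ge0 ltW.
have k1 : 0 < e1^-1 + 1 by exact: lt_le_trans k0.
have [|s [S [p _ b]]] := H (e / 2 / (e1^-1 + 1)); first by rewrite !divr_gt0.
have [_ LS mS _ gS] := simple_pair_L2 p; exists S; split => //.
  rewrite ltr_pdivlMr// in b.
  have := ler_peMr (nrm_ge0 P (fun w => X w - S w)) k0; lra.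
have := nrm_dist e10 LX LS; rewrite ltr_pdivlMr// in b.
have : e1 * nrm P X <= e / 2.
  by rewrite /e1 -mulrA ler_piMr ?divr_ge0 ?(ltW e0)// mulrC ler_pdivrMr// mul1r lerDl.
move=> ? h2; apply: (le_trans h2); rewrite mulrC in b; lra.
Qed.

(** Holds for the simple integrals [S], which are Gaussian by hypothesis, and passes to the limit:
    both [X - S] and the difference of the two multiples of [eta] are small in L^2. Two applications
    of [cos_mean_dist], each costing [2 * e], give the constant 4. *)
Lemma wint_cos_mean h X phi : wint h X ->
  cos_mean P X phi = cos_mean P (fun w => Num.sqrt (nrm P X) * eta w) phi.
Proof.
case: eta1 => geta Leta eta0 eta2.
move=> wX; apply: (@eq_by_small _ _ _ 4) => e e0.
have [Lh LX _] := wX.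
have [|S [LS mS gS nXS nXS']] := wint_approx wX (e := e ^+ 2); first by rewrite exprn_gt0.
have := gaussian_unit_law eta1 gS LS mS; set r := Num.sqrt (nrm P X); set r' := Num.sqrt (nrm P S).
move=> lS; have Lr := L2Z r Leta; have Lr' := L2Z r' Leta.
have eqc : cos_mean P S phi = cos_mean P (fun w => r' * eta w) phi.
  rewrite /cos_mean /Rintegral; congr fine.
  apply: (law_eq_integral LS.1 Lr'.1 lS (f := fun x => cos (x + phi))).
  apply: measurableT_comp; first exact: continuous_measurable_fun (@continuous_cos R).
  exact: measurable_funD.
have d1 := cos_mean_dist phi e0 LX LS.
have d2 := cos_mean_dist phi e0 Lr' Lr.
have n2 : nrm P (fun w => r' * eta w - r * eta w) <= e ^+ 2.
  under eq_fun do rewrite -mulrBl.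
  rewrite nrmZ// eta2 mulr1; apply: le_trans nXS'.
  have rr : r ^+ 2 = nrm P X by rewrite sqr_sqrtr ?nrm_ge0.
  have rr' : r' ^+ 2 = nrm P S by rewrite sqr_sqrtr ?nrm_ge0.
  have [r0 r'0] : 0 <= r /\ 0 <= r' by split; exact: sqrtr_ge0.
  (* Closeness of the squares [r ^+ 2], [r' ^+ 2] gives closeness of the roots:
     [|r' - r| <= r + r'], so [(r' - r) ^+ 2] is at most [|r ^+ 2 - r' ^+ 2|]. *)
  rewrite -rr -rr' subr_sqr normrM (ger0_norm (addr_ge0 r0 r'0)).
  rewrite -(ger0_norm (sqr_ge0 (r' - r))) expr2 normrM distrC ler_wpM2l//.
  by rewrite ler_norml; apply/andP; split; lra.
have ee x : x <= e ^+ 2 -> e^-1 * x <= e by move=> ?; rewrite mulrC ler_pdivrMr// -expr2.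
have := ee _ nXS; have := ee _ n2; move: d1 d2; rewrite eqc.
set a := cos_mean P X phi; set b := cos_mean P _ phi; set c := cos_mean P _ phi.
rewrite !ler_norml => /andP[? ?] /andP[? ?] ? ?; apply/andP; split; lra.
Qed.

(** [X] and [r * eta] have the same cosine means, and so do all their multiples. Cramer-Wold over a
    one-point index set gives equality in law, and [r * eta] is Gaussian. *)
Lemma wint_gaussian h X : (exists h', wint h' eta) -> wint h X -> gaussian_rv P X.
Proof.
move=> [h' weta] wX; case: (eta1) => geta Leta _ eta2; have [Lh LX _] := wX.
set r := Num.sqrt (nrm P X); have wr := wintZ r weta.
have Lr := L2Z r Leta.
have nr : nrm P (fun w => r * eta w) = nrm P X.
  by rewrite nrmZ// eta2 mulr1 sqr_sqrtr// nrm_ge0.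
have H : fdd_eq (setT : set unit) P P (fun=> X) (fun=> fun w => r * eta w).
  apply: cramer_wold => [_ _|_ _|n t a phi _]; [exact: LX.1|exact: Lr.1|].
  (* All [n] indices denote the same variable, so a linear combination collapses to the multiple by
     [A]. *)
  pose A := \sum_(i < n) a i.
  have wA := wintZ A wX; have wrA := wintZ A wr.
  have sE (Y : T -> R) : (fun w => (cos (\sum_(i < n) a i * Y w + phi))%:E) =
      fun w => (cos (A * Y w + phi))%:E.
    by apply/funext => w; rewrite mulr_suml.
  rewrite (sE X) (sE (fun w => r * eta w)).
  have [_ [mA _] _] := wA; have [_ [mrA _] _] := wrA.
  rewrite (cos_mean_fin P phi mA) (cos_mean_fin P phi mrA).
  by rewrite (wint_cos_mean _ wA) (wint_cos_mean _ wrA) (nrmZ A LX) (nrmZ A Lr) nr.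
have gr : gaussian_rv P (fun w => 0 + r * eta w).
  by apply: gaussian_affine => //; exact: sqrtr_ge0.
apply: (law_eq_gaussian LX.1 _ gr) => B mB.
have mB1 : measurable [set x : 1.-tuple R | B (tnth x ord0)].
  by have := @measurable_tnth _ R 1 ord0 measurableT B mB; rewrite setTI.
have := H 1%N (fun=> tt) (fun=> I) _ mB1.
rewrite (_ : [set w | _] = X @^-1` B); last first.
  by apply/seteqP; split => w /=; rewrite tnth_mktuple.
move=> ->; congr (P _); apply/seteqP; split => w /=;
  by rewrite tnth_mktuple add0r.
Qed.

End gaussian_integrals.

Section families.
Context (I : Type) (D : set I) (h : I -> R3 R -> R) (X : I -> T -> R).
Hypothesis hX : forall t, D t -> wint (h t) (X t).

Lemma wint_gaussian_process : gaussian_process P D X.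
Proof.
move=> n t a Dt; have [eta [eta1 weta]] := white_noise_unit_normal.
have := wint_sum (index_enum 'I_n) (fun i => wintZ (a i) (hX (Dt i))).
exact: (wint_gaussian eta1 weta).
Qed.

Lemma wint_fdd_eq (h' : I -> R3 R -> R) (X' : I -> T -> R) :
  (forall t, D t -> wint (h' t) (X' t)) ->
  (forall s t, D s -> D t -> ip m3 (h s) (h t) = ip m3 (h' s) (h' t)) ->
  fdd_eq D P P X X'.
Proof.
move=> hX' hh'; have [eta [eta1 weta]] := white_noise_unit_normal.
apply: (gaussian_process_fdd_eq eta1).
- exact: wint_gaussian_process.
- move=> n t a Dt.
  have := wint_sum (index_enum 'I_n) (fun i => wintZ (a i) (hX' _ (Dt i))).
  exact: (wint_gaussian eta1 weta).
- by move=> t Dt; case: (hX Dt).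
- by move=> t Dt; case: (hX' _ Dt).
- by move=> t Dt; exact: wint_mean (hX Dt).
- by move=> t Dt; exact: wint_mean (hX' _ Dt).
- move=> s t Ds Dt.
  by rewrite (wint_ip (hX Ds) (hX Dt)) (wint_ip (hX' _ Ds) (hX' _ Dt)) hh'.
Qed.

Lemma wint_fdd_eq_gaussian d' (T' : measurableType d') (P' : probability T' R)
    (B : I -> T' -> R) :
  gaussian_process P' D B -> centered P' D B ->
  (forall s t, D s -> D t ->
    'E_P'[fun w => (B s w * B t w)%R]%E = (ip m3 (h s) (h t))%:E) ->
  fdd_eq D P P' X B.
Proof.
move=> gB cB covB; have [eta [eta1 weta]] := white_noise_unit_normal.
have LB := gaussian_process_L2 gB (fun t Dt => covB t t Dt Dt).
apply: (gaussian_process_fdd_eq eta1) => //.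
- exact: wint_gaussian_process.
- by move=> t Dt; case: (hX Dt).
- by move=> t Dt; exact: wint_mean (hX Dt).
- move=> t Dt; apply: EFin_inj; rewrite -expectation_L2; last exact: LB.
  exact: cB.
- move=> s t Ds Dt; rewrite (wint_ip (hX Ds) (hX Dt)).
  by apply: EFin_inj; rewrite -covB// (expectation_mul (LB _ Ds) (LB _ Dt)).
Qed.

End families.

(** A finite integral of the square leaves infinite values on a null set only, so [fine], which
    sends them to 0, does not change the integrand in L^2. *)
Lemma in_L2_L2 (h : R3 R -> \bar R) : in_L2 h ->
  {ae m3, forall u, h u \is a fin_num} /\ L2 m3 (fine \o h).
Proof.
move=> [mh fh].
have mh2 : measurable_fun setT (fun u => h u ^+ 2)%E.
    exact: (emeasurable_funM mh mh).
have hfin : {ae m3, forall u, h u \is a fin_num}.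
  have ih : m3.-integrable setT (fun u => h u ^+ 2)%E.
    apply/integrableP; split => //.
    by under eq_integral do rewrite gee0_abs ?sqre_ge0//.
  apply: filterS (integrable_ae measurableT ih) => u /(_ I).
  by case: (h u) => //.
split => //; split; first exact: measurableT_comp.
rewrite (@ae_eq_integral _ _ _ m3 setT (fun u => h u ^+ 2)%E)//.
- by apply/measurable_EFinP; apply: measurable_funX; exact: measurableT_comp.
- by apply: filterS hfin => u hu _ /=; rewrite EFin_expe fineK.
Qed.

Lemma wiener_integral_wint (h : R3 R -> \bar R) X : in_L2 h ->
  wiener_integral P W h X -> wint (fine \o h) X.
Proof.
move=> Lh [mX H]; have [hfin Lf] := in_L2_L2 Lh.
(* Square integrability of [X] is not part of [wiener_integral]; it follows from the approximation
   at [e = 1], as a simple integral plus a square integrable error. *)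
have LX : L2 P X.
  have [n [a [A [fA _ h2]]]] := H 1 ltr01.
  have [|_ LS _ _ _] := @simple_pair_L2 (fun u => \sum_(i < n) a i * \1_(A i) u)
    (fun w => \sum_(i < n) a i * W (A i) w); first by exists n, a, A.
  rewrite (_ : X = fun w => (X w - \sum_(i < n) a i * W (A i) w) +
                            \sum_(i < n) a i * W (A i) w); last first.
    by apply/funext => w; rewrite subrK.
  apply: L2D => //; split; first by apply: measurable_funB => //; exact: LS.1.
  by move: h2; rewrite unlock => h2; rewrite (lt_trans h2)// ltry.
split => // e e0; have [n [a [A [fA h1 h2]]]] := H e e0.
have p : simple_pair (fun u => \sum_(i < n) a i * \1_(A i) u)
    (fun w => \sum_(i < n) a i * W (A i) w) by exists n, a, A.
have [Ls LS _ _ _] := simple_pair_L2 p.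
exists (fun u => \sum_(i < n) a i * \1_(A i) u), (fun w => \sum_(i < n) a i * W (A i) w).
split => //.
- rewrite -lte_fin -nrm_eint; last exact: L2B.
  rewrite (@ae_eq_integral _ _ _ m3 setT
    (fun u => (h u - (\sum_(i < n) a i * \1_(A i) u)%:E) ^+ 2)%E)//.
  + apply/measurable_EFinP; apply: measurable_funX; apply: measurable_funB.
      exact: Lf.1.
    exact: Ls.1.
  + have ms : measurable_fun setT (fun u => h u - (\sum_(i < n) a i * \1_(A i) u)%:E)%E.
      apply: emeasurable_funB; first exact: Lh.1.
      by apply/measurable_EFinP; exact: Ls.1.
    exact: (emeasurable_funM ms ms).
  + by apply: filterS hfin => u hu _ /=; rewrite EFin_expe EFinB fineK.
- by rewrite -lte_fin -nrm_eint; [rewrite unlock in h2|exact: L2B].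
Qed.

End white_noise_integrals.

(** * Integrability of powers near 0 and at infinity *)

Section power_singularities.
Context {R : realType}.
Notation mu := (@lebesgue_measure R).

(* A nonnegative [f] with [f z <= k f(l z) + C] near 0 and [f z <= k f(l z)]
   away from 0 is integrable as soon as [k < l]: substitute [l z] for [z] in
   the integrals of the truncations [f_ n]. *)
Lemma integral_by_scaling (f : R -> R) (f_ : nat -> R -> R) (l k C : R) :
  0 < l -> 0 <= k < l -> 0 <= C ->
  (forall n, measurable_fun setT (f_ n)) -> (forall n z, 0 <= f_ n z) ->
  (forall z, nondecreasing_seq (f_ ^~ z)) ->
  (forall z, \forall n \near \oo, f_ n z = f z) ->
  (forall n, \int[mu]_z (f_ n z)%:E < +oo)%E ->
  (forall n z, f_ n z <= k * f_ n (l * z) + C * \1_(`[-2, 2]%classic) z) ->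
  (\int[mu]_z (f z)%:E < +oo)%E.
Proof.
move=> l0 /andP[k0 kl] C0 mf f0 ndf cvf fin ineq.
have mI : measurable (`[-2, 2]%classic : set R) by exact: measurable_itv.
have mE n : measurable_fun setT (fun z => (f_ n z)%:E) by apply/measurable_EFinP.
have scale n : (\int[mu]_z (f_ n (l * z))%:E = l^-1%:E * \int[mu]_z (f_ n z)%:E)%E.
  have [_ sc] := lebesgue_scales 0 l0.
  rewrite -(sc (fun z => (f_ n z)%:E) (mE n)); last by move=> x; rewrite lee_fin.
  rewrite muleA -EFinM mulVf ?gt_eqF// mul1e.
  by apply: eq_integral => z _; rewrite addr0.
have mfl n : measurable_fun setT (fun z => f_ n (l * z)).
  by apply: measurableT_comp => //; exact: measurable_funM.
have mEl n : measurable_fun setT (fun z => (f_ n (l * z))%:E) by apply/measurable_EFinP.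
have mEk n : measurable_fun setT (fun z => (k * f_ n (l * z))%:E).
  by apply/measurable_EFinP; exact: measurable_funM.
have m1 : measurable_fun setT (fun z : R => (\1_(`[-2, 2]%classic) z : R)%:E).
  by apply/measurable_EFinP; exact: measurable_indic.
have mC : measurable_fun setT (fun z : R => (C * \1_(`[-2, 2]%classic) z)%:E).
  by apply/measurable_EFinP; apply: measurable_funM => //; exact: measurable_indic.
(* Substitution turns the pointwise inequality into [I <= (k / l) * I + 4 * C] for the truncated
   integral [I], 4 being the length of [[-2, 2]]. Since [I] is finite, the inequality can be solved
   for [I], with a bound free of [n]. *)
have bound n : (\int[mu]_z (f_ n z)%:E <= (C * 4 / (1 - k / l))%:E)%E.
  have h : (\int[mu]_z (f_ n z)%:E <=
      (k / l)%:E * \int[mu]_z (f_ n z)%:E + (C * 4)%:E)%E.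
    apply: (@le_trans _ _ (\int[mu]_z ((k * f_ n (l * z))%:E +
       (C * \1_(`[-2, 2]%classic) z)%:E))%E).
      apply: ge0_le_integral => //.
      - by move=> z _; rewrite lee_fin.
      - exact: mE.
      - by apply: emeasurable_funD; [exact: mEk|exact: mC].
      - by move=> z _; rewrite -EFinD lee_fin.
    rewrite ge0_integralD; try by [|exact: mEk|exact: mC|move=> z _; rewrite lee_fin mulr_ge0].
    under eq_integral do rewrite EFinM.
    rewrite ge0_integralZl; try by [|exact: mEl|move=> z _; rewrite lee_fin].
    rewrite scale muleA -EFinM; apply: leeD => //.
    under eq_integral do rewrite EFinM.
    rewrite ge0_integralZl; try by [|exact: m1|move=> z _; rewrite lee_fin].
    rewrite integral_indic// setIT.
    have h4 : mu (`[-2, 2]%classic : set R) = 4%:E.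
      rewrite lebesgue_measure_itv/= lte_fin ifT; last by lra.
      by rewrite -EFinB; congr EFin; lra.
    by rewrite [X in (C%:E * X)%E]h4 -EFinM lee_fin.
  have fi : (0 <= \int[mu]_z (f_ n z)%:E)%E by apply: integral_ge0 => z _; rewrite lee_fin.
  have := fin n; move: fi h.
  case: (\int[mu]_z (f_ n z)%:E)%E => [r| |]//.
  rewrite -EFinM -EFinD !lee_fin => r0 h _.
  have kl1 : k / l < 1 by rewrite ltr_pdivrMr// mul1r.
  by rewrite ler_pdivlMr ?subr_gt0// mulrBr mulr1 mulrC; lra.
have cvgI : (\int[mu]_z (f_ n z)%:E)%E @[n --> \oo] --> (\int[mu]_z (f z)%:E)%E.
  have fE : (fun z => (f z)%:E) = fun z => limn (fun n => (f_ n z)%:E).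
    apply/funext => z; apply/esym/cvg_lim => //; apply: cvg_near_cst.
    by apply: filterS (cvf z) => n ->.
  rewrite fE; apply: cvg_monotone_convergence; try by [|exact: mE|move=> n z _; rewrite lee_fin].
  by move=> z _ m n mn; rewrite lee_fin; exact: ndf.
have : (\int[mu]_z (f z)%:E <= (C * 4 / (1 - k / l))%:E)%E.
  rewrite -(cvg_lim _ cvgI)//; apply: lime_le.
    by apply/cvg_ex; eexists; exact: cvgI.
  exact: nearW.
by move/le_lt_trans; apply; exact: ltry.
Qed.

Definition near0 (a z : R) : R := if `|z| <= 1 then `|z| `^ (- a) else 0.
Definition far0 (b z : R) : R := if `|z| <= 1 then 0 else `|z| `^ (- b).

Lemma near0_ge0 a z : 0 <= near0 a z.
Proof. by rewrite /near0; case: ifP => // _; exact: powR_ge0. Qed.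

Lemma far0_ge0 b z : 0 <= far0 b z.
Proof. by rewrite /far0; case: ifP => // _; exact: powR_ge0. Qed.

Let measurable_abs_powR (p : R) : measurable_fun setT (fun z : R => `|z| `^ p).
Proof. by apply: (measurableT_comp (measurable_powR p)); exact: normr_measurable. Qed.

Let measurable_abs_le1 : measurable_fun setT (fun z : R => `|z| <= 1).
Proof. by apply: measurable_fun_ler => //; exact: normr_measurable. Qed.

Lemma measurable_near0 a : measurable_fun setT (near0 a).
Proof. exact: measurable_fun_ifT. Qed.

Lemma measurable_far0 b : measurable_fun setT (far0 b).
Proof. exact: measurable_fun_ifT. Qed.

Lemma two_powR_lt (a : R) : a < 1 -> (2 : R) `^ a < 2.
Proof.
move=> a1; have p1 : (1 : R) `^ (1 - a) < 2 `^ (1 - a).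
  by apply: gt0_ltr_powR; rewrite ?subr_gt0// ?nnegrE ?ltr1n.
rewrite powR1 in p1.
rewrite -[ltRHS](_ : (2 : R) `^ a * 2 `^ (1 - a) = 2).
  by rewrite ltr_pMr// powR_gt0.
have h : (a + (1 - a) == 0) ==> ((2 : R) != 0) by apply/implyP => _; rewrite pnatr_eq0.
by rewrite -(powRD h) addrC subrK powRr1.
Qed.

Let nat_bound_integrable (g : R -> R) n : measurable_fun setT g ->
  (forall z, 0 <= g z <= n%:R * \1_(`[- n%:R, n%:R]%classic) z) ->
  (\int[mu]_z (g z)%:E < +oo)%E.
Proof.
move=> mg gb.
pose J : set R := `[- n%:R, n%:R]%classic.
have mI : measurable J by exact: measurable_itv.
have m1 : measurable_fun setT (fun z : R => (\1_J z : R)%:E).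
  by apply/measurable_EFinP; exact: measurable_indic.
have mg' : measurable_fun setT (fun z => (g z)%:E) by apply/measurable_EFinP.
apply: (@le_lt_trans _ _ (\int[mu]_z ((n%:R)%R%:E * (\1_J z)%:E))%E).
  apply: ge0_le_integral => //.
  - by move=> z _; rewrite lee_fin; case/andP: (gb z).
  - by apply: emeasurable_funM.
  - by move=> z _; rewrite -EFinM lee_fin; case/andP: (gb z).
rewrite ge0_integralZl; try by [|exact: m1|move=> z _; rewrite lee_fin].
rewrite integral_indic// setIT.
have h4 : (mu J < +oo)%E.
  by rewrite lebesgue_measure_itv/= lte_fin; case: ifP => _; rewrite ?ltry// -EFinB ltry.
by apply: lte_mul_pinfty => //; rewrite lee_fin.
Qed.

(** Scaling by 2: for [|z| <= 1/2] the function is [2 ^ a] times its value at [2 * z], and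
    [2 ^ a < 2]; for [1/2 < |z| <= 1] it is at most [2 ^ a]. Truncating the height at [n] respects
    this because [2 ^ a >= 1]. *)
Lemma near0_integrable a : 0 < a < 1 -> (\int[mu]_z (near0 a z)%:E < +oo)%E.
Proof.
move=> /andP[a0 a1]; have two0 : (0 : R) < 2 by [].
have p0 : 0 < (2 : R) `^ a by exact: powR_gt0.
have p1 : 1 <= (2 : R) `^ a.
  rewrite -[leLHS](powRr0 2); apply: ler_powR; last exact: ltW.
  by rewrite ler1n.
pose f_ n z := Num.min (near0 a z) n%:R.
have f_ge0 n z : 0 <= f_ n z by rewrite /f_ le_min near0_ge0 ler0n.
have mf n : measurable_fun setT (f_ n).
  by apply: measurable_minr => //; exact: measurable_near0.
apply: (@integral_by_scaling (near0 a) f_ 2 (2 `^ a) (2 `^ a)) => //.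
- by rewrite (ltW p0) two_powR_lt.
- move=> z m n mn; rewrite /f_ le_min ge_min lexx/= ge_min orbC.
  by rewrite (ler_nat R) mn.
- move=> z; near=> n; rewrite /f_; apply/min_idPl/ltW.
  by near: n; exact: nbhs_infty_gtr.
- move=> n; apply: (@nat_bound_integrable _ n.+1) => // z; rewrite f_ge0/=.
  rewrite indicE; have [_|zn] := boolP (z \in _).
    by rewrite mulr1 /f_ ge_min ler_nat leqnSn orbT.
  rewrite mulr0 /f_ ge_min; apply/orP; left; rewrite /near0.
  case: ifP => // z1; case/negP: zn; rewrite inE/= in_itv/= -ler_norml.
  by rewrite (le_trans z1)// ler1n.
- move=> n z; have q0 := f_ge0 n (2 * z).
  case: (leP `|z| 1) => z1; last first.
    have -> : f_ n z = 0 by rewrite /f_ /near0 ifF ?min_l ?ler0n//; exact: lt_geF.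
    by rewrite addr_ge0 ?mulr_ge0 ?(ltW p0).
  rewrite /f_ /near0 z1 indicE.
  rewrite mem_set ?mulr1; last by rewrite /= in_itv/= -ler_norml; lra.
  rewrite normrM (ger0_norm (ltW two0)).
  have y0 : 0 <= `|z| `^ (- a) by exact: powR_ge0.
  have n0 : (0 : R) <= n%:R by exact: ler0n.
  case: (leP (2 * `|z|) 1) => z2.
    rewrite powRM// (powRN 2); set y := `|z| `^ (- a) in y0 *.
    rewrite -[leLHS]addr0 lerD ?(ltW p0)// minr_pMr ?(ltW p0)// mulVKf ?gt_eqF//.
    by rewrite le_min ge_min lexx/= ge_min ler_peMl// orbT.
  rewrite (min_l n0) mulr0 add0r ge_min; apply/orP; left.
  have zp : 0 < `|z| by rewrite -(ltr_pM2l two0) mulr0 (lt_trans ltr01).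
  rewrite powRN -[leRHS]mul1r -ler_pdivrMr// -invfM -powRM//.
  rewrite invf_le1 ?powR_gt0 ?mulr_gt0// mulrC.
  rewrite -[leLHS](powRr0 (2 * `|z|)); apply: ler_powR; exact: ltW.
Unshelve. all: by end_near. Qed.

(** Scaling by 1/2: for [|z| > 2] the function is [2 ^ (- b)] times its value at [z / 2], and
    [2 ^ (- b) < 1/2]; elsewhere it is at most 1. Here the truncation is the window [[-n, n]], which
    contains [z / 2] whenever it contains [z]. *)
Lemma far0_integrable b : 1 < b -> (\int[mu]_z (far0 b z)%:E < +oo)%E.
Proof.
move=> b1; have two0 : (0 : R) < 2 by [].
have h0 : (0 : R) < 2^-1 by rewrite invr_gt0.
have p0 : 0 < (2 : R) `^ b by exact: powR_gt0.
have p1 : 2 < (2 : R) `^ b.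
  have : (1 : R) `^ (b - 1) < 2 `^ (b - 1).
    by apply: gt0_ltr_powR; rewrite ?subr_gt0// ?nnegrE ?ltr1n.
  rewrite powR1 powRB; last by rewrite pnatr_eq0 implybT.
  by rewrite powRr1// ltr_pdivlMr// mul1r.
have far_le1 z : far0 b z <= 1.
  rewrite /far0; case: ifPn => //; rewrite -ltNge => z1.
  rewrite -[leRHS](powRr0 `|z|); apply: ler_powR; first exact: ltW.
  by rewrite oppr_le0; lra.
pose f_ n z := far0 b z * \1_(`[- n%:R, n%:R]%classic) z.
have f_ge0 n z : 0 <= f_ n z by rewrite /f_ mulr_ge0// far0_ge0.
have mf n : measurable_fun setT (f_ n).
  apply: measurable_funM; first exact: measurable_far0.
  by apply: measurable_indic; exact: measurable_itv.
have memE n z : ((z \in `[- (n%:R : R), n%:R]%classic) = (`|z| <= n%:R)).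
  by apply/idP/idP; rewrite inE/= in_itv/= ler_norml.
apply: (@integral_by_scaling (far0 b) f_ 2^-1 (2 `^ b)^-1 1) => //.
- by rewrite invr_ge0 (ltW p0) ltf_pV2.
- move=> z m n mn; rewrite /f_ ler_wpM2l ?far0_ge0// !indicE ler_nat !memE.
  by case: (leP `|z| m%:R) => // zm; rewrite (le_trans zm)// ler_nat.
- move=> z; near=> n; rewrite /f_ indicE memE.
  suff -> : `|z| <= n%:R by rewrite mulr1.
  by apply: ltW; near: n; exact: nbhs_infty_gtr.
- move=> n; apply: (@nat_bound_integrable _ n) => // z; rewrite f_ge0/=.
  rewrite /f_ indicE memE; case: n => [|n].
    case: (leP `|z| 0) => z0; last by rewrite !mulr0.
    by rewrite /far0 (le_trans z0)// !mul0r.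
  by rewrite ler_wpM2r// (le_trans (far_le1 z))// ler1n.
- move=> n z; rewrite [in leRHS]indicE.
  have -> : (z \in `[-2, 2]%classic) = (`|z| <= 2).
    by apply/idP/idP; rewrite inE/= in_itv/= ler_norml.
  case: (leP `|z| 2) => z2.
    rewrite mul1r (@le_trans _ _ 1)//.
      by rewrite /f_ -[leRHS]mulr1 ler_pM// ?far0_ge0// indicE lern1 leq_b1.
    by rewrite lerDr mulr_ge0// invr_ge0 ltW.
  rewrite mulr0 addr0 /f_ !indicE !memE /far0 normrM (gtr0_norm h0).
  have z1 : (`|z| <= 1) = false by apply: lt_geF; lra.
  have z3 : (2^-1 * `|z| <= 1) = false by apply: lt_geF; lra.
  rewrite z1 z3.
  have e2 : (2^-1 : R) `^ (- b) = 2 `^ b.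
    by rewrite -[in LHS](powR_inv1 (ltW two0)) -powRrM mulN1r opprK.
  rewrite powRM ?(ltW h0)// e2 -!mulrA mulKf ?gt_eqF//.
  rewrite ler_wpM2l ?powR_ge0// ler_nat.
  case: (leP `|z| n%:R) => // zn.
  rewrite (_ : 2^-1 * `|z| <= n%:R)//; lra.
Unshelve. all: by end_near. Qed.

Lemma near0_sqr a z : near0 a z * near0 a z = near0 (2 * a) z.
Proof.
rewrite /near0; case: ifP => _; last by rewrite mulr0.
by rewrite -expr2 -powR_mulrn ?powR_ge0// -powRrM mulNr mulrC.
Qed.

Lemma far0_sqr b z : far0 b z * far0 b z = far0 (2 * b) z.
Proof.
rewrite /far0; case: ifP => _; first by rewrite mulr0.
by rewrite -expr2 -powR_mulrn ?powR_ge0// -powRrM mulNr mulrC.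
Qed.

Lemma near0N a z : near0 a (- z) = near0 a z.
Proof. by rewrite /near0 normrN. Qed.

Lemma far0N b z : far0 b (- z) = far0 b z.
Proof. by rewrite /far0 normrN. Qed.

End power_singularities.

(* The kernel of the field is a product over the axes of functions of [u_j] and
   [t_j] in one of three ways: with [w_j] the coordinate restricted to the
   interval of the indicator and [z_j] the coordinate entering [rho],
   [White] has [(w, z) = (u, t)], [Conv] has [(t, t - u)], [Flat] has [(t, u)]. *)
Inductive axis_kind := White | Conv | Flat.

(** * Square integrability on one axis *)

Section axes.
Context {R : realType}.
Notation mu := (@lebesgue_measure R).
Implicit Types (I : set R) (g : R -> R) (k : axis_kind).

Definition wco k (u t : R) : R := if k is White then u else t.
Definition zco k (u t : R) : R :=
  match k with White => t | Conv => t - u | Flat => u end.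

(** Thresholds that make [smear] square integrable: [a < top_exp] at the singularity, [b > bot_exp]
    at infinity. [White] integrates the profile over all [z], so both are 1; [Flat] squares it, so
    both are 1/2; [Conv] averages over a bounded interval, so an integrable singularity is harmless
    and the tail need only be square integrable. *)
Definition top_exp k : R := if k is Flat then 2^-1 else 1.
Definition bot_exp k : R := if k is White then 1 else 2^-1.

(** The bound of the kernel is a product over the axes; its integral over [t] is a product of three
    functions of this form. *)
Definition smear k I g (u : R) : \bar R :=
  (\int[mu]_t (\1_I (wco k u t) * g (zco k u t))%:E)%E.

Lemma measurable_wco k : measurable_fun setT (fun p : R * R => wco k p.1 p.2).
Proof. by case: k; [exact: measurable_fst|exact: measurable_snd|exact: measurable_snd]. Qed.

Lemma measurable_zco k : measurable_fun setT (fun p : R * R => zco k p.1 p.2).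
Proof.
case: k; [exact: measurable_snd| |exact: measurable_fst].
by apply: measurable_funB; [exact: measurable_snd|exact: measurable_fst].
Qed.

Let smear_fun_measurable k I g : measurable I -> measurable_fun setT g ->
  measurable_fun setT (fun p : R * R => (\1_I (wco k p.1 p.2) * g (zco k p.1 p.2))%:E).
Proof.
move=> mI mg; apply/measurable_EFinP; apply: measurable_funM.
  by apply: measurableT_comp; [exact: measurable_indic|exact: measurable_wco].
by apply: measurableT_comp => //; exact: measurable_zco.
Qed.

Lemma smear_ge0 k I g u : (forall z, 0 <= g z) -> (0 <= smear k I g u)%E.
Proof. by move=> g0; apply: integral_ge0 => t _; rewrite lee_fin mulr_ge0. Qed.

Lemma measurable_smear k I g : measurable I -> measurable_fun setT g ->
  (forall z, 0 <= g z) -> measurable_fun setT (smear k I g).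
Proof.
move=> mI mg g0.
apply: (@measurable_fun_fubini_tonelli_F _ _ _ _ _ mu
  (fun p : R * R => (\1_I (wco k p.1 p.2) * g (zco k p.1 p.2))%:E)).
  exact: smear_fun_measurable.
by move=> p; rewrite lee_fin mulr_ge0.
Qed.

Let mEg g : measurable_fun setT g -> measurable_fun setT (fun z => (g z)%:E).
Proof. by move=> mg; apply/measurable_EFinP. Qed.

Let m1E I : measurable I -> measurable_fun setT (fun z : R => (\1_I z : R)%:E).
Proof. by move=> mI; apply/measurable_EFinP; exact: measurable_indic. Qed.

Let int1 I : measurable I -> (\int[mu]_t (\1_I t)%:E = mu I)%E.
Proof. by move=> mI; rewrite integral_indic ?setIT. Qed.

Lemma integral_shift g (c : R) : measurable_fun setT g -> (forall z, 0 <= g z) ->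
  (\int[mu]_z (g (z - c))%:E = \int[mu]_z (g z)%:E)%E.
Proof.
move=> mg g0; have [_ sc] := lebesgue_scales (- c) (@ltr01 R).
rewrite -(sc (fun z => (g z)%:E)); [|exact: mEg|by move=> x; rewrite lee_fin].
by rewrite mul1e; apply: eq_integral => z _; rewrite mul1r.
Qed.

Lemma smear_White I g u : measurable I -> measurable_fun setT g ->
  (forall z, 0 <= g z) ->
  smear White I g u = ((\1_I u)%:E * \int[mu]_t (g t)%:E)%E.
Proof.
move=> mI mg g0; rewrite /smear/=; under eq_integral do rewrite EFinM.
by rewrite ge0_integralZl; try by [|exact: mEg|move=> z _; rewrite lee_fin].
Qed.

Lemma smear_Flat I g u : measurable I -> (forall z, 0 <= g z) ->
  smear Flat I g u = (mu I * (g u)%:E)%E.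
Proof.
move=> mI g0; rewrite /smear/=; under eq_integral do rewrite EFinM.
rewrite ge0_integralZr; try by [|exact: m1E|move=> z _; rewrite lee_fin|rewrite lee_fin].
by rewrite int1.
Qed.

Lemma smear_Conv_le I g u : measurable I -> measurable_fun setT g ->
  (forall z, 0 <= g z) -> (smear Conv I g u <= \int[mu]_t (g t)%:E)%E.
Proof.
move=> mI mg g0; rewrite -(integral_shift u mg g0); apply: ge0_le_integral => //=.
- by move=> t _; rewrite lee_fin mulr_ge0.
- apply: mEg; apply: measurable_funM; first exact: measurable_indic.
  by apply: measurableT_comp => //; exact: measurable_funB.
- by apply: mEg; apply: measurableT_comp => //; exact: measurable_funB.
- by move=> t _; rewrite lee_fin -[leRHS]mul1r ler_wpM2r.
Qed.

Lemma integral_smear_Conv I g : measurable I -> measurable_fun setT g ->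
  (forall z, 0 <= g z) -> (forall z, g (- z) = g z) ->
  (\int[mu]_u smear Conv I g u = mu I * \int[mu]_t (g t)%:E)%E.
Proof.
move=> mI mg g0 gN.
rewrite [LHS](@fubini_tonelli _ _ _ _ _ mu mu
  (fun p : R * R => (\1_I (wco Conv p.1 p.2) * g (zco Conv p.1 p.2))%:E)); last 2 first.
- exact: smear_fun_measurable.
- by move=> p; rewrite lee_fin mulr_ge0.
rewrite /fubini_G/=.
transitivity (\int[mu]_t ((\1_I t)%:E * \int[mu]_z (g z)%:E))%E.
  apply: eq_integral => t _; under eq_integral do rewrite EFinM.
  rewrite ge0_integralZl; try by [|move=> z _; rewrite lee_fin|
    apply: mEg; apply: measurableT_comp => //; exact: measurable_funB].
  congr (_ * _)%E; rewrite -(integral_shift t mg g0).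
  by apply: eq_integral => u _; rewrite -gN opprB.
rewrite ge0_integralZr; try by [|exact: m1E|move=> z _; rewrite lee_fin|
  apply: integral_ge0 => z _; rewrite lee_fin].
by rewrite int1.
Qed.

(** Cauchy-Schwarz up to the factor 2: the square is a double integral over [s, t] in [I] of
    [g (t - u) * g (s - u)], bounded by the sum of the two squares, and each square contributes
    [mu I] times the same integral. *)
Lemma smear_Conv_sqr I g u : measurable I -> measurable_fun setT g ->
  (forall z, 0 <= g z) ->
  (smear Conv I g u * smear Conv I g u <=
   2%:E * mu I * smear Conv I (fun z => g z * g z)%R u)%E.
Proof.
move=> mI mg g0; set F := smear Conv I g u.
have mgu : measurable_fun setT (fun t : R => g (t - u)).
  by apply: measurableT_comp => //; exact: measurable_funB.
have m1g : measurable_fun setT (fun t : R => (\1_I t * g (t - u))%:E).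
  by apply: mEg; apply: measurable_funM => //; exact: measurable_indic.
have m1gg : measurable_fun setT (fun t : R => (\1_I t * (g (t - u) * g (t - u)))%:E).
  apply: mEg; apply: measurable_funM; first exact: measurable_indic.
  exact: measurable_funM.
have F0 : (0 <= F)%E by exact: smear_ge0.
have S0 : (0 <= smear Conv I (fun z => g z * g z)%R u)%E.
  by apply: smear_ge0 => z; rewrite mulr_ge0.
set S := smear Conv I _ u in S0 *.
have inner t : ((\1_I t * g (t - u))%:E * F <=
    (\1_I t * (g (t - u) * g (t - u)))%:E * mu I + (\1_I t)%:E * S)%E.
  rewrite {1}/F /smear -ge0_integralZl; try by [|exact: m1g|
    move=> z _; rewrite lee_fin mulr_ge0|rewrite lee_fin mulr_ge0].
  rewrite -[X in (_ * X + _)%E](int1 mI) /S /smear.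
  rewrite -ge0_integralZl; try by [|exact: m1E|move=> z _; rewrite lee_fin|
    rewrite lee_fin !mulr_ge0].
  rewrite -ge0_integralZl; try by [|exact: m1gg|move=> z _; rewrite lee_fin !mulr_ge0|
    rewrite lee_fin].
  rewrite -ge0_integralD; try by [|move=> z _; rewrite -EFinM lee_fin !mulr_ge0|
    apply: emeasurable_funM => //; exact: m1E|exact: emeasurable_funM].
  apply: ge0_le_integral; try by [|move=> z _; rewrite -EFinM lee_fin !mulr_ge0|
    exact: emeasurable_funM].
  - by apply: emeasurable_funD; apply: emeasurable_funM => //; exact: m1E.
  - move=> s _; rewrite -!EFinM -EFinD lee_fin /=.
    set x := g (t - u); set y := g (s - u).
    have i0 : 0 <= (\1_I t : R) * \1_I s by rewrite mulr_ge0.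
    have xy : 0 <= x * x + y * y - x * y.
      have := sqr_ge0 (x - y); have := mulr_ge0 (g0 (t - u)) (g0 (s - u)).
      by rewrite -/x -/y !expr2; nra.
    by have := mulr_ge0 i0 xy; nra.
have FF : (F * F = \int[mu]_t ((\1_I t * g (t - u))%:E * F))%E.
  by rewrite ge0_integralZr; try by [|exact: m1g|move=> z _; rewrite lee_fin mulr_ge0].
rewrite FF; apply: (@le_trans _ _ (\int[mu]_t
   ((\1_I t * (g (t - u) * g (t - u)))%:E * mu I + (\1_I t)%:E * S))%E).
  apply: ge0_le_integral => //.
  - by move=> t _; rewrite mule_ge0// lee_fin mulr_ge0.
  - by apply: emeasurable_funM.
  - by apply: emeasurable_funD; apply: emeasurable_funM => //; exact: m1E.
rewrite ge0_integralD; try by [|move=> z _; rewrite mule_ge0// lee_fin !mulr_ge0|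
    exact: emeasurable_funM|apply: emeasurable_funM => //; exact: m1E].
rewrite ge0_integralZr; try by [|exact: m1gg|move=> z _; rewrite lee_fin !mulr_ge0].
rewrite ge0_integralZr; try by [|exact: m1E|move=> z _; rewrite lee_fin].
rewrite int1// -/S (muleC S) -ge0_muleDl ?measure_ge0//.
by rewrite (_ : 2%:E = 1%:E + 1%:E)%E ?ge0_muleDl ?mul1e ?measure_ge0// -EFinD.
Qed.

Lemma smear_ConvD I g (h : R -> R) u : measurable I -> measurable_fun setT g ->
  measurable_fun setT h -> (forall z, 0 <= g z) -> (forall z, 0 <= h z) ->
  smear Conv I (fun z => g z + h z) u = (smear Conv I g u + smear Conv I h u)%E.
Proof.
move=> mI mg mh g0 h0.
have m1f (f : R -> R) : measurable_fun setT f ->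
    measurable_fun setT (fun t : R => (\1_I t * f (t - u))%:E).
  move=> mf; apply: mEg; apply: measurable_funM; first exact: measurable_indic.
  by apply: measurableT_comp => //; exact: measurable_funB.
rewrite /smear/= -ge0_integralD; try by [|exact: m1f|move=> z _; rewrite lee_fin mulr_ge0].
by apply: eq_integral => t _; rewrite -EFinD mulrDr.
Qed.

Lemma ge0_sqreD_le (x y : \bar R) : (0 <= x)%E -> (0 <= y)%E ->
  ((x + y) * (x + y) <= 2%:E * (x * x) + 2%:E * (y * y))%E.
Proof.
have two : (0 < 2%:E :> \bar R)%E by rewrite lte_fin.
case: x => [x| |]; case: y => [y| |]; rewrite ?leeNy_eq ?leNye// => x0 y0.
- rewrite -?EFinD -?EFinM -?EFinD lee_fin; have := sqr_ge0 (x - y); rewrite !expr2; nra.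
- by rewrite mulyy gt0_muley// addey// ?leey// -?EFinM.
- by rewrite mulyy gt0_muley// addye// ?leey// -?EFinM.
- by rewrite mulyy gt0_muley// addye// leey.
Qed.

Definition profile (a b z : R) : R := near0 a z + far0 b z.

Lemma profile_ge0 a b z : 0 <= profile a b z.
Proof. by rewrite addr_ge0 ?near0_ge0 ?far0_ge0. Qed.

Lemma measurable_profile a b : measurable_fun setT (profile a b).
Proof. by apply: measurable_funD; [exact: measurable_near0|exact: measurable_far0]. Qed.

Lemma profile_integrable a b : 0 < a < 1 -> 1 < b ->
  (\int[mu]_z (profile a b z)%:E < +oo)%E.
Proof.
move=> ha hb; under eq_integral do rewrite EFinD.
rewrite ge0_integralD; try by [|apply: mEg; exact: measurable_near0|
  apply: mEg; exact: measurable_far0|move=> z _; rewrite lee_fin near0_ge0|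
  move=> z _; rewrite lee_fin far0_ge0].
by rewrite lte_add_pinfty ?near0_integrable ?far0_integrable.
Qed.

(** [near0] and [far0] live on the disjoint sets [|z| <= 1] and [|z| > 1], so the cross terms
    vanish. *)
Lemma profile_sqr a b z : profile a b z * profile a b z = profile (2 * a) (2 * b) z.
Proof.
rewrite /profile mulrDl !mulrDr near0_sqr far0_sqr.
by rewrite /near0 /far0; case: ifP => _; rewrite ?mulr0 ?mul0r ?addr0 ?add0r.
Qed.

Lemma smear_L2 k I a b : measurable I -> (mu I < +oo)%E ->
  0 < a < top_exp k -> bot_exp k < b ->
  (\int[mu]_u (smear k I (profile a b) u * smear k I (profile a b) u) < +oo)%E.
Proof.
move=> mI fI; have I0 := measure_ge0 mu I.
have finI : mu I \is a fin_num by rewrite ge0_fin_numE.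
case: k => /= /andP[a0 a1] b1.
- have Pfin := profile_integrable (introT andP (conj a0 a1)) b1.
  have P0 : (0 <= \int[mu]_z (profile a b z)%:E)%E.
    by apply: integral_ge0 => z _; rewrite lee_fin profile_ge0.
  set c := (\int[mu]_z _)%E in Pfin P0.
  rewrite (_ : (\int[mu]_u _)%E = \int[mu]_u ((\1_I u)%:E * (c * c)))%E; last first.
    apply: eq_integral => u _.
    rewrite !(smear_White _ mI (measurable_profile a b) (profile_ge0 a b)) -/c.
    rewrite indicE; case: (u \in I); rewrite ?mul1e ?mul0e//.
  rewrite ge0_integralZr; try by [|exact: m1E|move=> z _; rewrite lee_fin|exact: mule_ge0].
  by rewrite int1// lte_mul_pinfty ?lte_mul_pinfty// ge0_fin_numE.
(* [Conv]: near and far parts are squared separately. The near part is at most the constant [c], so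
   its square is at most [c] times itself, which is integrable by Tonelli. The far part goes through
   [smear_Conv_sqr], since [far0 b] need not be integrable for [b <= 1] whereas its square is. *)
- have mn := measurable_near0 a; have mf := measurable_far0 b.
  have n0 := near0_ge0 a; have f0 := far0_ge0 b.
  have ni : (\int[mu]_z (near0 a z)%:E < +oo)%E by apply: near0_integrable; rewrite a0.
  have nI0 : (0 <= \int[mu]_z (near0 a z)%:E)%E.
    by apply: integral_ge0 => z _; rewrite lee_fin.
  have mff : measurable_fun setT (fun z => far0 b z * far0 b z) by exact: measurable_funM.
  have ff0 z : 0 <= far0 b z * far0 b z by rewrite mulr_ge0.
  have mN := measurable_smear Conv mI mn n0; have mF := measurable_smear Conv mI mf f0.
  have mFF := measurable_smear Conv mI mff ff0.
  have N0 u := smear_ge0 Conv I u n0; have F0 u := smear_ge0 Conv I u f0.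
  have FF0 u := smear_ge0 Conv I u ff0.
  set c := (\int[mu]_z (near0 a z)%:E)%E in ni nI0.
  apply: (@le_lt_trans _ _ (\int[mu]_u ((2%:E * c) * smear Conv I (near0 a) u +
     (2%:E * (2%:E * mu I)) * smear Conv I (fun z => far0 b z * far0 b z)%R u))%E).
    apply: ge0_le_integral => //.
    + by move=> u _; apply: mule_ge0; apply: smear_ge0 => z; exact: profile_ge0.
    + by apply: emeasurable_funM; apply: measurable_smear => //;
        first [exact: measurable_profile|exact: profile_ge0].
    + apply: emeasurable_funD; apply: emeasurable_funM => //.
    + move=> u _; rewrite (smear_ConvD _ mI mn mf n0 f0).
      apply: (le_trans (ge0_sqreD_le (N0 u) (F0 u))).
      rewrite -!(muleA 2%:E); apply: leeD; apply: lee_pmul => //; rewrite ?lee_fin ?mule_ge0//.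
        by apply: lee_pmul => //; exact: smear_Conv_le.
      by rewrite muleA; exact: smear_Conv_sqr.
  rewrite ge0_integralD; try by [|move=> u _; rewrite !mule_ge0 ?lee_fin|
    exact: emeasurable_funM].
  rewrite !ge0_integralZl; try by [|rewrite !mule_ge0 ?lee_fin].
  rewrite (integral_smear_Conv mI mn n0 (near0N a)).
  rewrite (integral_smear_Conv mI mff ff0); last by move=> z; rewrite far0N.
  under [X in (_ + _ * (_ * X))%E]eq_integral do rewrite far0_sqr.
  have fi : (\int[mu]_z (far0 (2 * b) z)%:E < +oo)%E by apply: far0_integrable; lra.
  have fI0 : (0 <= \int[mu]_z (far0 (2 * b) z)%:E)%E.
    by apply: integral_ge0 => z _; rewrite lee_fin far0_ge0.
  have fc : c \is a fin_num by rewrite ge0_fin_numE.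
  have ff : (\int[mu]_z (far0 (2 * b) z)%:E)%E \is a fin_num by rewrite ge0_fin_numE.
  by rewrite ltey_eq fin_numD !fin_numM.
- rewrite (_ : (\int[mu]_u _)%E =
     \int[mu]_u ((mu I * mu I) * (profile (2 * a) (2 * b) u)%:E))%E; last first.
    apply: eq_integral => u _.
    by rewrite (smear_Flat _ mI (profile_ge0 a b)) muleACA -EFinM profile_sqr.
  rewrite ge0_integralZl; try by [|apply: mEg; exact: measurable_profile|
    move=> z _; rewrite lee_fin profile_ge0|exact: mule_ge0].
  have := @profile_integrable (2 * a) (2 * b) => h.
  rewrite lte_mul_pinfty ?mule_ge0 ?fin_numM// h//; last by lra.
  by apply/andP; split; lra.
Qed.

End axes.

(** * Bounding the inverse of [rho] by a product over the axes *)

Section rho_bounds.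
Context {R : realType} (q c : R3 R) (nu : R).
Hypotheses (hq : open_orthant q) (hc : open_orthant c) (hnu : 0 < nu).

Let q1 : 0 < co1 q. Proof. by case: hq. Qed.
Let q2 : 0 < co2 q. Proof. by case: hq. Qed.
Let q3 : 0 < co3 q. Proof. by case: hq. Qed.
Let c1 : 0 < co1 c. Proof. by case: hc. Qed.
Let c2 : 0 < co2 c. Proof. by case: hc. Qed.
Let c3 : 0 < co3 c. Proof. by case: hc. Qed.

Lemma rho_ge0 z1 z2 z3 : 0 <= rho q c nu z1 z2 z3.
Proof. exact: powR_ge0. Qed.

Lemma rho_gt0 z1 z2 z3 : z1 != 0 -> 0 < rho q c nu z1 z2 z3.
Proof.
move=> z0; apply: powR_gt0; rewrite -addrA ltr_wpDr//.
  by rewrite addr_ge0// mulr_ge0 ?powR_ge0// ltW.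
by rewrite mulr_gt0// powR_gt0 ?normr_gt0.
Qed.

(** Keeping one summand inside [rho] gives [c_j ^ nu * |z_j| ^ q_j <= rho]; the minimum is a
    constant valid on all three axes. *)
Definition rho_floor : R :=
  Num.min (co1 c `^ nu) (Num.min (co2 c `^ nu) (co3 c `^ nu)).

Lemma rho_floor_gt0 : 0 < rho_floor.
Proof. by rewrite /rho_floor !lt_min !powR_gt0. Qed.

Lemma rho_lower z1 z2 z3 :
  [/\ `|z1| `^ co1 q <= rho q c nu z1 z2 z3 / rho_floor,
      `|z2| `^ co2 q <= rho q c nu z1 z2 z3 / rho_floor &
      `|z3| `^ co3 q <= rho q c nu z1 z2 z3 / rho_floor].
Proof.
have key (C p z S : R) : 0 < C -> rho_floor <= C `^ nu -> C * `|z| `^ (p / nu) <= S ->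
    `|z| `^ p <= S `^ nu / rho_floor.
  move=> C0 hC hS; rewrite ler_pdivlMr ?rho_floor_gt0//.
  have t0 : 0 <= C * `|z| `^ (p / nu) by rewrite mulr_ge0 ?powR_ge0// ltW.
  have := @ge0_ler_powR R nu (ltW hnu) _ _ t0 (le_trans t0 hS) hS.
  apply: le_trans; rewrite powRM ?powR_ge0 ?(ltW C0)//.
  by rewrite -powRrM divfK ?gt_eqF// mulrC ler_wpM2r ?powR_ge0.
have p1 := powR_ge0 `|z1| (co1 q / nu); have p2 := powR_ge0 `|z2| (co2 q / nu).
have p3 := powR_ge0 `|z3| (co3 q / nu).
have m1 := mulr_ge0 (ltW c1) p1; have m2 := mulr_ge0 (ltW c2) p2.
have m3 := mulr_ge0 (ltW c3) p3.
split; [apply: (key _ _ _ _ c1)|apply: (key _ _ _ _ c2)|apply: (key _ _ _ _ c3)].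
- by rewrite /rho_floor ge_min lexx.
- by rewrite -addrA lerDl addr_ge0.
- by rewrite /rho_floor !ge_min lexx orbT.
- by rewrite (addrC (_ * _)) -addrA lerDl addr_ge0.
- by rewrite /rho_floor !ge_min lexx !orbT.
- by rewrite lerDr addr_ge0.
Qed.

(** Weights of sum 1 split [r] into the factors [r ^ w_j], so that each axis may be estimated with
    its own share. *)
Lemma weighted_inverse_le (r w1 w2 w3 p1 p2 p3 : R) :
  0 < r -> w1 + w2 + w3 = 1 -> 0 < p1 -> 0 < p2 -> 0 < p3 ->
  p1^-1 <= r `^ w1 -> p2^-1 <= r `^ w2 -> p3^-1 <= r `^ w3 ->
  r^-1 <= p1 * p2 * p3.
Proof.
move=> r0 w p10 p20 p30 h1 h2 h3; rewrite -[leRHS]invrK lef_pV2 ?posrE//; last first.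
  by rewrite invr_gt0 !mulr_gt0.
have i1 : 0 <= p1^-1 by rewrite invr_ge0 ltW.
have i2 : 0 <= p2^-1 by rewrite invr_ge0 ltW.
have i3 : 0 <= p3^-1 by rewrite invr_ge0 ltW.
have rE : r `^ w1 * r `^ w2 * r `^ w3 = r.
  have ri (s t : R) : (s + t == 0) ==> (r != 0) by rewrite (gt_eqF r0) implybT.
  by rewrite -(powRD (ri _ _)) -(powRD (ri _ _)) w powRr1// ltW.
by rewrite -[leRHS]rE !invfM ler_pM ?mulr_ge0// ler_pM.
Qed.

Lemma profile_gt0 (a b z : R) : z != 0 -> 0 < profile a b z.
Proof.
move=> z0; rewrite /profile /near0 /far0.
by case: ifP => _; rewrite ?addr0 ?add0r powR_gt0// normr_gt0.
Qed.

(* Here [w] is the weight of the axis in the geometric mean of the three lower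
   bounds of [rho]: one choice of weights is used when all coordinates are at
   most 1, another one otherwise. *)
Lemma profile_near_le (r w a b p z : R) : 0 <= w -> z != 0 -> `|z| <= 1 -> a = w * p ->
  `|z| `^ p <= r -> (profile a b z)^-1 <= r `^ w.
Proof.
move=> w0 z0 z1 -> h; rewrite /profile /near0 /far0 z1 addr0 powRN invrK mulrC powRrM.
apply: ge0_ler_powR => //; rewrite nnegrE ?powR_ge0//.
exact: le_trans (powR_ge0 _ _) h.
Qed.

Lemma profile_far_le (r w a b p z : R) : 0 <= w -> z != 0 -> 1 <= r -> 0 <= a ->
  b = w * p -> `|z| `^ p <= r -> (profile a b z)^-1 <= r `^ w.
Proof.
move=> w0 z0 r1 a0 -> h; rewrite /profile /near0 /far0.
case: ifP => z1; rewrite ?addr0 ?add0r powRN invrK.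
  apply: (@le_trans _ _ 1).
    rewrite -[leRHS](powRr0 `|z|); apply: ger_powR => //.
    by rewrite normr_gt0 z0.
  by rewrite -[leLHS](powRr0 r); exact: ler_powR.
rewrite mulrC powRrM; apply: ge0_ler_powR => //; rewrite nnegrE ?powR_ge0//.
exact: le_trans (powR_ge0 _ _) h.
Qed.

Section kinds.
Variables k1 k2 k3 : axis_kind.

Definition top_sum : R := top_exp k1 / co1 q + top_exp k2 / co2 q + top_exp k3 / co3 q.
Definition bot_sum : R := bot_exp k1 / co1 q + bot_exp k2 / co2 q + bot_exp k3 / co3 q.

Definition kind_region : Prop := bot_sum < 1 < top_sum.

Hypothesis reg : kind_region.

(** The weights [top_exp k_j / (q_j * top_sum)] add up to 1, and weight times [q_j] is this
    exponent. It is below [top_exp] because [top_sum > 1], just as [far_exp] is above [bot_exp]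
    because [bot_sum < 1]: this is where the region enters. *)
Definition near_exp (k : axis_kind) : R := top_exp k / top_sum.
Definition far_exp (k : axis_kind) : R := bot_exp k / bot_sum.

Lemma top_exp_gt0 k : 0 < top_exp k :> R.
Proof. by case: k => /=; rewrite ?invr_gt0. Qed.

Lemma bot_exp_gt0 k : 0 < bot_exp k :> R.
Proof. by case: k => /=; rewrite ?invr_gt0. Qed.

Lemma bot_sum_gt0 : 0 < bot_sum.
Proof. by rewrite !addr_gt0// divr_gt0// bot_exp_gt0. Qed.

Lemma near_exp_bounds k : 0 < near_exp k < top_exp k.
Proof.
case/andP: reg => _ S1; have S0 := lt_trans ltr01 S1; have t0 := top_exp_gt0 k.
by rewrite /near_exp divr_gt0//= ltr_pdivrMr// ltr_pMr.
Qed.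

Lemma far_exp_bound k : bot_exp k < far_exp k.
Proof.
case/andP: reg => S1 _; have t0 := bot_exp_gt0 k.
by rewrite /far_exp ltr_pdivlMr ?bot_sum_gt0// gtr_pMr.
Qed.

Lemma rhoV_le z1 z2 z3 : z1 != 0 -> z2 != 0 -> z3 != 0 ->
  (rho q c nu z1 z2 z3)^-1 <= rho_floor^-1 *
   (profile (near_exp k1) (far_exp k1) z1 * profile (near_exp k2) (far_exp k2) z2 *
    profile (near_exp k3) (far_exp k3) z3).
Proof.
move=> z10 z20 z30; have [l1 l2 l3] := rho_lower z1 z2 z3.
case/andP: reg => _ S1; have S0 := lt_trans ltr01 S1; have B0 := bot_sum_gt0.
set r := rho q c nu z1 z2 z3 / rho_floor in l1 l2 l3.
have r0 : 0 < r by rewrite divr_gt0 ?rho_gt0 ?rho_floor_gt0.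
have -> : (rho q c nu z1 z2 z3)^-1 = rho_floor^-1 * r^-1.
  by rewrite /r invf_div mulrA mulVf ?mul1r ?gt_eqF ?rho_floor_gt0.
rewrite ler_pM2l ?invr_gt0 ?rho_floor_gt0//.
have pos := (profile_gt0 (near_exp k1) (far_exp k1) z10,
  profile_gt0 (near_exp k2) (far_exp k2) z20, profile_gt0 (near_exp k3) (far_exp k3) z30).
have [[t1 t2] t3] := (top_exp_gt0 k1, top_exp_gt0 k2, top_exp_gt0 k3).
have [[b1 b2] b3] := (bot_exp_gt0 k1, bot_exp_gt0 k2, bot_exp_gt0 k3).
have [/and3P[n1 n2 n3]|] := boolP [&& `|z1| <= 1, `|z2| <= 1 & `|z3| <= 1].
  apply: (@weighted_inverse_le r (top_exp k1 / co1 q / top_sum)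
    (top_exp k2 / co2 q / top_sum) (top_exp k3 / co3 q / top_sum)) => //;
    rewrite ?pos//.
  - by rewrite -!mulrDl -/top_sum divff// gt_eqF.
  - apply: (@profile_near_le _ _ _ _ (co1 q)) => //; first by rewrite !divr_ge0// ltW.
    by rewrite /near_exp; field; rewrite !gt_eqF.
  - apply: (@profile_near_le _ _ _ _ (co2 q)) => //; first by rewrite !divr_ge0// ltW.
    by rewrite /near_exp; field; rewrite !gt_eqF.
  - apply: (@profile_near_le _ _ _ _ (co3 q)) => //; first by rewrite !divr_ge0// ltW.
    by rewrite /near_exp; field; rewrite !gt_eqF.
(* One coordinate beyond 1 forces [r >= 1]. The coordinates that are still small then cost nothing,
   since their profile is at least 1 and [r ^ w >= 1]. *)
move=> far; have r1 : 1 <= r.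
  have big (z p : R) : 0 < p -> ~~ (`|z| <= 1) -> `|z| `^ p <= r -> 1 <= r.
    move=> p0; rewrite -ltNge => z1' h; apply: le_trans h.
    rewrite -[leLHS](powRr0 `|z|); apply: ler_powR; exact: ltW.
  by move: far; rewrite !negb_and => /or3P[] h; [exact: big q1 h l1|exact: big q2 h l2|
     exact: big q3 h l3].
have a0 k : 0 <= near_exp k by case/andP: (near_exp_bounds k) => /ltW.
apply: (@weighted_inverse_le r (bot_exp k1 / co1 q / bot_sum)
    (bot_exp k2 / co2 q / bot_sum) (bot_exp k3 / co3 q / bot_sum)) => //;
    rewrite ?pos//.
- by rewrite -!mulrDl -/bot_sum divff// gt_eqF.
- apply: (@profile_far_le _ _ _ _ (co1 q)) => //; first by rewrite !divr_ge0// ltW.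
  by rewrite /far_exp; field; rewrite !gt_eqF.
- apply: (@profile_far_le _ _ _ _ (co2 q)) => //; first by rewrite !divr_ge0// ltW.
  by rewrite /far_exp; field; rewrite !gt_eqF.
- apply: (@profile_far_le _ _ _ _ (co3 q)) => //; first by rewrite !divr_ge0// ltW.
  by rewrite /far_exp; field; rewrite !gt_eqF.
Qed.

End kinds.
End rho_bounds.

(** * The kernel over a box and its square integrability *)

Section box_kernel.
Context {R : realType} (q c : R3 R) (nu : R) (k1 k2 k3 : axis_kind)
  (side : R -> R -> set R).
Notation mu := (@lebesgue_measure R).
Implicit Types a b u t : R3 R.

Hypothesis measurable_side : forall x y, measurable (side x y).
Hypothesis side_finite : forall x y, (mu (side x y) < +oo)%E.

(** [side] is a parameter so that the open intervals of the fields and the half-open ones share one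
    proof of square integrability. The lower corner [a] serves the increments, whose boxes do not
    start at the origin. *)
Definition kern a b u t : R :=
  \1_(side (co1 a) (co1 b)) (wco k1 (co1 u) (co1 t)) *
  \1_(side (co2 a) (co2 b)) (wco k2 (co2 u) (co2 t)) *
  \1_(side (co3 a) (co3 b)) (wco k3 (co3 u) (co3 t)) *
  (rho q c nu (zco k1 (co1 u) (co1 t)) (zco k2 (co2 u) (co2 t))
              (zco k3 (co3 u) (co3 t)))^-1.

Definition GG a b u : \bar R := (\int[leb3 R]_t (kern a b u t)%:E)%E.

Definition CC a b a' b' : \bar R := (\int[leb3 R]_u (GG a b u * GG a' b' u))%E.

Lemma kern_ge0 a b u t : 0 <= kern a b u t.
Proof. by rewrite !mulr_ge0// invr_ge0 powR_ge0. Qed.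

Lemma GG_ge0 a b u : (0 <= GG a b u)%E.
Proof. by apply: integral_ge0 => t _; rewrite lee_fin kern_ge0. Qed.

Lemma measurable_rho d (T : measurableType d) (f g h : T -> R) :
  measurable_fun setT f -> measurable_fun setT g -> measurable_fun setT h ->
  measurable_fun setT (fun x => rho q c nu (f x) (g x) (h x)).
Proof.
move=> mf mg mh.
have mp (f' : T -> R) (p : R) : measurable_fun setT f' ->
    measurable_fun setT (fun x => `|f' x| `^ p).
  move=> mf'; apply: (measurableT_comp (measurable_powR p)).
  by apply: measurableT_comp => //; exact: normr_measurable.
apply: (measurableT_comp (measurable_powR nu)).
by apply: measurable_funD; [apply: measurable_funD|]; apply: measurable_funM => //;
  exact: mp.
Qed.

Lemma measurable_kern a b : measurable_fun setT (fun p : R3 R * R3 R => kern a b p.1 p.2).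
Proof.
have m1 : measurable_fun setT (fun p : R3 R * R3 R => (co1 p.1, co1 p.2)).
  by apply: measurable_fun_pair; apply: measurableT_comp => //; exact: measurable_co1.
have m2 : measurable_fun setT (fun p : R3 R * R3 R => (co2 p.1, co2 p.2)).
  by apply: measurable_fun_pair; apply: measurableT_comp => //; exact: measurable_co2.
have m3 : measurable_fun setT (fun p : R3 R * R3 R => (co3 p.1, co3 p.2)).
  by apply: measurable_fun_pair; apply: measurableT_comp => //; exact: measurable_co3.
have mw k (f : R3 R * R3 R -> R * R) x y : measurable_fun setT f ->
    measurable_fun setT (fun p => \1_(side x y) (wco k (f p).1 (f p).2) : R).
  move=> mf; have mi : measurable_fun setT (\1_(side x y) : R -> R).
    by apply: measurable_indic; exact: measurable_side.
  exact: (measurableT_comp mi (measurableT_comp (measurable_wco k) mf)).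
have mz k (f : R3 R * R3 R -> R * R) : measurable_fun setT f ->
    measurable_fun setT (fun p => zco k (f p).1 (f p).2).
  by move=> mf; exact: (measurableT_comp (measurable_zco k) mf).
apply: measurable_funM.
  by apply: measurable_funM; [apply: measurable_funM|]; [exact: mw m1|exact: mw m2|exact: mw m3].
under eq_fun do rewrite -powR_inv1 ?rho_ge0//.
apply: (measurableT_comp (measurable_powR (-1))).
by apply: measurable_rho; [exact: mz m1|exact: mz m2|exact: mz m3].
Qed.

Lemma measurable_kern_u a b u : measurable_fun setT (kern a b u).
Proof.
exact: (measurableT_comp (measurable_kern a b) (@pair1_measurable _ _ (R3 R) (R3 R) u)).
Qed.

Lemma measurable_GG a b : measurable_fun setT (GG a b).
Proof.
apply: (@measurable_fun_fubini_tonelli_F _ _ _ _ _ (leb3 R)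
  (fun p : R3 R * R3 R => (kern a b p.1 p.2)%:E)).
  by apply/measurable_EFinP; exact: measurable_kern.
by move=> p; rewrite lee_fin kern_ge0.
Qed.

Lemma CC_ge0 a b a' b' : (0 <= CC a b a' b')%E.
Proof. by apply: integral_ge0 => u _; rewrite mule_ge0 ?GG_ge0. Qed.

Lemma CC_sym a b a' b' : CC a b a' b' = CC a' b' a b.
Proof. by apply: eq_integral => u _; rewrite muleC. Qed.

Section square_integrability.
Hypotheses (hq : open_orthant q) (hc : open_orthant c) (hnu : 0 < nu).
Hypothesis reg : kind_region q k1 k2 k3.

Let prof k := profile (near_exp q k1 k2 k3 k) (far_exp q k1 k2 k3 k).

Let smear_at (a b : R3 R) : R3 R -> \bar R := fun u =>
  (smear k1 (side (co1 a) (co1 b)) (prof k1) (co1 u) *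
   smear k2 (side (co2 a) (co2 b)) (prof k2) (co2 u) *
   smear k3 (side (co3 a) (co3 b)) (prof k3) (co3 u))%E.

Let prof_ge0 k z : 0 <= prof k z. Proof. exact: profile_ge0. Qed.

Let measurable_prof k : measurable_fun setT (prof k). Proof. exact: measurable_profile. Qed.

Let axis_fun_measurable k x y v :
  measurable_fun setT (fun s => (\1_(side x y) (wco k v s) * prof k (zco k v s))%:E).
Proof.
apply/measurable_EFinP.
have mi : measurable_fun setT (\1_(side x y) : R -> R).
  by apply: measurable_indic; exact: measurable_side.
have mw := measurableT_comp (measurable_wco k) (@pair1_measurable _ _ R R v).
have mz := measurableT_comp (measurable_zco k) (@pair1_measurable _ _ R R v).
apply: measurable_funM; first exact: (measurableT_comp mi mw).
exact: (measurableT_comp (measurable_prof k) mz).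
Qed.

(** Almost every [t] differs from 0 and from [u] in each coordinate, so that no argument of [rho]
    vanishes whatever the kinds, and [rhoV_le] can be integrated over [t]. *)
Lemma GG_le a b u : co1 u != 0 -> co2 u != 0 -> co3 u != 0 ->
  (GG a b u <= (rho_floor c nu)^-1%:E * smear_at a b u)%E.
Proof.
move=> u1 u2 u3; have fl0 := rho_floor_gt0 nu hc.
pose f k x y v s := (\1_(side x y) (wco k v s) * prof k (zco k v s))%:E.
have f0 k x y v s : (0 <= f k x y v s)%E by rewrite lee_fin mulr_ge0.
have mf k x y v : measurable_fun setT (f k x y v) by exact: axis_fun_measurable.
have -> : smear_at a b u = (\int[leb3 R]_t
    (f k1 (co1 a) (co1 b) (co1 u) (co1 t) * f k2 (co2 a) (co2 b) (co2 u) (co2 t) *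
     f k3 (co3 a) (co3 b) (co3 u) (co3 t)))%E.
  by rewrite leb3_prod.
have mt : measurable_fun setT (fun t : R3 R =>
    (f k1 (co1 a) (co1 b) (co1 u) (co1 t) * f k2 (co2 a) (co2 b) (co2 u) (co2 t) *
     f k3 (co3 a) (co3 b) (co3 u) (co3 t))%E).
  by apply: emeasurable_funM; [apply: emeasurable_funM|];
    [exact: (measurableT_comp (mf _ _ _ _) measurable_co1)|
     exact: (measurableT_comp (mf _ _ _ _) measurable_co2)|
     exact: (measurableT_comp (mf _ _ _ _) measurable_co3)].
rewrite -ge0_integralZl; try by [|move=> t _; rewrite !mule_ge0|rewrite lee_fin invr_ge0 ltW].
have mk : measurable_fun setT (fun t => (kern a b u t)%:E).
  by apply/measurable_EFinP; exact: measurable_kern_u.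
apply: (@ae_ge0_le_integral _ _ _ (leb3 R) setT measurableT) => //.
- by move=> t _; rewrite lee_fin kern_ge0.
- by move=> t _; rewrite !mule_ge0// lee_fin invr_ge0 ltW.
- by apply: emeasurable_funM.
apply: filterS2 (leb3_ae_neq (0, 0, 0)) (leb3_ae_neq u) => t [t1 t2 t3] [tu1 tu2 tu3] _.
have nz k v s : v != 0 -> s != 0 -> s != v -> zco k v s != 0 :> R.
  by case: k => //= _ _; rewrite subr_eq0.
have n1 := nz k1 _ _ u1 t1 tu1; have n2 := nz k2 _ _ u2 t2 tu2; have n3 := nz k3 _ _ u3 t3 tu3.
have := rhoV_le hq hc hnu reg n1 n2 n3; rewrite -!EFinM lee_fin /kern.
set i1 := \1_(side (co1 a) (co1 b)) _; set i2 := \1_(side (co2 a) (co2 b)) _.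
set i3 := \1_(side (co3 a) (co3 b)) _ => h.
have i0 : 0 <= i1 * i2 * i3 by rewrite !mulr_ge0.
apply: (le_trans (ler_wpM2l i0 h)); rewrite le_eqVlt; apply/orP; left; apply/eqP.
by rewrite -/(prof k1) -/(prof k2) -/(prof k3); ring.
Qed.

Lemma GG_sqr_finite a b : (\int[leb3 R]_u (GG a b u * GG a b u) < +oo)%E.
Proof.
have fl0 := rho_floor_gt0 nu hc.
pose s k x y v := (smear k (side x y) (prof k) v * smear k (side x y) (prof k) v)%E.
have S0 k x y v : (0 <= smear k (side x y) (prof k) v)%E by exact: smear_ge0.
have s0 k x y v : (0 <= s k x y v)%E by rewrite mule_ge0.
have mS k x y : measurable_fun setT (smear k (side x y) (prof k)).
  by apply: measurable_smear => //; exact: measurable_side.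
have ms k x y : measurable_fun setT (s k x y) by exact: emeasurable_funM.
pose bound u := (s k1 (co1 a) (co1 b) (co1 u) * s k2 (co2 a) (co2 b) (co2 u) *
  s k3 (co3 a) (co3 b) (co3 u))%E.
have b0 u : (0 <= bound u)%E by rewrite !mule_ge0.
have mb : measurable_fun setT bound.
  by apply: emeasurable_funM; [apply: emeasurable_funM|];
    [exact: (measurableT_comp (ms _ _ _) measurable_co1)|
     exact: (measurableT_comp (ms _ _ _) measurable_co2)|
     exact: (measurableT_comp (ms _ _ _) measurable_co3)].
pose C := ((rho_floor c nu)^-1 * (rho_floor c nu)^-1)%R.
have C0 : 0 <= C by rewrite mulr_ge0// invr_ge0 ltW.
have mGG := measurable_GG a b.
apply: (@le_lt_trans _ _ (\int[leb3 R]_u (C%:E * bound u))%E).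
  apply: (@ae_ge0_le_integral _ _ _ (leb3 R) setT measurableT) => //.
  - by move=> u _; rewrite mule_ge0 ?GG_ge0.
  - exact: emeasurable_funM.
  - by move=> u _; rewrite mule_ge0.
  - exact: emeasurable_funM.
  apply: filterS (leb3_ae_neq (0, 0, 0)) => u [u1 u2 u3] _.
  have h := GG_le a b u1 u2 u3.
  apply: (@le_trans _ _ (((rho_floor c nu)^-1%:E * smear_at a b u) *
                        ((rho_floor c nu)^-1%:E * smear_at a b u))%E).
    by apply: lee_pmul => //; exact: GG_ge0.
  have key (x y z : \bar R) : ((x * y * z) * (x * y * z) = (x * x) * (y * y) * (z * z))%E.
    by rewrite muleACA; congr (_ * _)%E; rewrite muleACA.
  by rewrite muleACA -EFinM /smear_at key.
have -> : (\int[leb3 R]_u (C%:E * bound u) = C%:E * \int[leb3 R]_u bound u)%E.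
  by apply: ge0_integralZl => //; rewrite lee_fin.
rewrite /bound leb3_prod//.
have fin k x y : (\int[mu]_v s k x y v < +oo)%E.
  apply: smear_L2; [exact: measurable_side|exact: side_finite| |].
    exact: near_exp_bounds.
  exact: far_exp_bound.
have I0 k x y : (0 <= \int[mu]_v s k x y v)%E by exact: integral_ge0.
have fn k x y : (\int[mu]_v s k x y v)%E \is a fin_num by rewrite ge0_fin_numE.
by rewrite ltey_eq !fin_numM.
Qed.

Lemma GG_in_L2 a b : in_L2 (GG a b).
Proof. by split; [exact: measurable_GG|exact: GG_sqr_finite]. Qed.

Lemma CC_finite a b a' b' : CC a b a' b' \is a fin_num.
Proof.
rewrite ge0_fin_numE ?CC_ge0//.
have mG := measurable_GG a b; have mG' := measurable_GG a' b'.
apply: (@le_lt_trans _ _ (\int[leb3 R]_u (GG a b u * GG a b u + GG a' b' u * GG a' b' u))%E).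
  apply: ge0_le_integral => //.
  - by move=> u _; rewrite mule_ge0 ?GG_ge0.
  - exact: emeasurable_funM.
  - by apply: emeasurable_funD; exact: emeasurable_funM.
  - move=> u _; have := GG_ge0 a' b' u; have := GG_ge0 a b u.
    move: (GG a b u) (GG a' b' u) => x y x0 y0.
    have [xy|/ltW yx] := leP x y.
      apply: (@le_trans _ _ (y * y)%E); first exact: lee_pmul.
      by rewrite leeDr// mule_ge0.
    apply: (@le_trans _ _ (x * x)%E); first exact: lee_pmul.
    by rewrite leeDl// mule_ge0.
rewrite ge0_integralD//; try by [|move=> u _; rewrite mule_ge0 ?GG_ge0|exact: emeasurable_funM].
by rewrite lte_add_pinfty ?GG_sqr_finite.
Qed.

End square_integrability.

End box_kernel.

(** * Half-open boxes: affine maps and splitting *)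

Section half_open_boxes.
Context {R : realType}.
Notation mu := (@lebesgue_measure R).

Definition side_oc (x y : R) : set R := `]x, y]%classic.
Definition side_oo (x y : R) : set R := `]x, y[%classic.

Lemma measurable_side_oc (x y : R) : measurable (side_oc x y).
Proof. exact: measurable_itv. Qed.

Lemma measurable_side_oo (x y : R) : measurable (side_oo x y).
Proof. exact: measurable_itv. Qed.

Lemma side_oc_finite (x y : R) : (mu (side_oc x y) < +oo)%E.
Proof.
by rewrite lebesgue_measure_itv/= lte_fin; case: ifP => _; rewrite -?EFinB ltry.
Qed.

Lemma side_oo_finite (x y : R) : (mu (side_oo x y) < +oo)%E.
Proof.
by rewrite lebesgue_measure_itv/= lte_fin; case: ifP => _; rewrite -?EFinB ltry.
Qed.

Lemma side_oc_affine (l s x y v : R) : 0 < l ->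
  \1_(side_oc (l * x + s) (l * y + s)) (l * v + s) = \1_(side_oc x y) v :> R.
Proof.
move=> l0; rewrite !indicE /side_oc !mem_setE !in_itv/=.
by rewrite ltrD2r lerD2r ltr_pM2l// ler_pM2l.
Qed.

Lemma side_oc_split (x y z v : R) : x <= y <= z ->
  \1_(side_oc x z) v = \1_(side_oc x y) v + \1_(side_oc y z) v :> R.
Proof.
move=> /andP[xy yz]; have mE a b : (v \in side_oc a b) = (a < v <= b).
  by rewrite /side_oc mem_setE in_itv.
rewrite !indicE !mE; have [vy|yv] := leP v y.
  by rewrite addr0 (le_trans vy yz).
by rewrite andbF add0r (le_lt_trans xy yv).
Qed.

Lemma side_oo_oc (x y v : R) : v != y ->
  \1_(side_oo x y) v = \1_(side_oc x y) v :> R.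
Proof.
move=> vy; rewrite !indicE /side_oc /side_oo !mem_setE !in_itv/=.
by rewrite (le_eqVlt v) (negbTE vy).
Qed.

End half_open_boxes.

Section box_integrals.
Context {R : realType} (q c : R3 R) (nu : R) (k1 k2 k3 : axis_kind).
Implicit Types a b u t x y : R3 R.

Let ker := kern q c nu k1 k2 k3 side_oc.
Let G := GG q c nu k1 k2 k3 side_oc.
Let C := CC q c nu k1 k2 k3 side_oc.

(** The conditions are on [u] because a [White] axis reads its indicator at [u_j]; where it is read
    at [t_j], the endpoint is negligible in the integral. *)
Lemma GG_oo_oc a b u :
  co1 u != co1 b -> co2 u != co2 b -> co3 u != co3 b ->
  GG q c nu k1 k2 k3 side_oo a b u = G a b u.
Proof.
move=> u1 u2 u3.
have mk1 : measurable_fun setT (fun t => (kern q c nu k1 k2 k3 side_oo a b u t)%:E).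
  by apply/measurable_EFinP; apply: measurable_kern_u => *; exact: measurable_side_oo.
have mk2 : measurable_fun setT (fun t => (ker a b u t)%:E).
  by apply/measurable_EFinP; apply: measurable_kern_u => *; exact: measurable_side_oc.
apply: (@ae_eq_integral _ _ _ (leb3 R) setT) => //.
apply: filterS (leb3_ae_neq b) => t [t1 t2 t3] _; rewrite /ker /kern.
have nz k v s w : v != w -> s != w -> wco k v s != w :> R by case: k.
by rewrite (side_oo_oc _ (nz k1 _ _ _ u1 t1)) (side_oo_oc _ (nz k2 _ _ _ u2 t2))
  (side_oo_oc _ (nz k3 _ _ _ u3 t3)).
Qed.

Definition aff3 (l s x : R3 R) : R3 R :=
  (co1 l * co1 x + co1 s, co2 l * co2 x + co2 s, co3 l * co3 x + co3 s).

Section affine.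
Variables (l m s : R3 R) (kap : R).
Hypotheses (hl : open_orthant l) (hm : open_orthant m) (kap0 : 0 < kap).
Hypothesis conv1 : k1 = Conv -> co1 l = co1 m.
Hypothesis conv2 : k2 = Conv -> co2 l = co2 m.
Hypothesis conv3 : k3 = Conv -> co3 l = co3 m.
Hypothesis rhoM : forall z1 z2 z3,
  rho q c nu (co1 m * z1) (co2 m * z2) (co3 m * z3) = kap * rho q c nu z1 z2 z3.

(* Here [l] dilates the box and [m] the argument of [rho]; the scales of [u] and
   [t] follow from the roles of [u_j] and [t_j] on the axis. *)
Definition u_scale k (lj mj : R) : R := if k is Flat then mj else lj.
Definition u_shift k (sj : R) : R := if k is Flat then 0 else sj.
Definition t_scale k (lj mj : R) : R := if k is White then mj else lj.
Definition t_shift k (sj : R) : R := if k is White then 0 else sj.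

Let lu : R3 R :=
  (u_scale k1 (co1 l) (co1 m), u_scale k2 (co2 l) (co2 m), u_scale k3 (co3 l) (co3 m)).
Let su : R3 R := (u_shift k1 (co1 s), u_shift k2 (co2 s), u_shift k3 (co3 s)).
Let lt' : R3 R :=
  (t_scale k1 (co1 l) (co1 m), t_scale k2 (co2 l) (co2 m), t_scale k3 (co3 l) (co3 m)).
Let st : R3 R := (t_shift k1 (co1 s), t_shift k2 (co2 s), t_shift k3 (co3 s)).

Let u_jac : R := co1 lu * co2 lu * co3 lu.
Let t_jac : R := co1 lt' * co2 lt' * co3 lt'.

Let lu_pos : open_orthant lu.
Proof.
case: hl hm => ? ? ? [? ? ?]; rewrite /lu /open_orthant /co1 /co2 /co3 /=; split.
- by case: k1.
- by case: k2.
- by case: k3.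
Qed.

Let lt_pos : open_orthant lt'.
Proof.
case: hl hm => ? ? ? [? ? ?]; rewrite /lt' /open_orthant /co1 /co2 /co3 /=; split.
- by case: k1.
- by case: k2.
- by case: k3.
Qed.

Let wco_affine k (lj mj sj v r : R) :
  wco k (u_scale k lj mj * v + u_shift k sj) (t_scale k lj mj * r + t_shift k sj) =
  lj * wco k v r + sj.
Proof. by case: k. Qed.

Let zco_affine k (lj mj sj v r : R) : (k = Conv -> lj = mj) ->
  zco k (u_scale k lj mj * v + u_shift k sj) (t_scale k lj mj * r + t_shift k sj) =
  mj * zco k v r.
Proof.
by case: k => /= h; rewrite ?addr0// (h erefl); ring.
Qed.

Let kern_affine a b u t :
  ker (aff3 l s a) (aff3 l s b) (aff3 lu su u) (aff3 lt' st t) = kap^-1 * ker a b u t.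
Proof.
case: (hl) => l1 l2 l3; rewrite /ker /kern /aff3 /co1 /co2 /co3 /=.
rewrite !wco_affine !(side_oc_affine _ _ _ _ l1) !(side_oc_affine _ _ _ _ l2)
  !(side_oc_affine _ _ _ _ l3).
rewrite !zco_affine//= [in LHS]rhoM invfM.
by rewrite mulrCA.
Qed.

Lemma GG_affine a b u : G (aff3 l s a) (aff3 l s b) (aff3 lu su u) =
  ((t_jac / kap)%:E * G a b u)%E.
Proof.
have [_ sc] := leb3_scales st lt_pos.
have mk a' b' v : measurable_fun setT (fun t => (ker a' b' v t)%:E).
  by apply/measurable_EFinP; apply: measurable_kern_u => *; exact: measurable_side_oc.
have k0 a' b' v t : (0 <= (ker a' b' v t)%:E)%E by rewrite lee_fin kern_ge0.
have e1 := sc _ (mk (aff3 l s a) (aff3 l s b) (aff3 lu su u)) (k0 _ _ _).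
have e2 : (\int[leb3 R]_t (ker (aff3 l s a) (aff3 l s b) (aff3 lu su u) (aff3 lt' st t))%:E =
           kap^-1%:E * G a b u)%E.
  under eq_integral do rewrite kern_affine EFinM.
  apply: ge0_integralZl => //; first exact: mk.
  by rewrite lee_fin invr_ge0 ltW.
by rewrite EFinM -muleA -e2; exact: (esym e1).
Qed.

(** The outer integral brings the Jacobian in [u] once; each of the two factors [G] brings the
    Jacobian in [t] and the homogeneity factor of [rho]. *)
Lemma CC_affine a b a' b' :
  C (aff3 l s a) (aff3 l s b) (aff3 l s a') (aff3 l s b') =
  ((u_jac * (t_jac / kap) ^+ 2)%:E * C a b a' b')%E.
Proof.
have [_ sc] := leb3_scales su lu_pos.
have mG x y : measurable_fun setT (G x y).
  by apply: measurable_GG => *; exact: measurable_side_oc.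
have mGG x y x' y' : measurable_fun setT (fun u => G x y u * G x' y' u)%E.
  exact: emeasurable_funM.
have GG0 x y x' y' u : (0 <= G x y u * G x' y' u)%E by rewrite mule_ge0 ?GG_ge0.
have e1 := sc _ (mGG (aff3 l s a) (aff3 l s b) (aff3 l s a') (aff3 l s b')) (GG0 _ _ _ _).
have e2 : (\int[leb3 R]_u (G (aff3 l s a) (aff3 l s b) (aff3 lu su u) *
                           G (aff3 l s a') (aff3 l s b') (aff3 lu su u)) =
           ((t_jac / kap) ^+ 2)%:E * C a b a' b')%E.
  under eq_integral do rewrite !GG_affine muleACA -EFinM -expr2.
  apply: ge0_integralZl => //; first exact: mGG.
  by rewrite lee_fin sqr_ge0.
by rewrite EFinM -muleA -e2; exact: (esym e1).
Qed.

End affine.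

Lemma GG_split1 (x y z a2 a3 b2 b3 : R) u : x <= y <= z ->
  G (x, a2, a3) (z, b2, b3) u = (G (x, a2, a3) (y, b2, b3) u + G (y, a2, a3) (z, b2, b3) u)%E.
Proof.
move=> xyz.
have mk a' b' v : measurable_fun setT (fun t => (ker a' b' v t)%:E).
  by apply/measurable_EFinP; apply: measurable_kern_u => *; exact: measurable_side_oc.
rewrite /G /GG -ge0_integralD; try by [|exact: mk|move=> t _; rewrite lee_fin kern_ge0].
apply: eq_integral => t _; rewrite -EFinD /ker /kern /=.
by rewrite (side_oc_split _ xyz) !mulrDl.
Qed.

Lemma GG_split2 (x y z a1 a3 b1 b3 : R) u : x <= y <= z ->
  G (a1, x, a3) (b1, z, b3) u = (G (a1, x, a3) (b1, y, b3) u + G (a1, y, a3) (b1, z, b3) u)%E.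
Proof.
move=> xyz.
have mk a' b' v : measurable_fun setT (fun t => (ker a' b' v t)%:E).
  by apply/measurable_EFinP; apply: measurable_kern_u => *; exact: measurable_side_oc.
rewrite /G /GG -ge0_integralD; try by [|exact: mk|move=> t _; rewrite lee_fin kern_ge0].
apply: eq_integral => t _; rewrite -EFinD /ker /kern /=.
by rewrite (side_oc_split _ xyz) mulrDr !mulrDl.
Qed.

Lemma GG_split3 (x y z a1 a2 b1 b2 : R) u : x <= y <= z ->
  G (a1, a2, x) (b1, b2, z) u = (G (a1, a2, x) (b1, b2, y) u + G (a1, a2, y) (b1, b2, z) u)%E.
Proof.
move=> xyz.
have mk a' b' v : measurable_fun setT (fun t => (ker a' b' v t)%:E).
  by apply/measurable_EFinP; apply: measurable_kern_u => *; exact: measurable_side_oc.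
rewrite /G /GG -ge0_integralD; try by [|exact: mk|move=> t _; rewrite lee_fin kern_ge0].
apply: eq_integral => t _; rewrite -EFinD /ker /kern /=.
by rewrite (side_oc_split _ xyz) mulrDr !mulrDl.
Qed.

End box_integrals.

(** * Increments, stationarity and scaling of the fields over boxes *)

Section box_fields.
Context {R : realType} (q c : R3 R) (nu : R) (k1 k2 k3 : axis_kind).
Hypotheses (hq : open_orthant q) (hc : open_orthant c) (hnu : 0 < nu).
Hypothesis reg : kind_region q k1 k2 k3.
Implicit Types a b u t x y : R3 R.

Let G := GG q c nu k1 k2 k3 side_oc.
Let C := CC q c nu k1 k2 k3 side_oc.
Let m3 : {measure set _ -> \bar R} := leb3 R.

Definition fG a b u : R := fine (G a b u).
Definition cov a b a' b' : R := fine (C a b a' b').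

Lemma box_in_L2 a b : in_L2 (G a b).
Proof.
by apply: GG_in_L2 => // *; [exact: measurable_side_oc|exact: side_oc_finite].
Qed.

Lemma fG_L2 a b : L2 m3 (fG a b).
Proof. by have [] := in_L2_L2 (box_in_L2 a b). Qed.

Lemma G_fin a b : {ae m3, forall u, G a b u \is a fin_num}.
Proof. by have [] := in_L2_L2 (box_in_L2 a b). Qed.

Lemma C_fin a b a' b' : C a b a' b' \is a fin_num.
Proof.
by apply: CC_finite => // *; [exact: measurable_side_oc|exact: side_oc_finite].
Qed.

Lemma ip_fG a b a' b' : ip m3 (fG a b) (fG a' b') = cov a b a' b'.
Proof.
have mG x y : measurable_fun setT (G x y).
  by apply: measurable_GG => *; exact: measurable_side_oc.
rewrite /ip /Rintegral /cov /C /CC; congr fine; apply: ae_eq_integral => //.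
- by apply/measurable_EFinP; apply: measurable_funM; [exact: (fG_L2 _ _).1|exact: (fG_L2 _ _).1].
- by apply: emeasurable_funM; exact: mG.
- by apply: filterS2 (G_fin a b) (G_fin a' b') => u h h' _; rewrite EFinM /fG !fineK.
Qed.

Lemma cov_sym a b a' b' : cov a b a' b' = cov a' b' a b.
Proof. by rewrite /cov /C CC_sym. Qed.

Lemma fG_split1 (x y z a2 a3 b2 b3 : R) : x <= y <= z ->
  {ae m3, forall u, fG (x, a2, a3) (z, b2, b3) u =
     fG (x, a2, a3) (y, b2, b3) u + fG (y, a2, a3) (z, b2, b3) u}.
Proof.
move=> xyz; apply: filterS2 (G_fin (x, a2, a3) (y, b2, b3)) (G_fin (y, a2, a3) (z, b2, b3)).
by move=> u h1 h2; rewrite /fG -fineD// /G (GG_split1 _ _ _ _ _ _ _ _ _ _ _ xyz).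
Qed.

Lemma fG_split2 (x y z a1 a3 b1 b3 : R) : x <= y <= z ->
  {ae m3, forall u, fG (a1, x, a3) (b1, z, b3) u =
     fG (a1, x, a3) (b1, y, b3) u + fG (a1, y, a3) (b1, z, b3) u}.
Proof.
move=> xyz; apply: filterS2 (G_fin (a1, x, a3) (b1, y, b3)) (G_fin (a1, y, a3) (b1, z, b3)).
by move=> u h1 h2; rewrite /fG -fineD// /G (GG_split2 _ _ _ _ _ _ _ _ _ _ _ xyz).
Qed.

Lemma fG_split3 (x y z a1 a2 b1 b2 : R) : x <= y <= z ->
  {ae m3, forall u, fG (a1, a2, x) (b1, b2, z) u =
     fG (a1, a2, x) (b1, b2, y) u + fG (a1, a2, y) (b1, b2, z) u}.
Proof.
move=> xyz; apply: filterS2 (G_fin (a1, a2, x) (b1, b2, y)) (G_fin (a1, a2, y) (b1, b2, z)).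
by move=> u h1 h2; rewrite /fG -fineD// /G (GG_split3 _ _ _ _ _ _ _ _ _ _ _ xyz).
Qed.

Let O : R3 R := (0, 0, 0).

Definition field_increment (f : R3 R -> R3 R -> R) (y x u : R3 R) : R :=
  f (co1 x, co2 x, co3 x) u
  - f (co1 x, co2 x, co3 y) u - f (co1 x, co2 y, co3 x) u
  - f (co1 y, co2 x, co3 x) u
  + f (co1 x, co2 y, co3 y) u + f (co1 y, co2 x, co3 y) u
  + f (co1 y, co2 y, co3 x) u
  - f (co1 y, co2 y, co3 y) u.

(** Inclusion-exclusion one axis at a time: four cuts at [y1], then two at [y2], then one at [y3].
    The cuts are exact for the extended integrals and survive [fine] where the pieces are finite,
    hence almost everywhere. *)
Lemma fG_increment y x : closed_orthant y -> prec3 y x ->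
  {ae m3, forall u, field_increment (fG O) y x u = fG y x u}.
Proof.
case: y => [[y1 y2] y3]; case: x => [[x1 x2] x3] [/= p1 p2 p3] [/= q1 q2 q3].
rewrite /co1 /co2 /co3 /= in p1 p2 p3 q1 q2 q3.
have h1 : 0 <= y1 <= x1 by rewrite p1 ltW.
have h2 : 0 <= y2 <= x2 by rewrite p2 ltW.
have h3 : 0 <= y3 <= x3 by rewrite p3 ltW.
have s1 (b2 b3 : R) := fG_split1 0 0 b2 b3 h1.
have s2 (b3 : R) := fG_split2 y1 0 x1 b3 h2.
have s3 := fG_split3 y1 y2 x1 x2 h3.
have FF : Filter (nbhs (almost_everywhere m3)) := leb3_ae_filter.
have ae := filterI (filterI (filterI (s1 x2 x3) (s1 x2 y3))
  (filterI (s1 y2 x3) (s1 y2 y3))) (filterI (filterI (s2 x3) (s2 y3)) s3).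
apply: (@filterS _ _ FF _ _ _ (ae FF FF FF FF FF FF)) => u [[[e1 e2] [e3 e4]] [[e5 e6] e7]].
have -> : field_increment (fG O) (y1, y2, y3) (x1, x2, x3) u =
  fG O (x1, x2, x3) u - fG O (x1, x2, y3) u - fG O (x1, y2, x3) u - fG O (y1, x2, x3) u +
  fG O (x1, y2, y3) u + fG O (y1, x2, y3) u + fG O (y1, y2, x3) u - fG O (y1, y2, y3) u by [].
by rewrite e1 e2 e3 e4 e5 e6 e7; ring.
Qed.

Context d (T : measurableType d) (P : probability T R) (W : set (R3 R) -> T -> R).
Hypothesis whiteW : white_noise P W.
Variable Y : R3 R -> T -> R.
Hypothesis wY : forall x, closed_orthant x -> wint P W (fG O x) (Y x).

Lemma closed_orthant0 : closed_orthant O.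
Proof. by split => /=. Qed.

Lemma wint_increment y x : closed_orthant y -> prec3 y x ->
  wint P W (fG y x) (rect_increment Y y x).
Proof.
move=> oy yx; have [x1 x2 x3] : closed_orthant x.
  case: oy yx => y1 y2 y3 [p1 p2 p3].
  by split; apply: ltW;
    [exact: le_lt_trans y1 p1|exact: le_lt_trans y2 p2|exact: le_lt_trans y3 p3].
case: (oy) => y1 y2 y3.
apply: (wint_ae whiteW _ (fG_L2 _ _) (fG_increment oy yx)).
have wN h X : wint P W h X -> wint P W (fun u => - h u) (fun w => - X w).
  move=> /(wintZ whiteW (-1)).
  by under eq_fun do rewrite mulN1r; under [X in wint _ _ _ X]eq_fun do rewrite mulN1r.
rewrite /field_increment /rect_increment.
by do ?[apply: (wintD whiteW) | apply: wN]; apply: wY; split.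
Qed.

Let one : R3 R := (1, 1, 1).

Let one_pos : open_orthant one.
Proof. by split; exact: ltr01. Qed.

Lemma cov_translate s a b a' b' :
  cov (aff3 one s a) (aff3 one s b) (aff3 one s a') (aff3 one s b') = cov a b a' b'.
Proof.
rewrite /cov /C (@CC_affine R q c nu k1 k2 k3 one one s 1)//; last first.
  by move=> z1 z2 z3; rewrite !mul1r.
have e k : u_scale k (1 : R) 1 = 1 /\ t_scale k (1 : R) 1 = 1 by case: k.
rewrite /co1 /co2 /co3 /= !(e _).1 !(e _).2 !mulr1 divr1 expr1n mul1r.
by rewrite mul1e.
Qed.

(** Both increments are Wiener integrals over single boxes, and the translation by [y] carries one
    box to the other without changing inner products. *)
Lemma box_field_stationary : stationary_rect_increments P Y.
Proof.
move=> y oy.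
have h1 x : prec3 y x -> wint P W (fG y x) (rect_increment Y y x).
  by move=> yx; exact: wint_increment.
have h2 x : prec3 y x ->
    wint P W (fG O (sub3 x y)) (rect_increment Y (0, 0, 0) (sub3 x y)).
  move=> [p1 p2 p3]; apply: wint_increment; first exact: closed_orthant0.
  by rewrite /prec3 /sub3 /co1/co2/co3/= !subr_gt0; split.
apply: (wint_fdd_eq whiteW h1 h2).
move=> x x' _ _; rewrite !ip_fG -(cov_translate y O).
have e z : aff3 one y (sub3 z y) = z.
    by case: z => [[z1 z2] z3]; rewrite /aff3 /sub3 /co1/co2/co3/= !mul1r !subrK.
  have e0 : aff3 one y O = y.
    by case: (y) => [[z1 z2] z3]; rewrite /aff3 /co1/co2/co3/= !mulr0 !add0r.
  by rewrite !e e0.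
Qed.

(** On a [Conv] axis the box restricts [t] while [rho] sees [t - u], so both must be dilated by the
    same factor; on the other axes they see different variables and dilate independently. Hence one
    free parameter for each [White] or [Flat] axis and a single one, [kap], for all [Conv] axes
    together. Only [S ^+ 2] is prescribed because only covariances matter. *)
Lemma box_field_scaling (l m : R3 R) (kap S : R) :
  open_orthant l -> open_orthant m -> 0 < kap ->
  (k1 = Conv -> co1 l = co1 m) -> (k2 = Conv -> co2 l = co2 m) ->
  (k3 = Conv -> co3 l = co3 m) ->
  (forall z1 z2 z3, rho q c nu (co1 m * z1) (co2 m * z2) (co3 m * z3) =
                    kap * rho q c nu z1 z2 z3) ->
  S ^+ 2 = u_scale k1 (co1 l) (co1 m) * u_scale k2 (co2 l) (co2 m) *
           u_scale k3 (co3 l) (co3 m) *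
           (t_scale k1 (co1 l) (co1 m) * t_scale k2 (co2 l) (co2 m) *
            t_scale k3 (co3 l) (co3 m) / kap) ^+ 2 ->
  (forall x y, cov O (scale3 (co1 l) (co2 l) (co3 l) x) O (scale3 (co1 l) (co2 l) (co3 l) y) =
     S ^+ 2 * cov O x O y) /\
  fdd_eq closed_orthant P P (fun x => Y (scale3 (co1 l) (co2 l) (co3 l) x))
    (fun x w => S * Y x w).
Proof.
move=> hl hm k0 v1 v2 v3 rhoM SE.
have covE x y : cov O (scale3 (co1 l) (co2 l) (co3 l) x) O
    (scale3 (co1 l) (co2 l) (co3 l) y) = S ^+ 2 * cov O x O y.
  have e0 : aff3 l O O = O by rewrite /aff3 /co1/co2/co3/= !mulr0 !addr0.
  have e z : scale3 (co1 l) (co2 l) (co3 l) z = aff3 l O z.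
    by rewrite /aff3 /scale3 /co1/co2/co3/= !addr0.
  have h := @CC_affine R q c nu k1 k2 k3 l m O kap hl hm k0 v1 v2 v3 rhoM O x O y.
  rewrite e0 -!e in h.
  by rewrite /cov /C h SE fineM ?C_fin.
split => //; case: (hl) => l1 l2 l3.
have h1 x : closed_orthant x -> wint P W (fG O (scale3 (co1 l) (co2 l) (co3 l) x))
    (Y (scale3 (co1 l) (co2 l) (co3 l) x)).
  move=> [x1 x2 x3]; apply: wY.
  by split; rewrite /scale3 /co1/co2/co3/= mulr_ge0// ltW.
have h2 x : closed_orthant x -> wint P W (fun u => S * fG O x u) (fun w => S * Y x w).
  by move=> ox; apply: (wintZ whiteW); exact: wY.
apply: (wint_fdd_eq whiteW h1 h2).
move=> x y _ _; rewrite ip_fG covE ipZl ?ipZr ?ip_fG ?mulrA -?expr2//;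
  try exact: fG_L2; by apply: L2Z; exact: fG_L2.
Qed.

End box_fields.

(** * The six fields as integrals over boxes *)

Section kernels_as_box_integrals.
Context {R : realType} (q c : R3 R) (nu : R).
Hypotheses (hq : open_orthant q) (hc : open_orthant c) (hnu : 0 < nu).
Notation mu := (@lebesgue_measure R).
Implicit Types x u t : R3 R.

Let O : R3 R := (0, 0, 0).

Let rho_inv_ge0 z1 z2 z3 : 0 <= (rho q c nu z1 z2 z3)^-1.
Proof. by rewrite invr_ge0 rho_ge0. Qed.

Let indE (y v : R) : \1_(side_oo 0 y) v = (0 < v < y)%R%:R :> R.
Proof. by rewrite indicE /side_oo mem_setE in_itv. Qed.

Lemma g1E x : g1 q c nu x = GG q c nu Conv White White side_oo O x.
Proof.
apply/funext => u; apply: eq_integral => t _; rewrite /kern /= !indE.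
by move: (0 < co2 u < co2 x) (0 < co3 u < co3 x) (0 < co1 t < co1 x) => [] [] [];
  rewrite ?mulr1 ?mul0r ?mulr0 ?mul0r.
Qed.

Lemma g12E x : g12 q c nu x = GG q c nu Conv Conv White side_oo O x.
Proof.
apply/funext => u; apply: eq_integral => t _; rewrite /kern /= !indE.
set A := 0 < co1 t < co1 x; set B := 0 < co2 t < co2 x; set D := 0 < co3 _ < co3 x.
by move: A B D => [] [] []; rewrite ?mulr1 ?mul0r ?mulr0 ?mul0r.
Qed.

Lemma g0E x : g0 q c nu x = GG q c nu Conv Conv Conv side_oo O x.
Proof.
apply/funext => u; apply: eq_integral => t _; rewrite /kern /= !indE.
set A := 0 < co1 t < co1 x; set B := 0 < co2 t < co2 x; set D := 0 < co3 _ < co3 x.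
by move: A B D => [] [] []; rewrite ?mulr1 ?mul0r ?mulr0 ?mul0r.
Qed.

Let m01 : measurable_fun setT (fun v : R => (\1_(side_oo 0 1) v : R)%:E).
Proof. by apply/measurable_EFinP; apply: measurable_indic; exact: measurable_side_oo. Qed.

Let int01 : (\int[mu]_v (\1_(side_oo 0 1) v : R)%:E = 1)%E.
Proof.
have h : mu (side_oo (0 : R) 1) = 1%E.
  by rewrite lebesgue_measure_itv/= lte_fin ltr01 oppr0 adde0.
by rewrite integral_indic ?setIT//; exact: measurable_side_oo.
Qed.

(** Supplies the integration over [t_1] that the kernels [g2] and [g23] do not have: the interval
    [(0, 1)] has length 1, so the value is unchanged and the box has first side 1 until the factor
    [x_1] is absorbed. *)
Lemma leb3_flat1 (f : R -> R -> R) : measurable_fun setT (fun p : R * R => f p.1 p.2) ->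
  (forall v w, 0 <= f v w) ->
  (\int[leb3 R]_t (\1_(side_oo 0 1) (co1 t) * f (co2 t) (co3 t))%:E =
   \int[leb2 R]_t (f t.1 t.2)%:E)%E.
Proof.
move=> mf f0.
have mEf : measurable_fun setT (fun p : R * R => (f p.1 p.2)%:E) by apply/measurable_EFinP.
have mi : measurable_fun setT (\1_(side_oo (0 : R) 1) : R -> R).
  by apply: measurable_indic; exact: measurable_side_oo.
have m23 : measurable_fun setT (fun t : R3 R => f (co2 t) (co3 t)).
  exact: (measurableT_comp mf (measurable_fun_pair measurable_co2 measurable_co3)).
rewrite leb3_tonelli; last 2 first.
- apply/measurable_EFinP; apply: measurable_funM => //.
  exact: (measurableT_comp mi measurable_co1).
- by move=> t; rewrite lee_fin mulr_ge0.
rewrite leb2_tonelli => //; last by move=> t; rewrite lee_fin.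
have mv v : measurable_fun setT (fun w => (f v w)%:E).
  exact: (measurableT_comp mEf (@pair1_measurable _ _ R R v)).
have I0 v : (0 <= \int[mu]_w (f v w)%:E)%E by apply: integral_ge0 => w _; rewrite lee_fin.
have mI : measurable_fun setT (fun v => \int[mu]_w (f v w)%:E)%E.
  by apply: (@measurable_fun_fubini_tonelli_F _ _ _ _ _ mu (fun p => (f p.1 p.2)%:E)) => // p;
    rewrite lee_fin.
transitivity (\int[mu]_s ((\1_(side_oo 0 1) s)%:E * \int[mu]_v \int[mu]_w (f v w)%:E))%E.
  apply: eq_integral => s _.
  rewrite -ge0_integralZl; try by [|exact: mI|rewrite lee_fin].
  apply: eq_integral => v _.
  rewrite -ge0_integralZl; try by [|exact: mv|move=> w _; rewrite lee_fin|rewrite lee_fin].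
rewrite ge0_integralZr; try by [|exact: m01|move=> w _; rewrite lee_fin|exact: integral_ge0].
by rewrite int01 mul1e.
Qed.

Lemma leb3_flat12 (f : R -> R) : measurable_fun setT f -> (forall v, 0 <= f v) ->
  (\int[leb3 R]_t (\1_(side_oo 0 1) (co1 t) * \1_(side_oo 0 1) (co2 t) * f (co3 t))%:E =
   \int[mu]_v (f v)%:E)%E.
Proof.
move=> mf f0; have mEf : measurable_fun setT (fun v => (f v)%:E) by apply/measurable_EFinP.
transitivity (\int[leb3 R]_t ((\1_(side_oo 0 1) (co1 t))%:E *
   (\1_(side_oo 0 1) (co2 t))%:E * (f (co3 t))%:E))%E; first by [].
rewrite (leb3_prod m01 m01 mEf); try by move=> v; rewrite lee_fin.
by rewrite !int01 !mul1e.
Qed.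

Lemma measurable_rhoV d (T : measurableType d) (f g h : T -> R) :
  measurable_fun setT f -> measurable_fun setT g -> measurable_fun setT h ->
  measurable_fun setT (fun p => (rho q c nu (f p) (g p) (h p))^-1).
Proof.
move=> mf mg mh; under eq_fun do rewrite -powR_inv1 ?rho_ge0//.
by apply: (measurableT_comp (measurable_powR (-1))); exact: measurable_rho.
Qed.

Let mi (y : R) : measurable_fun setT (\1_(side_oo (0 : R) y) : R -> R).
Proof. by apply: measurable_indic; exact: measurable_side_oo. Qed.

Lemma g2E x : g2 q c nu x = GG q c nu Flat Conv White side_oo O (1, co2 x, co3 x).
Proof.
apply/funext => u.
pose f (v w : R) := \1_(side_oo 0 (co2 x)) v * \1_(side_oo 0 (co3 x)) (co3 u) *
  (rho q c nu (co1 u) (v - co2 u) w)^-1.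
transitivity (\int[leb2 R]_t (f t.1 t.2)%:E)%E.
  apply: eq_integral => t _; rewrite /f !indE.
  by move: (0 < co3 u < co3 x) (0 < t.1 < co2 x) => [] []; rewrite ?mulr1 ?mul0r ?mulr0 ?mul0r.
rewrite -leb3_flat1.
- by apply: eq_integral => t _; rewrite /kern /f /= !mulrA.
- apply: measurable_funM.
    by apply: measurable_funM => //; exact: (measurableT_comp (mi _) measurable_fst).
  apply: measurable_rhoV => //.
  by apply: measurable_funB => //; exact: measurable_fst.
- by move=> v w; rewrite !mulr_ge0.
Qed.

Lemma g23E x : g23 q c nu x = GG q c nu Flat Conv Conv side_oo O (1, co2 x, co3 x).
Proof.
apply/funext => u.
pose f (v w : R) := \1_(side_oo 0 (co2 x)) v * \1_(side_oo 0 (co3 x)) w *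
  (rho q c nu (co1 u) (v - co2 u) (w - co3 u))^-1.
transitivity (\int[leb2 R]_t (f t.1 t.2)%:E)%E.
  by apply: eq_integral => t _; rewrite /f !indE -natrM mulnb.
rewrite -leb3_flat1.
- by apply: eq_integral => t _; rewrite /kern /f /= !mulrA.
- apply: measurable_funM.
    by apply: measurable_funM; [exact: (measurableT_comp (mi _) measurable_fst)|
      exact: (measurableT_comp (mi _) measurable_snd)].
  by apply: measurable_rhoV => //; apply: measurable_funB.
- by move=> v w; rewrite !mulr_ge0.
Qed.

Lemma g3E x : g3 q c nu x = GG q c nu Flat Flat Conv side_oo O (1, 1, co3 x).
Proof.
apply/funext => u.
pose f (v : R) := \1_(side_oo 0 (co3 x)) v * (rho q c nu (co1 u) (co2 u) (v - co3 u))^-1.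
transitivity (\int[mu]_t (f t)%:E)%E.
  by apply: eq_integral => t _; rewrite /f !indE.
rewrite -leb3_flat12.
- by apply: eq_integral => t _; rewrite /kern /f /= !mulrA.
- apply: measurable_funM; first exact: mi.
  by apply: measurable_rhoV => //; apply: measurable_funB.
- by move=> v; rewrite mulr_ge0.
Qed.

Lemma box_oo_in_L2 k1 k2 k3 a b : kind_region q k1 k2 k3 ->
  in_L2 (GG q c nu k1 k2 k3 side_oo a b).
Proof.
move=> reg; apply: GG_in_L2 => // *;
  [exact: measurable_side_oo|exact: side_oo_finite].
Qed.

Lemma region1_kind : region1 q -> kind_region q Conv White White.
Proof.
rewrite /region1 /kind_region /bot_sum /top_sum /=.
by rewrite !invfM !mul1r !addrA.
Qed.

Lemma region2_kind : region2 q -> kind_region q Flat Conv White.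
Proof.
rewrite /region2 /kind_region /bot_sum /top_sum /=.
by rewrite !invfM !mul1r !addrA.
Qed.

Lemma region3_kind : region3 q -> kind_region q Flat Flat Conv.
Proof.
rewrite /region3 /kind_region /bot_sum /top_sum /=.
by rewrite !invfM !mul1r.
Qed.

Lemma region12_kind : region12 q -> kind_region q Conv Conv White.
Proof.
rewrite /region12 /kind_region /bot_sum /top_sum /=.
by rewrite !invfM !mul1r.
Qed.

Lemma region23_kind : region23 q -> kind_region q Flat Conv Conv.
Proof.
rewrite /region23 /kind_region /bot_sum /top_sum /=.
by rewrite !invfM !mul1r !addrA.
Qed.

Lemma region0_kind : region0 q -> kind_region q Conv Conv Conv.
Proof.
rewrite /region0 /kind_region /bot_sum /top_sum /=.
by rewrite !invfM !mul1r.
Qed.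

Lemma kernels_well_defined :
  (region1 q -> well_defined (g1 q c nu)) /\
  (region2 q -> well_defined (g2 q c nu)) /\
  (region3 q -> well_defined (g3 q c nu)) /\
  (region12 q -> well_defined (g12 q c nu)) /\
  (region23 q -> well_defined (g23 q c nu)) /\
  (region0 q -> well_defined (g0 q c nu)).
Proof.
split; [|split; [|split; [|split; [|split]]]] => reg x _.
- by rewrite g1E; apply: box_oo_in_L2; exact: region1_kind.
- by rewrite g2E; apply: box_oo_in_L2; exact: region2_kind.
- by rewrite g3E; apply: box_oo_in_L2; exact: region3_kind.
- by rewrite g12E; apply: box_oo_in_L2; exact: region12_kind.
- by rewrite g23E; apply: box_oo_in_L2; exact: region23_kind.
- by rewrite g0E; apply: box_oo_in_L2; exact: region0_kind.
Qed.

Section flat_axes.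
Variables k1 k2 k3 : axis_kind.
Let one : R3 R := (1, 1, 1).
Let one_pos : open_orthant one. Proof. by split; exact: ltr01. Qed.

Let rho1 (z1 z2 z3 : R) :
  rho q c nu (co1 one * z1) (co2 one * z2) (co3 one * z3) = 1 * rho q c nu z1 z2 z3.
Proof. by rewrite !mul1r. Qed.

Let side0 (s v : R) : s = 0 -> \1_(side_oc 0 s) v = 0 :> R.
Proof.
by move=> ->; rewrite indicE /side_oc mem_setE in_itv/=; case: ltgtP.
Qed.

(** Dilating only the box along a [Flat] axis leaves [u] and [rho] alone and rescales [t_1], with
    Jacobian [s]. No dilation is available at [s = 0], but there the half-open side is empty. *)
Lemma G_flat1 (s y z : R) u : k1 = Flat -> 0 <= s ->
  GG q c nu k1 k2 k3 side_oc O (s, y, z) u =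
  (s%:E * GG q c nu k1 k2 k3 side_oc O (1, y, z)%R u)%E.
Proof.
move=> k1F; rewrite le_eqVlt => /predU1P[s0|s0].
  rewrite -s0 mul0e /GG integral0_eq// => t _.
  by rewrite /kern [X in X * _ * _ * _]side0// !mul0r.
have hl : open_orthant ((s, 1, 1) : R3 R) by split; rewrite ?s0 //; exact: ltr01.
have h1 : k1 = Conv -> co1 ((s, 1, 1) : R3 R) = co1 one by rewrite k1F.
have := @GG_affine R q c nu k1 k2 k3 (s, 1, 1) one O 1 hl one_pos ltr01 h1
  (fun=> erefl) (fun=> erefl) rho1 O (1, y, z) u.
have e k : u_scale k (1 : R) 1 = 1 /\ t_scale k (1 : R) 1 = 1 by case: k.
have es k : u_shift k (0 : R) = 0 by case: k.
rewrite /aff3 /co1/co2/co3/= !(e _).1 !(e _).2 !es k1F/= !mul1r !mulr0 !addr0 !mulr1 divr1.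
by case: u => [[u1 u2] u3].
Qed.

Lemma G_flat2 (s x z : R) u : k2 = Flat -> 0 <= s ->
  GG q c nu k1 k2 k3 side_oc O (x, s, z) u =
  (s%:E * GG q c nu k1 k2 k3 side_oc O (x, 1, z)%R u)%E.
Proof.
move=> k2F; rewrite le_eqVlt => /predU1P[s0|s0].
  rewrite -s0 mul0e /GG integral0_eq// => t _.
  by rewrite /kern [X in _ * X * _ * _]side0// mulr0 !mul0r.
have hl : open_orthant ((1, s, 1) : R3 R) by split; rewrite ?s0 //; exact: ltr01.
have h2 : k2 = Conv -> co2 ((1, s, 1) : R3 R) = co2 one by rewrite k2F.
have := @GG_affine R q c nu k1 k2 k3 (1, s, 1) one O 1 hl one_pos ltr01 (fun=> erefl)
  h2 (fun=> erefl) rho1 O (x, 1, z) u.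
have e k : u_scale k (1 : R) 1 = 1 /\ t_scale k (1 : R) 1 = 1 by case: k.
have es k : u_shift k (0 : R) = 0 by case: k.
rewrite /aff3 /co1/co2/co3/= !(e _).1 !(e _).2 !es k2F/= !mul1r !mulr0 !addr0 !mulr1 divr1.
by case: u => [[u1 u2] u3].
Qed.

End flat_axes.

(** Also true at [x = +oo], where both sides are 0, so the identities on [Flat] axes hold for every
    [u] and not only almost everywhere. *)
Lemma fineZ (s : R) (x : \bar R) : 0 <= s -> (0 <= x)%E -> fine (s%:E * x) = s * fine x.
Proof.
move=> s0; case: x => [x| |]//= _; rewrite mulr0.
move: s0; rewrite le_eqVlt => /predU1P[<-|s0]; first by rewrite mul0e.
by rewrite gt0_muley// lte_fin.
Qed.

Section fields.
Context d (T : measurableType d) (P : probability T R) (W : set (R3 R) -> T -> R).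
Hypothesis whiteW : white_noise P W.

Lemma wiener_integral_box k1 k2 k3 x Z : kind_region q k1 k2 k3 ->
  wiener_integral P W (GG q c nu k1 k2 k3 side_oo O x) Z ->
  wint P W (fG q c nu k1 k2 k3 O x) Z.
Proof.
move=> reg wZ; have := wiener_integral_wint whiteW (box_oo_in_L2 O x reg) wZ.
move=> w; apply: (wint_ae whiteW w (fG_L2 hq hc hnu reg _ _)).
apply: filterS (leb3_ae_neq x) => u [u1 u2 u3].
by rewrite /fG /= GG_oo_oc.
Qed.

(** The prefactors [co1 x] and [co1 x * co2 x] are inside [fG] here, as the lengths of the sides on
    the [Flat] axes, so that all six fields satisfy the same relation. *)
Definition is_box_field k1 k2 k3 (Y : R3 R -> T -> R) : Prop :=
  forall x, closed_orthant x -> wint P W (fG q c nu k1 k2 k3 O x) (Y x).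

Let eta3 x : (co1 x, co2 x, co3 x) = x.
Proof. by case: x => [[]]. Qed.

Lemma Y1_box Y : region1 q -> is_Y1 P W q c nu Y -> is_box_field Conv White White Y.
Proof.
move=> reg HY x ox; have [Z wZ ->] := HY x ox; rewrite g1E in wZ.
have := wiener_integral_box (region1_kind reg) wZ.
by under [X in _ -> wint _ _ _ X]eq_fun do rewrite mul1r.
Qed.

Lemma Y12_box Y : region12 q -> is_Y12 P W q c nu Y -> is_box_field Conv Conv White Y.
Proof.
move=> reg HY x ox; have [Z wZ ->] := HY x ox; rewrite g12E in wZ.
have := wiener_integral_box (region12_kind reg) wZ.
by under [X in _ -> wint _ _ _ X]eq_fun do rewrite mul1r.
Qed.

Lemma Y0_box Y : region0 q -> is_Y0 P W q c nu Y -> is_box_field Conv Conv Conv Y.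
Proof.
move=> reg HY x ox; have [Z wZ ->] := HY x ox; rewrite g0E in wZ.
have := wiener_integral_box (region0_kind reg) wZ.
by under [X in _ -> wint _ _ _ X]eq_fun do rewrite mul1r.
Qed.

Let fG_flat1 k2 k3 x u : closed_orthant x -> kind_region q Flat k2 k3 ->
  fG q c nu Flat k2 k3 O x u = co1 x * fG q c nu Flat k2 k3 O (1, co2 x, co3 x) u.
Proof.
move=> [x1 _ _] reg; rewrite -[in LHS](eta3 x) /fG G_flat1//.
by rewrite fineZ//; exact: GG_ge0.
Qed.

Let flat_box k2 k3 Y : kind_region q Flat k2 k3 ->
  (forall x, closed_orthant x -> exists2 Z,
     wiener_integral P W (GG q c nu Flat k2 k3 side_oo O (1, co2 x, co3 x)) Z &
     Y x = (fun w => co1 x * Z w)) -> is_box_field Flat k2 k3 Y.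
Proof.
move=> reg HY x ox; have [Z wZ ->] := HY x ox.
have := wintZ whiteW (co1 x) (wiener_integral_box reg wZ).
by congr wint; apply/funext => u; rewrite -(fG_flat1 _ ox reg).
Qed.

Lemma Y2_box Y : region2 q -> is_Y2 P W q c nu Y -> is_box_field Flat Conv White Y.
Proof.
move=> reg HY; apply: flat_box; first exact: region2_kind.
by move=> x /HY[Z wZ YE]; exists Z; rewrite -?g2E.
Qed.

Lemma Y23_box Y : region23 q -> is_Y23 P W q c nu Y -> is_box_field Flat Conv Conv Y.
Proof.
move=> reg HY; apply: flat_box; first exact: region23_kind.
by move=> x /HY[Z wZ YE]; exists Z; rewrite -?g23E.
Qed.

Lemma Y3_box Y : region3 q -> is_Y3 P W q c nu Y -> is_box_field Flat Flat Conv Y.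
Proof.
move=> reg3 HY x ox; have reg := region3_kind reg3.
have [Z wZ ->] := HY x ox; rewrite g3E in wZ.
have := wintZ whiteW (co1 x * co2 x) (wiener_integral_box reg wZ).
case: (ox) => _ x2 _.
congr wint; apply/funext => u; rewrite (fG_flat1 _ ox reg) -mulrA; congr (_ * _).
by rewrite /fG [in RHS]G_flat2// fineZ ?GG_ge0.
Qed.

End fields.
End kernels_as_box_integrals.

(** * The covariance of the fractional Brownian sheet *)

Section axis_covariance.
Context {R : realType}.

Lemma axis_covariance (d : R -> R -> R) (h : R) : 0 < h ->
  (forall s s', 0 <= s -> 0 <= s' -> d s s' = d s' s) ->
  (forall r s s', 0 < r -> 0 <= s -> 0 <= s' -> d (r * s) (r * s') = r `^ (2 * h) * d s s') ->
  (forall s s', 0 <= s <= s' -> d s' s' - d s s' - d s' s + d s s = d (s' - s) (s' - s)) ->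
  forall s s', 0 <= s -> 0 <= s' ->
  d s s' = 2^-1 * (s `^ (2 * h) + s' `^ (2 * h) - `|s - s'| `^ (2 * h)) * d 1 1.
Proof.
move=> h0 dsym dscale dincr.
(* Dilations by [r > 0] say nothing at 0; the degenerate increment [s = s' = 0] does. *)
have d00 : d 0 0 = 0.
  by have := dincr 0 0; rewrite lexx (subrr (0 : R)) => /(_ isT); lra.
have dss s : 0 <= s -> d s s = s `^ (2 * h) * d 1 1.
  rewrite le_eqVlt => /predU1P[<-|s0].
    by rewrite d00 powR0 ?mul0r// mulf_neq0// gt_eqF.
  by have := dscale s 1 1 s0 ler01 ler01; rewrite mulr1.
have main s s' : 0 <= s <= s' ->
    d s s' = 2^-1 * (s `^ (2 * h) + s' `^ (2 * h) - `|s - s'| `^ (2 * h)) * d 1 1.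
  move=> /andP[s0 ss']; have s'0 := le_trans s0 ss'.
  have := dincr s s'; rewrite s0 ss' => /(_ isT).
  rewrite (dsym s' s)// (dss s')// (dss s)// (dss (s' - s)) ?subr_ge0//.
  rewrite distrC (ger0_norm (_ : 0 <= s' - s)) ?subr_ge0//. lra.
move=> s s' s0 s'0; have [ss'|/ltW s's] := leP s s'; first by apply: main; rewrite s0.
by rewrite dsym// distrC main ?s'0//; ring.
Qed.

Definition fbm_cov (h s s' : R) : R := s `^ (2 * h) + s' `^ (2 * h) - `|s - s'| `^ (2 * h).

Section sheet_covariance.
Variable D : R3 R -> R3 R -> R.

Definition swaps1 := forall x1 x2 x3 y1 y2 y3 : R,
  closed_orthant (x1, x2, x3) -> closed_orthant (y1, y2, y3) ->
  D (x1, x2, x3) (y1, y2, y3) = D (y1, x2, x3) (x1, y2, y3).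
Definition swaps2 := forall x1 x2 x3 y1 y2 y3 : R,
  closed_orthant (x1, x2, x3) -> closed_orthant (y1, y2, y3) ->
  D (x1, x2, x3) (y1, y2, y3) = D (x1, y2, x3) (y1, x2, y3).
Definition swaps3 := forall x1 x2 x3 y1 y2 y3 : R,
  closed_orthant (x1, x2, x3) -> closed_orthant (y1, y2, y3) ->
  D (x1, x2, x3) (y1, y2, y3) = D (x1, x2, y3) (y1, y2, x3).

Hypothesis D_sym : forall x y, D x y = D y x.

Lemma swaps23 : swaps2 -> swaps3 -> swaps1.
Proof.
move=> s2 s3 x1 x2 x3 y1 y2 y3 [? ? ?] [? ? ?].
by rewrite D_sym s2; [rewrite s3|..].
Qed.

Lemma swaps13 : swaps1 -> swaps3 -> swaps2.
Proof.
move=> s1 s3 x1 x2 x3 y1 y2 y3 [? ? ?] [? ? ?].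
by rewrite D_sym s1; [rewrite s3|..].
Qed.

Lemma swaps12 : swaps1 -> swaps2 -> swaps3.
Proof.
move=> s1 s2 x1 x2 x3 y1 y2 y3 [? ? ?] [? ? ?].
by rewrite D_sym s1; [rewrite s2|..].
Qed.

(** [axis_covariance] on each axis in turn, replacing the pair [(x_j, y_j)] by [(1, 1)]; the three
    factors [2^-1] make up [8^-1]. *)
Lemma sheet_covariance h1 h2 h3 x y : 0 < h1 -> 0 < h2 -> 0 < h3 ->
  swaps1 -> swaps2 -> swaps3 ->
  (forall s s' x2 x3 y2 y3, 0 <= s <= s' ->
    D (s', x2, x3) (s', y2, y3) - D (s, x2, x3) (s', y2, y3) -
    D (s', x2, x3) (s, y2, y3) + D (s, x2, x3) (s, y2, y3) =
    D (s' - s, x2, x3) (s' - s, y2, y3)) ->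
  (forall s s' x1 x3 y1 y3, 0 <= s <= s' ->
    D (x1, s', x3) (y1, s', y3) - D (x1, s, x3) (y1, s', y3) -
    D (x1, s', x3) (y1, s, y3) + D (x1, s, x3) (y1, s, y3) =
    D (x1, s' - s, x3) (y1, s' - s, y3)) ->
  (forall s s' x1 x2 y1 y2, 0 <= s <= s' ->
    D (x1, x2, s') (y1, y2, s') - D (x1, x2, s) (y1, y2, s') -
    D (x1, x2, s') (y1, y2, s) + D (x1, x2, s) (y1, y2, s) =
    D (x1, x2, s' - s) (y1, y2, s' - s)) ->
  (forall r1 r2 r3 x y, 0 < r1 -> 0 < r2 -> 0 < r3 ->
    D (scale3 r1 r2 r3 x) (scale3 r1 r2 r3 y) =
    r1 `^ (2 * h1) * r2 `^ (2 * h2) * r3 `^ (2 * h3) * D x y) ->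
  closed_orthant x -> closed_orthant y ->
  D x y = 8^-1 * (fbm_cov h1 (co1 x) (co1 y) * fbm_cov h2 (co2 x) (co2 y) *
                  fbm_cov h3 (co3 x) (co3 y)) * D (1, 1, 1) (1, 1, 1).
Proof.
move=> h10 h20 h30 sw1 sw2 sw3 incr1 incr2 incr3 scale.
case: x => [[x1 x2] x3]; case: y => [[y1 y2] y3] [p1 p2 p3] [r1 r2 r3].
rewrite /co1 /co2 /co3 /= in p1 p2 p3 r1 r2 r3 *.
have -> := @axis_covariance (fun s s' => D (s, x2, x3) (s', y2, y3))
  h1 h10 _ _ _ x1 y1 p1 r1; first 1 last.
- by move=> s s' s0 s'0; apply: sw1.
- move=> r s s' r0 s0 s'0; have := scale r 1 1 (s, x2, x3) (s', y2, y3) r0 ltr01 ltr01.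
  by rewrite /scale3 /co1/co2/co3/= !mul1r !powR1 !mulr1.
- by move=> s s' ss'; rewrite -incr1.
have -> := @axis_covariance (fun s s' => D (1, s, x3) (1, s', y3))
  h2 h20 _ _ _ x2 y2 p2 r2; first 1 last.
- by move=> s s' s0 s'0; apply: sw2; split=> //; exact: ler01.
- move=> r s s' r0 s0 s'0; have := scale 1 r 1 (1, s, x3) (1, s', y3) ltr01 r0 ltr01.
  by rewrite /scale3 /co1/co2/co3/= !mul1r !powR1 !mulr1 mul1r.
- by move=> s s' ss'; rewrite -incr2.
have -> := @axis_covariance (fun s s' => D (1, 1, s) (1, 1, s'))
  h3 h30 _ _ _ x3 y3 p3 r3; first 1 last.
- by move=> s s' s0 s'0; apply: sw3; split=> //; exact: ler01.
- move=> r s s' r0 s0 s'0; have := scale 1 1 r (1, 1, s) (1, 1, s') ltr01 ltr01 r0.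
  by rewrite /scale3 /co1/co2/co3/= !mul1r !powR1 !mul1r.
- by move=> s s' ss'; rewrite -incr3.
by rewrite /fbm_cov; field.
Qed.

End sheet_covariance.

End axis_covariance.

Section box_covariance.
Context {R : realType} (q c : R3 R) (nu : R) (k1 k2 k3 : axis_kind).
Hypotheses (hq : open_orthant q) (hc : open_orthant c) (hnu : 0 < nu).
Hypothesis reg : kind_region q k1 k2 k3.

Let O : R3 R := (0, 0, 0).
Let one : R3 R := (1, 1, 1).
Let G := GG q c nu k1 k2 k3 side_oc.
Let cv := cov q c nu k1 k2 k3.
Let m3 : {measure set _ -> \bar R} := leb3 R.
Let fg := fG q c nu k1 k2 k3.

Definition cov0 x y : R := cv O x O y.

Let fg_L2 a b : L2 m3 (fg a b). Proof. exact: fG_L2. Qed.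

Let cvE a b a' b' : cv a b a' b' = ip m3 (fg a b) (fg a' b').
Proof. by rewrite ip_fG. Qed.

Let cv_add a b b1 a1 a' b' :
  {ae m3, forall u, fg a b u = fg a b1 u + fg a1 b u} ->
  cv a b a' b' = cv a b1 a' b' + cv a1 b a' b'.
Proof.
move=> h; rewrite !cvE -ipDl//; apply: ip_ae_eq => //; first exact: L2D.
exact: aeW.
Qed.

Let incr_gen a b b1 a1 a' b' b1' a1' :
  {ae m3, forall u, fg a b u = fg a b1 u + fg a1 b u} ->
  {ae m3, forall u, fg a' b' u = fg a' b1' u + fg a1' b' u} ->
  cv a b a' b' - cv a b1 a' b' - cv a b a' b1' + cv a b1 a' b1' = cv a1 b a1' b'.
Proof.
move=> h h'; have e1 := cv_add a' b' h; have e2 := cv_add a' b1' h.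
have e3 : cv a1 b a' b' = cv a1 b a' b1' + cv a1 b a1' b'.
  have sy x y x' y' : cv x y x' y' = cv x' y' x y by exact: cov_sym.
  rewrite (sy a1 b a' b') (sy a1 b a' b1') (sy a1 b a1' b').
  exact: (cv_add a1 b h').
move: e1 e2 e3; move: (cv a b a' b') (cv a b1 a' b') (cv a1 b a' b') (cv a b a' b1')
  (cv a b1 a' b1') (cv a1 b a' b1') (cv a1 b a1' b') => *; lra.
Qed.

Lemma cov_increment1 (s s' x2 x3 y2 y3 : R) : 0 <= s <= s' ->
  cov0 (s', x2, x3) (s', y2, y3) - cov0 (s, x2, x3) (s', y2, y3) -
  cov0 (s', x2, x3) (s, y2, y3) + cov0 (s, x2, x3) (s, y2, y3) =
  cov0 (s' - s, x2, x3) (s' - s, y2, y3).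
Proof.
move=> ss'.
rewrite /cov0 (incr_gen (fG_split1 hq hc hnu reg 0 0 x2 x3 ss')
  (fG_split1 hq hc hnu reg 0 0 y2 y3 ss')).
rewrite /cv -(cov_translate q c nu k1 k2 k3 (s, 0, 0) O) /aff3 /co1/co2/co3/=.
by rewrite !mul1r !addr0 ?add0r !subrK.
Qed.

Lemma cov_increment2 (s s' x1 x3 y1 y3 : R) : 0 <= s <= s' ->
  cov0 (x1, s', x3) (y1, s', y3) - cov0 (x1, s, x3) (y1, s', y3) -
  cov0 (x1, s', x3) (y1, s, y3) + cov0 (x1, s, x3) (y1, s, y3) =
  cov0 (x1, s' - s, x3) (y1, s' - s, y3).
Proof.
move=> ss'.
rewrite /cov0 (incr_gen (fG_split2 hq hc hnu reg 0 0 x1 x3 ss')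
  (fG_split2 hq hc hnu reg 0 0 y1 y3 ss')).
rewrite /cv -(cov_translate q c nu k1 k2 k3 (0, s, 0) O) /aff3 /co1/co2/co3/=.
by rewrite !mul1r !addr0 ?add0r !subrK.
Qed.

Lemma cov_increment3 (s s' x1 x2 y1 y2 : R) : 0 <= s <= s' ->
  cov0 (x1, x2, s') (y1, y2, s') - cov0 (x1, x2, s) (y1, y2, s') -
  cov0 (x1, x2, s') (y1, y2, s) + cov0 (x1, x2, s) (y1, y2, s) =
  cov0 (x1, x2, s' - s) (y1, y2, s' - s).
Proof.
move=> ss'.
rewrite /cov0 (incr_gen (fG_split3 hq hc hnu reg 0 0 x1 x2 ss')
  (fG_split3 hq hc hnu reg 0 0 y1 y2 ss')).
rewrite /cv -(cov_translate q c nu k1 k2 k3 (0, 0, s) O) /aff3 /co1/co2/co3/=.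
by rewrite !mul1r !addr0 ?add0r !subrK.
Qed.

Let cov0E x y : cov0 x y = fine (\int[leb3 R]_u (G O x u * G O y u))%E.
Proof. by []. Qed.

Let cov0_congr x y x' y' : (forall u, G O x u * G O y u = G O x' u * G O y' u)%E ->
  cov0 x y = cov0 x' y'.
Proof. by move=> h; rewrite !cov0E; under eq_integral do rewrite h. Qed.

Lemma flat_swaps1 : k1 = Flat -> swaps1 cov0.
Proof.
move=> kF s x2 x3 s' y2 y3 [s0 _ _] [s'0 _ _].
have fl y z r u : 0 <= r -> G O (r, y, z) u = (r%:E * G O (1%R, y, z) u)%E by exact: G_flat1.
apply: cov0_congr => u.
rewrite (fl x2 x3 s u s0) (fl y2 y3 s' u s'0) (fl x2 x3 s' u s'0) (fl y2 y3 s u s0).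
by move: (G _ _ _) (G _ _ _) => g g'; rewrite muleACA [RHS]muleACA (muleC s%:E).
Qed.

Lemma flat_swaps2 : k2 = Flat -> swaps2 cov0.
Proof.
move=> kF x1 s x3 y1 s' y3 [_ s0 _] [_ s'0 _].
have fl y z r u : 0 <= r -> G O (y, r, z) u = (r%:E * G O (y, 1%R, z) u)%E by exact: G_flat2.
apply: cov0_congr => u.
rewrite (fl x1 x3 s u s0) (fl y1 y3 s' u s'0) (fl x1 x3 s' u s'0) (fl y1 y3 s u s0).
by move: (G _ _ _) (G _ _ _) => g g'; rewrite muleACA [RHS]muleACA (muleC s%:E).
Qed.

Lemma GG_eq_on_kern a b a' b' u : (forall t, kern q c nu k1 k2 k3 side_oc a b u t =
  kern q c nu k1 k2 k3 side_oc a' b' u t) -> G a b u = G a' b' u.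
Proof. by move=> h; apply: eq_integral => t _; rewrite h. Qed.

Let kern0_GG a b u : (forall t, kern q c nu k1 k2 k3 side_oc a b u t = 0) -> G a b u = 0%E.
Proof. by move=> h; rewrite /G /GG integral0_eq// => t _; rewrite h. Qed.

Let indic01 (A : set R) v : {(\1_A v : R) = 0} + {(\1_A v : R) = 1}.
Proof. by rewrite indicE; case: (v \in A); [right|left]. Qed.

(** Equality holds for each [u]. If [u_2] misses one of the two intervals, a factor vanishes on
    either side; otherwise both indicators are 1 and [s], [s'] are interchangeable. *)
Lemma white_swaps2 : k2 = White -> swaps2 cov0.
Proof.
move=> kW x1 s x3 y1 s' y3 _ _.
apply: cov0_congr => u.
have zero x r z : \1_(side_oc 0 r) (co2 u) = 0 :> R -> G O (x, r, z) u = 0%E.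
  by move=> e; apply: kern0_GG => t; rewrite /kern kW [X in _ * X * _ * _]e mulr0 !mul0r.
case: (indic01 (side_oc 0 s) (co2 u)) => [e|e].
  by rewrite !(zero _ s)// mul0e mule0.
case: (indic01 (side_oc 0 s') (co2 u)) => [e'|e'].
  by rewrite !(zero _ s')// mul0e mule0.
have eq x z : G O (x, s, z) u = G O (x, s', z) u.
  by apply: GG_eq_on_kern => t; rewrite /kern kW [X in _ * X * _ * _ = _]e
    [X in _ = _ * X * _ * _]e'.
by rewrite !eq.
Qed.

Lemma white_swaps3 : k3 = White -> swaps3 cov0.
Proof.
move=> kW x1 x2 s y1 y2 s' _ _.
apply: cov0_congr => u.
have zero x y r : \1_(side_oc 0 r) (co3 u) = 0 :> R -> G O (x, y, r) u = 0%E.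
  by move=> e; apply: kern0_GG => t; rewrite /kern kW [X in _ * _ * X * _]e mulr0 !mul0r.
case: (indic01 (side_oc 0 s) (co3 u)) => [e|e].
  by rewrite !(zero _ _ s)// mul0e mule0.
case: (indic01 (side_oc 0 s') (co3 u)) => [e'|e'].
  by rewrite !(zero _ _ s')// mul0e mule0.
have eq x y : G O (x, y, s) u = G O (x, y, s') u.
  by apply: GG_eq_on_kern => t; rewrite /kern kW [X in _ * _ * X * _ = _]e
    [X in _ = _ * _ * X * _]e'.
by rewrite !eq.
Qed.

Let c1 : 0 < co1 c. Proof. by case: hc. Qed.
Let c2 : 0 < co2 c. Proof. by case: hc. Qed.
Let c3 : 0 < co3 c. Proof. by case: hc. Qed.

Let M : R := (co1 c + co2 c + co3 c) `^ nu.

Let M0 : 0 < M. Proof. by rewrite powR_gt0// !addr_gt0. Qed.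

Let rho_le (z1 z2 z3 : R) : 0 < z1 <= 1 -> 0 < z2 <= 1 -> 0 < z3 <= 1 ->
  M^-1 <= (rho q c nu z1 z2 z3)^-1.
Proof.
case: hq => q1 q2 q3 h1 h2 h3.
have r0 : 0 < rho q c nu z1 z2 z3 by apply: rho_gt0 => //; rewrite gt_eqF//; case/andP: h1.
rewrite lef_pV2//; apply: ge0_ler_powR; rewrite ?nnegrE ?(ltW hnu)//.
- by rewrite !addr_ge0// mulr_ge0 ?powR_ge0// ltW.
- by rewrite !addr_ge0// ltW.
have le1 (C p z : R) : 0 < C -> 0 < p -> 0 < z <= 1 -> C * `|z| `^ (p / nu) <= C.
  move=> C0 p0 /andP[z0 z1']; rewrite ler_piMr ?(ltW C0)// gtr0_norm//.
  rewrite -[leRHS](powRr0 z); apply: ger_powR; first by rewrite z0.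
  by rewrite divr_ge0// ltW.
by rewrite !lerD ?le1.
Qed.

(** With [t] in [Q] and [u] in [Q'], each of [t_j], [u_j] and [t_j - u_j] lies in [(0, 1]]. So all
    indicators of the unit box are 1 and [rho] is at most [M], whatever the kinds of the axes. *)
Let Q : set (R3 R) := [set t | [/\ `](2^-1), 1[%classic (co1 t), `](2^-1), 1[%classic (co2 t) &
   `](2^-1), 1[%classic (co3 t)]].
Let Q' : set (R3 R) := [set t | [/\ `]0, (2^-1)[%classic (co1 t), `]0, (2^-1)[%classic (co2 t) &
   `]0, (2^-1)[%classic (co3 t)]].

Let mQ : measurable Q. Proof. by apply: measurable_box; exact: measurable_itv. Qed.
Let mQ' : measurable Q'. Proof. by apply: measurable_box; exact: measurable_itv. Qed.

Let vQ : leb3 R Q = (8^-1)%:E.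
Proof.
rewrite leb3_box ?lebesgue_measure_itv/=; try exact: measurable_itv.
rewrite lte_fin ifT; last by lra.
by rewrite -EFinB -!EFinM; congr EFin; field.
Qed.

Let vQ' : leb3 R Q' = (8^-1)%:E.
Proof.
rewrite leb3_box ?lebesgue_measure_itv/=; try exact: measurable_itv.
rewrite lte_fin ifT; last by lra.
by rewrite -EFinB -!EFinM; congr EFin; field.
Qed.

Let int_cst (A : set (R3 R)) (r : R) : measurable A -> 0 <= r -> leb3 R A = (8^-1)%:E ->
  (\int[leb3 R]_t (r * \1_A t)%:E = (r / 8)%:E)%E.
Proof.
move=> mA r0 vA; under eq_integral do rewrite EFinM.
rewrite ge0_integralZl; try by [|apply/measurable_EFinP; exact: measurable_indic|
  move=> t _; rewrite lee_fin|rewrite lee_fin].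
by rewrite integral_indic// setIT [X in (_ * X)%E]vA -EFinM.
Qed.

Let GG_lower u : ((M^-1 / 8 * \1_Q' u)%:E <= G O one u)%E.
Proof.
rewrite indicE; have [/set_mem [u1 u2 u3]|_] := boolP (u \in Q'); last first.
  by rewrite mulr0 GG_ge0.
rewrite mulr1 -(int_cst mQ _ vQ) ?invr_ge0 ?(ltW M0)//.
apply: ge0_le_integral => //.
- by move=> t _; rewrite lee_fin mulr_ge0// invr_ge0 ltW.
- by apply/measurable_EFinP; apply: measurable_funM => //; exact: measurable_indic.
- by apply/measurable_EFinP; apply: measurable_kern_u => *; exact: measurable_side_oc.
- move=> t _; rewrite lee_fin indicE; have [/set_mem [t1 t2 t3]|_] := boolP (t \in Q); last first.
    by rewrite mulr0 kern_ge0.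
  rewrite /= !in_itv/= in u1 u2 u3 t1 t2 t3.
  have wz k (v r : R) : 0 < v < 2^-1 -> 2^-1 < r < 1 ->
      \1_(side_oc 0 1) (wco k v r) = 1 :> R /\ 0 < zco k v r <= 1.
    move=> /andP[v0 v1] /andP[w0 w1].
    rewrite indicE /side_oc mem_setE in_itv.
    by split; [rewrite (_ : _ && _ = true)//; apply/andP; case: k => /=; split; lra|
               case: k => /=; apply/andP; split; lra].
  have [e1 z1] := wz k1 _ _ u1 t1; have [e2 z2] := wz k2 _ _ u2 t2.
  have [e3 z3] := wz k3 _ _ u3 t3.
  by rewrite mulr1 /kern [X in X * _ * _ * _]e1 [X in _ * X * _ * _]e2
    [X in _ * _ * X * _]e3 !mul1r; exact: rho_le.
Qed.

(** [GG_lower] bounds the integrand below by a positive constant on [Q'], a set of volume 1/8. *)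
Lemma cov_one_gt0 : 0 < cov0 one one.
Proof.
rewrite /cov0 /cv /cov -lte_fin fineK; last exact: C_fin.
have r0 : 0 <= M^-1 / 8 by rewrite divr_ge0// invr_ge0 ltW.
have mG : measurable_fun setT (G O one) by apply: measurable_GG => *; exact: measurable_side_oc.
apply: (@lt_le_trans _ _ (\int[leb3 R]_u ((M^-1 / 8 * (M^-1 / 8)) * \1_Q' u)%:E)%E).
  rewrite (int_cst mQ' (mulr_ge0 r0 r0) vQ') lte_fin.
  by rewrite !divr_gt0 ?mulr_gt0 ?divr_gt0 ?invr_gt0.
apply: ge0_le_integral => //.
- by move=> t _; rewrite lee_fin; apply: mulr_ge0 => //; exact: mulr_ge0.
- by apply/measurable_EFinP; apply: measurable_funM => //; exact: measurable_indic.
- exact: emeasurable_funM.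
- move=> u _; have p0 : 0 <= M^-1 / 8 * \1_Q' u by exact: mulr_ge0.
  apply: (@le_trans _ _ ((M^-1 / 8 * \1_Q' u)%:E * (M^-1 / 8 * \1_Q' u)%:E)%E).
    by rewrite -EFinM lee_fin indicE; case: (u \in Q'); rewrite /= ?mulr1 ?mulr0.
  by apply: lee_pmul; rewrite ?lee_fin//; exact: GG_lower.
Qed.

End box_covariance.

Section fractional_brownian_sheets.
Context {R : realType}.

Context (q c : R3 R) (nu : R) (k1 k2 k3 : axis_kind).
Hypotheses (hq : open_orthant q) (hc : open_orthant c) (hnu : 0 < nu).
Hypothesis reg : kind_region q k1 k2 k3.
Context d (T : measurableType d) (P : probability T R) (W : set (R3 R) -> T -> R).
Hypothesis whiteW : white_noise P W.
Variable Y : R3 R -> T -> R.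
Hypothesis wY : is_box_field q c nu P W k1 k2 k3 Y.

Let D := cov0 q c nu k1 k2 k3.
Let one : R3 R := (1, 1, 1).
Let fg x := fG q c nu k1 k2 k3 (0, 0, 0) x.

Let one_closed : closed_orthant one. Proof. by split; exact: ler01. Qed.

Let ip_fg x y : ip (leb3 R) (fg x) (fg y) = D x y.
Proof. exact: ip_fG. Qed.

Let L2_Y x : closed_orthant x -> L2 P (Y x). Proof. by move=> /wY[]. Qed.

Let ip_Y x y : closed_orthant x -> closed_orthant y -> ip P (Y x) (Y y) = D x y.
Proof. by move=> ox oy; rewrite (wint_ip whiteW (wY ox) (wY oy)) ip_fg. Qed.

Let s := sigma P Y.

Let D1 : 0 < D one one. Proof. exact: cov_one_gt0. Qed.

Let s2 : s ^+ 2 = D one one.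
Proof.
rewrite /s /sigma (_ : (fun w => Y (1, 1, 1) w ^+ 2) = (fun w => Y one w * Y one w)).
  rewrite expectation_mul; [|exact: L2_Y..].
  by rewrite ip_Y// sqr_sqrtr// ltW.
by apply/funext => w; rewrite expr2.
Qed.

Let s_neq0 : s != 0.
Proof. by rewrite -sqrf_eq0 s2 gt_eqF. Qed.

Variables h1 h2 h3 : R.
Hypotheses (h1b : 0 < h1 <= 1) (h2b : 0 < h2 <= 1) (h3b : 0 < h3 <= 1).
Hypotheses (sw1 : swaps1 D) (sw2 : swaps2 D) (sw3 : swaps3 D).
Hypothesis scale : forall r1 r2 r3 x y, 0 < r1 -> 0 < r2 -> 0 < r3 ->
  D (scale3 r1 r2 r3 x) (scale3 r1 r2 r3 y) =
  r1 `^ (2 * h1) * r2 `^ (2 * h2) * r3 `^ (2 * h3) * D x y.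

Let F x y := 8^-1 * (fbm_cov h1 (co1 x) (co1 y) * fbm_cov h2 (co2 x) (co2 y) *
                     fbm_cov h3 (co3 x) (co3 y)).

Let covD x y : closed_orthant x -> closed_orthant y -> D x y = F x y * s ^+ 2.
Proof.
move=> ox oy; rewrite s2.
case/andP: h1b => h10 _; case/andP: h2b => h20 _; case/andP: h3b => h30 _.
exact: (@sheet_covariance R D h1 h2 h3 x y h10 h20 h30 sw1 sw2 sw3
  (fun s s' x2 x3 y2 y3 => cov_increment1 hq hc hnu reg x2 x3 y2 y3)
  (fun s s' x1 x3 y1 y3 => cov_increment2 hq hc hnu reg x1 x3 y1 y3)
  (fun s s' x1 x2 y1 y2 => cov_increment3 hq hc hnu reg x1 x2 y1 y2) scale ox oy).
Qed.

(** The existence clause is met by the field itself divided by [s], on the same probability space.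
    An arbitrary sheet is then compared with [Y] through covariances alone. *)
Lemma box_field_fBs : fdd_eq_fBs P Y s h1 h2 h3.
Proof.
split.
  exists d, T, P, (fun x w => s^-1 * Y x w).
  have wV x : closed_orthant x -> wint P W (fun u => s^-1 * fg x u) (fun w => s^-1 * Y x w).
    by move=> ox; exact: (wintZ whiteW _ (wY ox)).
  split; first by split.
  - exact: (wint_gaussian_process whiteW wV).
  - move=> x ox; rewrite expectation_L2; last by apply: L2Z; exact: L2_Y.
    by rewrite (wint_mean whiteW (wV x ox)).
  - move=> x y ox oy; rewrite (expectation_mul (L2Z _ (L2_Y ox)) (L2Z _ (L2_Y oy))).
    rewrite (ipZl _ (L2_Y ox) (L2Z _ (L2_Y oy))) (ipZr _ (L2_Y oy) (L2_Y ox)) ip_Y// covD//.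
    by rewrite /F /fbm_cov; congr EFin; field.
move=> d' T' P' B [_ gB cB covB].
have LB := gaussian_process_L2 gB (fun t Dt => covB t t Dt Dt).
apply: (wint_fdd_eq_gaussian whiteW wY).
- move=> n t a Dt; have := gB n t (fun i => a i * s) Dt.
  by congr gaussian_rv; apply/funext => w; apply: eq_bigr => i _; rewrite mulrA.
- move=> x ox; have := cB x ox; rewrite !expectation_L2; [|exact: L2Z (LB x ox)|exact: LB].
  move=> [e]; rewrite ipZl ?e ?mulr0//; [exact: LB|exact: L2_cst].
- move=> x y ox oy; rewrite (expectation_mul (L2Z _ (LB x ox)) (L2Z _ (LB y oy))).
  rewrite (ipZl _ (LB x ox) (L2Z _ (LB y oy))) (ipZr _ (LB y oy) (LB x ox)).
  have := covB x y ox oy; rewrite (expectation_mul (LB x ox) (LB y oy)) => -[->].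
  rewrite [in RHS]ip_fg covD//; congr EFin.
  by rewrite /F /fbm_cov mulrA -expr2 mulrC.
Qed.

End fractional_brownian_sheets.

(** * Self-similarity and its exponents *)

Section self_similarity.
Context {R : realType}.

Lemma powR_expR (a r : R) : expR a `^ r = expR (r * a).
Proof. by rewrite /powR gt_eqF ?expR_gt0// expRK. Qed.

(** [p * A] lies strictly between 1/2 and 1. For [H1], [H2], [H3] the two hypotheses are the two
    inequalities of the region, rearranged. *)
Lemma hurst_bounds (p A : R) : 0 < p -> 1 / (2 * p) < A -> A < 1 / p ->
  0 < 3 / 2 - p * A <= 1.
Proof.
move=> p0; rewrite ltr_pdivrMr ?mulr_gt0// ltr_pdivlMr// => h1 h2.
have : A * p = p * A by exact: mulrC.
move: h1 h2; rewrite mulrCA => h1 h2 e; rewrite e in h1 h2.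
by move: (p * A) h1 h2 => z h1 h2; apply/andP; split; lra.
Qed.

Lemma pos_expR (a : R) : 0 < a -> exists b, a = expR b.
Proof. by move=> a0; exists (ln a); rewrite lnK. Qed.

Context (q c : R3 R) (nu : R).
Hypotheses (hq : open_orthant q) (hc : open_orthant c) (hnu : 0 < nu).

(** Each summand inside the power [nu] picks up the same factor [k ^ (1 / nu)]. *)
Lemma rho_dilate (k z1 z2 z3 : R) : 0 < k ->
  rho q c nu (k `^ (1 / co1 q) * z1) (k `^ (1 / co2 q) * z2) (k `^ (1 / co3 q) * z3) =
  k * rho q c nu z1 z2 z3.
Proof.
move=> k0; case: hq => q1 q2 q3; case: hc => c1 c2 c3.
have e p z : 0 < p -> `|k `^ (1 / p) * z| `^ (p / nu) = k `^ nu^-1 * `|z| `^ (p / nu).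
  move=> p0; rewrite normrM powRM// ger0_norm ?powR_ge0// -powRrM.
  by congr (_ `^ _ * _); field; rewrite !gt_eqF.
rewrite /rho !e// !(mulrCA _ (k `^ nu^-1)) -!mulrDr powRM ?powR_ge0//; last first.
  by rewrite !addr_ge0// mulr_ge0 ?powR_ge0// ltW.
by rewrite -powRrM mulVf ?gt_eqF// powRr1// ltW.
Qed.

Let dil (k : R) : R3 R := (k `^ (1 / co1 q), k `^ (1 / co2 q), k `^ (1 / co3 q)).

Let dil_pos k : 0 < k -> open_orthant (dil k).
Proof. by move=> k0; split; exact: powR_gt0. Qed.

Let dil1 (l p : R) : 0 < l -> 0 < p -> l = (l `^ p) `^ (1 / p).
Proof. by move=> l0 p0; rewrite -powRrM mul1r divff ?gt_eqF// powRr1// ltW. Qed.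

Context d (T : measurableType d) (P : probability T R) (W : set (R3 R) -> T -> R).
Hypothesis whiteW : white_noise P W.

Section generic.
Context (k1 k2 k3 : axis_kind) (reg : kind_region q k1 k2 k3).
Variable Y : R3 R -> T -> R.
Hypothesis wY : is_box_field q c nu P W k1 k2 k3 Y.

(** All six exponents can be read off here. As a power of [kap], a [Conv] axis contributes
    [3 / (2 q_j)]: [1 / q_j] from [dt_j] and half as much from [W(du)]. A [White] axis contributes
    [1 / q_j] from [dt_j], and the square root of its box scale; a [Flat] axis [1 / (2 q_j)] from
    [W(du)], and its whole box scale. The inverse of [rho] contributes [-1]. *)
Lemma dilation_scaling (l : R3 R) (kap S : R) : open_orthant l -> 0 < kap ->
  (k1 = Conv -> co1 l = kap `^ (1 / co1 q)) -> (k2 = Conv -> co2 l = kap `^ (1 / co2 q)) ->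
  (k3 = Conv -> co3 l = kap `^ (1 / co3 q)) ->
  S ^+ 2 = u_scale k1 (co1 l) (kap `^ (1 / co1 q)) * u_scale k2 (co2 l) (kap `^ (1 / co2 q)) *
           u_scale k3 (co3 l) (kap `^ (1 / co3 q)) *
           (t_scale k1 (co1 l) (kap `^ (1 / co1 q)) * t_scale k2 (co2 l) (kap `^ (1 / co2 q)) *
            t_scale k3 (co3 l) (kap `^ (1 / co3 q)) / kap) ^+ 2 ->
  (forall x y, cov0 q c nu k1 k2 k3 (scale3 (co1 l) (co2 l) (co3 l) x)
                 (scale3 (co1 l) (co2 l) (co3 l) y) = S ^+ 2 * cov0 q c nu k1 k2 k3 x y) /\
  fdd_eq closed_orthant P P (fun x => Y (scale3 (co1 l) (co2 l) (co3 l) x))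
    (fun x w => S * Y x w).
Proof.
move=> hl k0 v1 v2 v3 SE.
exact: (box_field_scaling hq hc hnu reg whiteW wY hl (dil_pos k0) k0 v1 v2 v3
  (fun z1 z2 z3 => rho_dilate z1 z2 z3 k0) SE).
Qed.

End generic.
Lemma scaling1 Y : region1 q -> is_box_field q c nu P W Conv White White Y ->
  forall l1 l2 l3 : R, 0 < l1 -> 0 < l2 -> 0 < l3 ->
  (forall x y, cov0 q c nu Conv White White (scale3 l1 l2 l3 x)
                 (scale3 l1 l2 l3 y) =
     (l1 `^ H1 q * l2 `^ (1 / 2) * l3 `^ (1 / 2)) ^+ 2 * cov0 q c nu Conv White White x y) /\
  fdd_eq closed_orthant P P
    (fun x => Y (scale3 l1 l2 l3 x))
    (fun x w => l1 `^ H1 q * l2 `^ (1 / 2) * l3 `^ (1 / 2) * Y x w).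
Proof.
move=> /region1_kind reg wY l1 l2 l3 l10 l20 l30; case: (hq) => q1 q2 q3.
(* The only [Conv] axis forces [l1 = kap ^ (1 / q1)], which determines [kap]; [l2] and [l3] remain
   free. *)
apply: (dilation_scaling reg wY
  (l := (l1, l2, l3))
  (kap := l1 `^ co1 q)) => [|||||].
- by split; rewrite /co1 /co2 /co3/= ?powR_gt0.
- by rewrite ?powR_gt0.
- by move=> _; exact: dil1.
- by [].
- by [].
rewrite /u_scale /t_scale /co1 /co2 /co3 /= -/(co1 q) -/(co2 q) -/(co3 q).
(* With the parameters written as exponentials, the identity between products of powers becomes one
   between exponents. *)
have [a ->] := pos_expR l10; have [b ->] := pos_expR l20; have [e ->] := pos_expR l30.
rewrite /H1 !powR_expR !expr2 -expRN -!expRD.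
by congr expR; field; rewrite !gt_eqF.
Qed.

Lemma scaling2 Y : region2 q -> is_box_field q c nu P W Flat Conv White Y ->
  forall l1 l2 l3 : R, 0 < l1 -> 0 < l2 -> 0 < l3 ->
  (forall x y, cov0 q c nu Flat Conv White (scale3 l1 l2 l3 x)
                 (scale3 l1 l2 l3 y) =
     (l1 * l2 `^ H2 q * l3 `^ (1 / 2)) ^+ 2 * cov0 q c nu Flat Conv White x y) /\
  fdd_eq closed_orthant P P
    (fun x => Y (scale3 l1 l2 l3 x))
    (fun x w => l1 * l2 `^ H2 q * l3 `^ (1 / 2) * Y x w).
Proof.
move=> /region2_kind reg wY l1 l2 l3 l10 l20 l30; case: (hq) => q1 q2 q3.
apply: (dilation_scaling reg wY
  (l := (l1, l2, l3))
  (kap := l2 `^ co2 q)) => [|||||].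
- by split; rewrite /co1 /co2 /co3/= ?powR_gt0.
- by rewrite ?powR_gt0.
- by [].
- by move=> _; exact: dil1.
- by [].
rewrite /u_scale /t_scale /co1 /co2 /co3 /= -/(co1 q) -/(co2 q) -/(co3 q).
have [a ->] := pos_expR l10; have [b ->] := pos_expR l20; have [e ->] := pos_expR l30.
rewrite /H2 !powR_expR !expr2 -expRN -!expRD.
by congr expR; field; rewrite !gt_eqF.
Qed.

Lemma scaling3 Y : region3 q -> is_box_field q c nu P W Flat Flat Conv Y ->
  forall l1 l2 l3 : R, 0 < l1 -> 0 < l2 -> 0 < l3 ->
  (forall x y, cov0 q c nu Flat Flat Conv (scale3 l1 l2 l3 x)
                 (scale3 l1 l2 l3 y) =
     (l1 * l2 * l3 `^ H3 q) ^+ 2 * cov0 q c nu Flat Flat Conv x y) /\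
  fdd_eq closed_orthant P P
    (fun x => Y (scale3 l1 l2 l3 x))
    (fun x w => l1 * l2 * l3 `^ H3 q * Y x w).
Proof.
move=> /region3_kind reg wY l1 l2 l3 l10 l20 l30; case: (hq) => q1 q2 q3.
apply: (dilation_scaling reg wY
  (l := (l1, l2, l3))
  (kap := l3 `^ co3 q)) => [|||||].
- by split; rewrite /co1 /co2 /co3/= ?powR_gt0.
- by rewrite ?powR_gt0.
- by [].
- by [].
- by move=> _; exact: dil1.
rewrite /u_scale /t_scale /co1 /co2 /co3 /= -/(co1 q) -/(co2 q) -/(co3 q).
have [a ->] := pos_expR l10; have [b ->] := pos_expR l20; have [e ->] := pos_expR l30.
rewrite /H3 !powR_expR !expr2 -expRN -!expRD.
by congr expR; field; rewrite !gt_eqF.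
Qed.

Lemma scaling12 Y : region12 q -> is_box_field q c nu P W Conv Conv White Y ->
  forall l m : R, 0 < l -> 0 < m ->
  (forall x y, cov0 q c nu Conv Conv White (scale3 (l `^ (1 / co1 q)) (l `^ (1 / co2 q)) m x)
                 (scale3 (l `^ (1 / co1 q)) (l `^ (1 / co2 q)) m y) =
     (l `^ H12 q * m `^ (1 / 2)) ^+ 2 * cov0 q c nu Conv Conv White x y) /\
  fdd_eq closed_orthant P P
    (fun x => Y (scale3 (l `^ (1 / co1 q)) (l `^ (1 / co2 q)) m x))
    (fun x w => l `^ H12 q * m `^ (1 / 2) * Y x w).
Proof.
move=> /region12_kind reg wY l m l0 m0; case: (hq) => q1 q2 q3.
apply: (dilation_scaling reg wY
  (l := (l `^ (1 / co1 q), l `^ (1 / co2 q), m))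
  (kap := l)) => [|||||].
- by split; rewrite /co1 /co2 /co3/= ?powR_gt0.
- by rewrite ?powR_gt0.
- by [].
- by [].
- by [].
rewrite /u_scale /t_scale /co1 /co2 /co3 /= -/(co1 q) -/(co2 q) -/(co3 q).
have [a ->] := pos_expR l0; have [b ->] := pos_expR m0.
rewrite /H12 !powR_expR !expr2 -expRN -!expRD.
by congr expR; field; rewrite !gt_eqF.
Qed.

Lemma scaling23 Y : region23 q -> is_box_field q c nu P W Flat Conv Conv Y ->
  forall l m : R, 0 < l -> 0 < m ->
  (forall x y, cov0 q c nu Flat Conv Conv (scale3 l (m `^ (1 / co2 q)) (m `^ (1 / co3 q)) x)
                 (scale3 l (m `^ (1 / co2 q)) (m `^ (1 / co3 q)) y) =
     (l * m `^ H23 q) ^+ 2 * cov0 q c nu Flat Conv Conv x y) /\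
  fdd_eq closed_orthant P P
    (fun x => Y (scale3 l (m `^ (1 / co2 q)) (m `^ (1 / co3 q)) x))
    (fun x w => l * m `^ H23 q * Y x w).
Proof.
move=> /region23_kind reg wY l m l0 m0; case: (hq) => q1 q2 q3.
apply: (dilation_scaling reg wY
  (l := (l, m `^ (1 / co2 q), m `^ (1 / co3 q)))
  (kap := m)) => [|||||].
- by split; rewrite /co1 /co2 /co3/= ?powR_gt0.
- by rewrite ?powR_gt0.
- by [].
- by [].
- by [].
rewrite /u_scale /t_scale /co1 /co2 /co3 /= -/(co1 q) -/(co2 q) -/(co3 q).
have [a ->] := pos_expR l0; have [b ->] := pos_expR m0.
rewrite /H23 !powR_expR !expr2 -expRN -!expRD.
by congr expR; field; rewrite !gt_eqF.
Qed.

Lemma scaling0 Y : region0 q -> is_box_field q c nu P W Conv Conv Conv Y ->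
  forall l : R, 0 < l ->
  (forall x y, cov0 q c nu Conv Conv Conv
                 (scale3 (l `^ (1 / co1 q)) (l `^ (1 / co2 q)) (l `^ (1 / co3 q)) x)
                 (scale3 (l `^ (1 / co1 q)) (l `^ (1 / co2 q)) (l `^ (1 / co3 q)) y) =
     (l `^ H0 q) ^+ 2 * cov0 q c nu Conv Conv Conv x y) /\
  fdd_eq closed_orthant P P
    (fun x => Y (scale3 (l `^ (1 / co1 q)) (l `^ (1 / co2 q)) (l `^ (1 / co3 q)) x))
    (fun x w => l `^ H0 q * Y x w).
Proof.
move=> /region0_kind reg wY l l0; case: (hq) => q1 q2 q3.
apply: (dilation_scaling reg wY
  (l := (l `^ (1 / co1 q), l `^ (1 / co2 q), l `^ (1 / co3 q)))
  (kap := l)) => [|||||].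
- by split; rewrite /co1 /co2 /co3/= ?powR_gt0.
- by rewrite ?powR_gt0.
- by [].
- by [].
- by [].
rewrite /u_scale /t_scale /co1 /co2 /co3 /= -/(co1 q) -/(co2 q) -/(co3 q).
have [a ->] := pos_expR l0.
rewrite /H0 !powR_expR !expr2 -expRN -!expRD.
by congr expR; field; rewrite !gt_eqF.
Qed.

End self_similarity.

(** * The three sheets and the conclusion *)

Section sheets.
Context {R : realType} (q c : R3 R) (nu : R).
Hypotheses (hq : open_orthant q) (hc : open_orthant c) (hnu : 0 < nu).
Context d (T : measurableType d) (P : probability T R) (W : set (R3 R) -> T -> R).
Hypothesis whiteW : white_noise P W.
Variable Y : R3 R -> T -> R.

Let sqr_powR (r h : R) : (r `^ h) ^+ 2 = r `^ (2 * h).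
Proof. by rewrite -powR_mulrn ?powR_ge0// -powRrM mulrC. Qed.

Let sqr_powR1 (r : R) : 0 < r -> r ^+ 2 = r `^ (2 * 1).
Proof. by move=> r0; rewrite mulr1 (@powR_mulrn _ r 2)// ltW. Qed.

Let half : 0 < (1 / 2 : R) <= 1. Proof. by apply/andP; split; lra. Qed.
Let unit1 : 0 < (1 : R) <= 1. Proof. by rewrite ltr01 lexx. Qed.

Lemma Y1_fBs : region1 q -> is_Y1 P W q c nu Y ->
  fdd_eq_fBs P Y (sigma P Y) (H1 q) (1 / 2) (1 / 2).
Proof.
move=> r1 /(Y1_box hq hc hnu whiteW r1) wY; have reg := region1_kind r1.
have h1 : 0 < H1 q <= 1.
  case: hq => q1 _ _; case/andP: r1 => a b.
  by apply: hurst_bounds => //; [move: a|move: b]; move: (1 / _) (1 / _) (1 / _) => *; lra.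
have sw2 : swaps2 (cov0 q c nu Conv White White) by exact: white_swaps2.
have sw3 : swaps3 (cov0 q c nu Conv White White) by exact: white_swaps3.
apply: (box_field_fBs hq hc hnu reg whiteW wY h1 half half _ sw2 sw3).
  by apply: (swaps23 _ sw2 sw3) => x y; exact: cov_sym.
move=> l1 l2 l3 x y l10 l20 l30.
by rewrite (scaling1 hq hc hnu whiteW r1 wY l10 l20 l30).1 !exprMn !sqr_powR.
Qed.

Lemma Y2_fBs : region2 q -> is_Y2 P W q c nu Y ->
  fdd_eq_fBs P Y (sigma P Y) 1 (H2 q) (1 / 2).
Proof.
move=> r2 /(Y2_box hq hc hnu whiteW r2) wY; have reg := region2_kind r2.
have h2 : 0 < H2 q <= 1.
  case: hq => _ q2 _; case/andP: r2 => a b.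
  by apply: hurst_bounds => //; [move: a|move: b]; move: (1 / _) (1 / _) (1 / _) => *; lra.
have sw1 : swaps1 (cov0 q c nu Flat Conv White) by exact: flat_swaps1.
have sw3 : swaps3 (cov0 q c nu Flat Conv White) by exact: white_swaps3.
apply: (box_field_fBs hq hc hnu reg whiteW wY unit1 h2 half sw1 _ sw3).
  by apply: (swaps13 _ sw1 sw3) => x y; exact: cov_sym.
move=> l1 l2 l3 x y l10 l20 l30.
by rewrite (scaling2 hq hc hnu whiteW r2 wY l10 l20 l30).1 !exprMn !sqr_powR sqr_powR1.
Qed.

Lemma Y3_fBs : region3 q -> is_Y3 P W q c nu Y ->
  fdd_eq_fBs P Y (sigma P Y) 1 1 (H3 q).
Proof.
move=> r3 /(Y3_box hq hc hnu whiteW r3) wY; have reg := region3_kind r3.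
have h3 : 0 < H3 q <= 1.
  case: hq => _ _ q3; case/andP: r3 => a b.
  by apply: hurst_bounds => //; [move: a|move: b]; move: (1 / _) (1 / _) (1 / _) => *; lra.
have sw1 : swaps1 (cov0 q c nu Flat Flat Conv) by exact: flat_swaps1.
have sw2 : swaps2 (cov0 q c nu Flat Flat Conv) by exact: flat_swaps2.
apply: (box_field_fBs hq hc hnu reg whiteW wY unit1 unit1 h3 sw1 sw2).
  by apply: (swaps12 _ sw1 sw2) => x y; exact: cov_sym.
move=> l1 l2 l3 x y l10 l20 l30.
by rewrite (scaling3 hq hc hnu whiteW r3 wY l10 l20 l30).1 !exprMn !sqr_powR !sqr_powR1.
Qed.

End sheets.

Theorem theorem3p1 (R : realType) (q c : R3 R) (nu : R)
    (hq : open_orthant q) (hc : open_orthant c) (hnu : 0 < nu) :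
  (* (i) *)
  ((region1 q -> well_defined (g1 q c nu)) /\
   (region2 q -> well_defined (g2 q c nu)) /\
   (region3 q -> well_defined (g3 q c nu)) /\
   (region12 q -> well_defined (g12 q c nu)) /\
   (region23 q -> well_defined (g23 q c nu)) /\
   (region0 q -> well_defined (g0 q c nu)))
  /\
  forall (d : measure_display) (T : measurableType d) (P : probability T R)
    (W : set (R3 R) -> T -> R), white_noise P W ->
  (* (ii) *)
  ((region1 q -> forall Y, is_Y1 P W q c nu Y ->
      stationary_rect_increments P Y /\
      forall l1 l2 l3 : R, 0 < l1 -> 0 < l2 -> 0 < l3 ->
        fdd_eq closed_orthant P P
          (fun x => Y (scale3 l1 l2 l3 x))
          (fun x w => l1 `^ H1 q * l2 `^ (1 / 2) * l3 `^ (1 / 2) * Y x w)) /\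
   (region2 q -> forall Y, is_Y2 P W q c nu Y ->
      stationary_rect_increments P Y /\
      forall l1 l2 l3 : R, 0 < l1 -> 0 < l2 -> 0 < l3 ->
        fdd_eq closed_orthant P P
          (fun x => Y (scale3 l1 l2 l3 x))
          (fun x w => l1 * l2 `^ H2 q * l3 `^ (1 / 2) * Y x w)) /\
   (region3 q -> forall Y, is_Y3 P W q c nu Y ->
      stationary_rect_increments P Y /\
      forall l1 l2 l3 : R, 0 < l1 -> 0 < l2 -> 0 < l3 ->
        fdd_eq closed_orthant P P
          (fun x => Y (scale3 l1 l2 l3 x))
          (fun x w => l1 * l2 * l3 `^ H3 q * Y x w)) /\
   (region12 q -> forall Y, is_Y12 P W q c nu Y ->
      stationary_rect_increments P Y /\
      forall l m : R, 0 < l -> 0 < m ->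
        fdd_eq closed_orthant P P
          (fun x => Y (scale3 (l `^ (1 / co1 q)) (l `^ (1 / co2 q)) m x))
          (fun x w => l `^ H12 q * m `^ (1 / 2) * Y x w)) /\
   (region23 q -> forall Y, is_Y23 P W q c nu Y ->
      stationary_rect_increments P Y /\
      forall l m : R, 0 < l -> 0 < m ->
        fdd_eq closed_orthant P P
          (fun x => Y (scale3 l (m `^ (1 / co2 q)) (m `^ (1 / co3 q)) x))
          (fun x w => l * m `^ H23 q * Y x w)) /\
   (region0 q -> forall Y, is_Y0 P W q c nu Y ->
      stationary_rect_increments P Y /\
      forall l : R, 0 < l ->
        fdd_eq closed_orthant P P
          (fun x => Y (scale3 (l `^ (1 / co1 q)) (l `^ (1 / co2 q))
                              (l `^ (1 / co3 q)) x))
          (fun x w => l `^ H0 q * Y x w)))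
  /\
  (* (iii) *)
  ((region1 q -> forall Y, is_Y1 P W q c nu Y ->
      fdd_eq_fBs P Y (sigma P Y) (H1 q) (1 / 2) (1 / 2)) /\
   (region2 q -> forall Y, is_Y2 P W q c nu Y ->
      fdd_eq_fBs P Y (sigma P Y) 1 (H2 q) (1 / 2)) /\
   (region3 q -> forall Y, is_Y3 P W q c nu Y ->
      fdd_eq_fBs P Y (sigma P Y) 1 1 (H3 q))).
Proof.
split; first exact: kernels_well_defined.
move=> d T P W whiteW; split.
  split; [|split; [|split; [|split; [|split]]]] => r Y HY.
  - have wY := Y1_box hq hc hnu whiteW r HY; split.
      exact: (box_field_stationary hq hc hnu (region1_kind r) whiteW wY).
    by move=> l1 l2 l3 p1 p2 p3; exact: (scaling1 hq hc hnu whiteW r wY p1 p2 p3).2.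
  - have wY := Y2_box hq hc hnu whiteW r HY; split.
      exact: (box_field_stationary hq hc hnu (region2_kind r) whiteW wY).
    by move=> l1 l2 l3 p1 p2 p3; exact: (scaling2 hq hc hnu whiteW r wY p1 p2 p3).2.
  - have wY := Y3_box hq hc hnu whiteW r HY; split.
      exact: (box_field_stationary hq hc hnu (region3_kind r) whiteW wY).
    by move=> l1 l2 l3 p1 p2 p3; exact: (scaling3 hq hc hnu whiteW r wY p1 p2 p3).2.
  - have wY := Y12_box hq hc hnu whiteW r HY; split.
      exact: (box_field_stationary hq hc hnu (region12_kind r) whiteW wY).
    by move=> l m p1 p2; exact: (scaling12 hq hc hnu whiteW r wY p1 p2).2.
  - have wY := Y23_box hq hc hnu whiteW r HY; split.
      exact: (box_field_stationary hq hc hnu (region23_kind r) whiteW wY).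
    by move=> l m p1 p2; exact: (scaling23 hq hc hnu whiteW r wY p1 p2).2.
  - have wY := Y0_box hq hc hnu whiteW r HY; split.
      exact: (box_field_stationary hq hc hnu (region0_kind r) whiteW wY).
    by move=> l p1; exact: (scaling0 hq hc hnu whiteW r wY p1).2.
split; [|split] => r Y HY.
- exact: (Y1_fBs hq hc hnu whiteW r HY).
- exact: (Y2_fBs hq hc hnu whiteW r HY).
- exact: (Y3_fBs hq hc hnu whiteW r HY).
Qed.
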